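(* Let $\Delta$ be a Euclidean building of one of the types $A_n, B_n, C_n$, with a standard ordering. Let $\mathcal{C}$ be the associated combing and let $\mathcal{C}'$ be the family of all edge paths in $\Delta^{(1)}$ in which any pair of consecutive directed edges $e_1,e_2$ (these being quasi-special) is of one of the following two kinds: 1) $\{e_1,e_2\}$ is straight, that is, the angle between $e_1$ and $e_2$ (at their common vertex) is equal to $\pi$, and hence $e_1\cup e_2$ is a line segment of length 2 in the edge path metric; or 2) the type $i$ of $e_1$ is strictly less than the type $j$ of $e_2$, the end of $e_1$ (= the origin of $e_2$) is a special vertex, and $(e_1,e_2)=\left(\frac{1}{c_i}\bar\omega_i^\vee,\frac{1}{c_j}\bar\omega_j^\vee\right)$. Then $\mathcal{C}$ and $\mathcal{C}'$ coincide.
   Context: **Root systems and Coxeter complexes.** Let $\Phi$ be a reduced, irreducible, crystallographic root system spanning a Euclidean space $V$ of dimension $n$, with Weyl group $W$. Let $\mathbb{Z}\Phi^\#=\{\lambda\in V: (\lambda,\alpha)\in\mathbb{Z}\ \forall \alpha\in\Phi\}$ be the coweight lattice. For $\alpha\in\Phi,k\in\mathbb{Z}$ let $H_{\alpha,k}=\{\lambda\in V:(\lambda,\alpha)=k\}$ (the walls). The walls triangulate $V$; the resulting piecewise Euclidean simplicial complex is $\Sigma_\Phi$, and its top-dimensional closed simplices are called alcoves. The extended affine Weyl group $\widehat{W_a}=\mathbb{Z}\Phi^\#\rtimes W$ acts on $\Sigma_\Phi$ by simplicial isometries. A Euclidean Coxeter complex is a simplicial structure $\Sigma$ on a Euclidean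 space $V'$ that is the image of some $\Sigma_\Phi$ under an affine isometry $V\to V'$; all notions are transported by this isometry. A vertex $x$ is special if for every wall there is a parallel wall passing through $x$. **Buildings.** A Euclidean building is a simplicial piecewise Euclidean complex $\Delta$ that is the union of a family of subcomplexes (apartments) such that: (B0) there is a Euclidean Coxeter complex $\Sigma_0$ such that each apartment is simplicially isometric to $\Sigma_0$; (B1) any two simplices of $\Delta$ lie in a common apartment; (B2) if two apartments $\Sigma,\Sigma'$ share a top-dimensional simplex, there is an isomorphism (simplicial isometry) $\Sigma\to\Sigma'$ fixing $\Sigma\cap\Sigma'$ pointwise. $\Delta$ is of type $A_n,B_n,C_n$ if $\Sigma_0\cong\Sigma_\Phi$ (simplicially isometric) with $\Phi$ of that type; fix this $\Phi$. $\Delta^{(1)}$ is the 1-skeleton of $\Delta$. A vertex of $\Delta$ is special if it is special in some (equivalently any) apartment containing it. **Orderings.** A directed edge of $\Delta^{(1)}$ is special if its origin is a special vertex, and quasi-special if it lies on a line segment $[x,y]\subset\Delta^{(1)}$ with $x,y$ special vertices. Special edges are quasi-special. An ordering of a Euclidean Coxeter complex $\Sigma$ of dimension $n$ is a function $\tau$ from the set of quasi-special edges to $\{1,\dots,n\}$ such that: 1) for each alcove $\langle x,x_1,\dots,x_n\rangle$ with $x$ a special vertex, $\tau$ is bijective on $\{[x,x_1],\dots,[x,x_n]\}$; 2) $\tau$ is $\widehat{W_a}$-invariant; 3) for any line segment $[x,y]\subset\Sigma^{(1)}$ with special end points, $\tau$ is constant on the quasi-special edges lying on $[x,y]$ and directed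 from $x$ to $y$. An ordering of a Euclidean building $\Delta$ of dimension $n$ is a function from its quasi-special edges to $\{1,\dots,n\}$ restricting to an ordering on each apartment; $\tau(e)$ is the type of $e$. An ordering is determined by its values on the edges of one alcove starting at one special vertex of it, and these may be prescribed by an arbitrary bijection. **Standard ordering.** Let $\Pi=\{\alpha_1,\dots,\alpha_n\}$ be a simple system numbered as in Bourbaki: $A_n$: $\alpha_i=\varepsilon_{i-1}-\varepsilon_i$ ($1\le i\le n$) in $\mathbb{R}^{n+1}$ with basis $\varepsilon_0,\dots,\varepsilon_n$; $B_n$ ($n\ge2$): $\alpha_i=\varepsilon_i-\varepsilon_{i+1}$ ($i<n$), $\alpha_n=\varepsilon_n$; $C_n$ ($n\ge2$): $\alpha_i=\varepsilon_i-\varepsilon_{i+1}$ ($i<n$), $\alpha_n=2\varepsilon_n$. Let $\bar\omega_1^\vee,\dots,\bar\omega_n^\vee$ be the dual basis, $(\bar\omega_i^\vee,\alpha_j)=\delta_{ij}$ (fundamental coweights), and $\tilde\alpha=\sum c_i\alpha_i$ the highest root. The standard alcove of $\Sigma_\Phi$ has vertices $0$ and $\bar\omega_i^\vee/c_i$. The standard ordering of the building is the ordering obtained by identifying an apartment simplicially and isometrically with $\Sigma_\Phi$ and giving the edge $[0,\bar\omega_i^\vee/c_i]$ the type $i$. **Scalar product of edges.** In 2), $(e_1,e_2)$ is the scalar product of the vectors (end point minus origin) of the directed edges $e_1,e_2$ computed in an apartment containing both, and the right-hand side is the scalar product in $V$. **The combing $\mathcal{C}$.** Let $x,y$ be special vertices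 of $\Delta$. Choose an apartment $\Sigma$ containing $x,y$ and regard it as a vector space with origin $x$. The walls through $x$ cut $\Sigma$ into closed simplicial cones (sectors) based at $x$; choose a sector $S$ containing $y$. Let $\langle x,x_1,\dots,x_n\rangle$ be the unique alcove in $S$ having $x$ as a vertex, numbered so that the edge $e_i=[x,x_i]$ has type $i$. Then $S=\sum\mathbb{R}_+e_i$ and $y=\sum m_ie_i$ with all $m_i\ge0$. Let $\alpha_{xy}$ be the concatenation, in this order, of the segments $[0,m_1e_1],[m_1e_1,m_1e_1+m_2e_2],\dots,[\sum_{i\le n-1}m_ie_i,\sum_{i\le n}m_ie_i]$; it is an edge path in $\Delta^{(1)}$ depending only on $x,y$. $\mathcal{C}$ consists of all $\alpha_{xy}$ ($x,y$ special vertices) together with all their prefix subpaths in $\Delta^{(1)}$.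
   Formalization: The family C' is restricted to edge paths whose origin is a special vertex; without this the claim fails for types B_n and C_n, e.g. a single edge (or trivial path) starting at a non-special vertex satisfies the pair condition vacuously but is not in C. *)

(* Defs.v *)
From HB Require Import structures.
From mathcomp Require Import all_boot all_order all_algebra.
From mathcomp Require Import mathcomp_extra boolp classical_sets functions.
From mathcomp Require Import cardinality reals trigo.

Set Implicit Arguments.
Unset Strict Implicit.
Unset Printing Implicit Defensive.
Import Order.TTheory GRing.Theory Num.Theory.
Local Open Scope classical_set_scope.
Local Open Scope ring_scope.

Definition dot (R : realType) (m : nat) (u v : 'rV[R]_m) : R :=
  \sum_j u 0 j * v 0 j.

Definition enorm (R : realType) (m : nat) (u : 'rV[R]_m) : R :=
  Num.sqrt (dot u u).

Definition angle (R : realType) (m : nat) (u v : 'rV[R]_m) : R :=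
  acos (dot u v / (enorm u * enorm v)).

Definition segment (R : realType) (m : nat) (x y : 'rV[R]_m) : set 'rV[R]_m :=
  [set (1 - t) *: x + t *: y | t in [set t : R | 0 <= t <= 1]].

(** * Piecewise Euclidean simplicial complexes *)

(* A simplex is represented by its set of vertices and its Euclidean metric by
   the lengths of its edges, which determine it up to isometry.  The vertices
   of the complex are the elements of its simplices: the other elements of the
   carrier, and the values of [elen] on pairs that do not span a simplex, are
   irrelevant.  A complex and its subcomplexes thus share the same carrier. *)
Record pecomplex (R : realType) := PEComplex {
  vertex :> Type;
  simplices : set (set vertex);
  elen : vertex -> vertex -> R }.
Arguments simplices {R} K : rename.
Arguments elen {R} K x y : rename.

Definition vertices (R : realType) (K : pecomplex R) : set K :=
  \bigcup_(s in simplices K) s.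
Arguments vertices {R} K.

Definition face_closed (T : Type) (S : set (set T)) : Prop :=
  forall s t, S s -> t `<=` s -> t !=set0 -> S t.

(* The second clause says that the prescribed lengths make every simplex an
   isometric copy of a nondegenerate simplex with vertices p_0, ..., p_k in
   R^k. *)
Definition is_pecomplex (R : realType) (K : pecomplex R) : Prop :=
  face_closed (simplices K) /\
  forall s, simplices K s ->
    exists (k : nat) (v : 'I_k.+1 -> K) (p : 'I_k.+1 -> 'rV[R]_k),
      [/\ s = range v, injective v,
          free [seq p (lift ord0 i) - p ord0 | i <- enum 'I_k]
        & forall i j, elen K (v i) (v j) = enorm (p i - p j)].

Definition subcomplex (R : realType) (K : pecomplex R) (S : set (set K)) :
  pecomplex R := PEComplex S (elen K).

Definition is_subcomplex (R : realType) (K : pecomplex R) (S : set (set K)) :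
  Prop := S `<=` simplices K /\ face_closed S.

(* The underlying map on vertices; its affine extension to every simplex is an
   isometry because it preserves the lengths of the edges. *)
Definition simplicial_isometry (R : realType) (K L : pecomplex R) (f : K -> L) :
  Prop :=
  [/\ {in vertices K &, injective f},
      [set f @` s | s in simplices K] = simplices L
    & forall s x y, simplices K s -> s x -> s y ->
        elen L (f x) (f y) = elen K x y].

Definition edge (R : realType) (K : pecomplex R) (x y : K) : Prop :=
  x <> y /\ simplices K [set x; y].

Definition top_simplex (R : realType) (K : pecomplex R) (s : set K) : Prop :=
  simplices K s /\ forall t, simplices K t -> (t #<= s)%card.
Arguments edge {R} K x y.
Arguments top_simplex {R} K s.

(** * The Coxeter complex of a root system *)

(* The root system is given by the list [Phi] of its roots in R^m; it spans
   the Euclidean space V = <<Phi>>. *)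

Definition wall (R : realType) (m : nat) (Phi : seq 'rV[R]_m)
    (alpha : 'rV[R]_m) (k : int) : set 'rV[R]_m :=
  [set v | v \in <<Phi>>%VS /\ dot v alpha = k%:~R].

Definition parallel (R : realType) (m : nat) (H H' : set 'rV[R]_m) : Prop :=
  exists t, H' = [set t + v | v in H].

(* The points on the same closed side as p of each wall, i.e. the closed cell
   of the triangulation whose relative interior contains p. *)
Definition closed_cell (R : realType) (m : nat) (Phi : seq 'rV[R]_m)
    (p : 'rV[R]_m) : set 'rV[R]_m :=
  [set q | q \in <<Phi>>%VS /\
     forall alpha (k : int), alpha \in Phi ->
       (dot p alpha <= k%:~R -> dot q alpha <= k%:~R) /\
       (k%:~R <= dot p alpha -> k%:~R <= dot q alpha)].

Definition cell_vertex (R : realType) (m : nat) (Phi : seq 'rV[R]_m)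
    (p : 'rV[R]_m) : Prop :=
  p \in <<Phi>>%VS /\ closed_cell Phi p = [set p].

Definition coxeter_complex (R : realType) (m : nat) (Phi : seq 'rV[R]_m) :
    pecomplex R :=
  @PEComplex R 'rV[R]_m
    [set closed_cell Phi p `&` cell_vertex Phi | p in [set` <<Phi>>%VS]]
    (fun p q => enorm (p - q)).

Definition special (R : realType) (m : nat) (Phi : seq 'rV[R]_m)
    (x : 'rV[R]_m) : Prop :=
  cell_vertex Phi x /\
  forall alpha (k : int), alpha \in Phi ->
    exists beta (l : int),
      [/\ beta \in Phi, parallel (wall Phi alpha k) (wall Phi beta l)
        & wall Phi beta l x].

Definition skeleton1 (R : realType) (m : nat) (Phi : seq 'rV[R]_m) :
    set 'rV[R]_m :=
  [set q | exists a b,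
     simplices (coxeter_complex Phi) [set a; b] /\ segment a b q].

Definition special_segment (R : realType) (m : nat) (Phi : seq 'rV[R]_m)
    (x y : 'rV[R]_m) : Prop :=
  [/\ special Phi x, special Phi y & segment x y `<=` skeleton1 Phi].

Definition edge_on (R : realType) (m : nat) (Phi : seq 'rV[R]_m)
    (x y a b : 'rV[R]_m) : Prop :=
  edge (coxeter_complex Phi) a b /\ segment a b `<=` segment x y.

Definition codirected (R : realType) (m : nat) (x y a b : 'rV[R]_m) : Prop :=
  exists2 r : R, 0 < r & b - a = r *: (y - x).

Definition quasi_special (R : realType) (m : nat) (Phi : seq 'rV[R]_m)
    (a b : 'rV[R]_m) : Prop :=
  exists x y, special_segment Phi x y /\ edge_on Phi x y a b.

Definition reflection (R : realType) (m : nat) (alpha v : 'rV[R]_m) :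
    'rV[R]_m :=
  v - (2 * dot v alpha / dot alpha alpha) *: alpha.

Definition coweight_lattice (R : realType) (m : nat) (Phi : seq 'rV[R]_m) :
    set 'rV[R]_m :=
  [set v | v \in <<Phi>>%VS /\
     forall alpha, alpha \in Phi -> exists k : int, dot v alpha = k%:~R].

(* The elements of the Weyl group are the products of reflections in roots. *)
Definition extended_affine_weyl (R : realType) (m : nat)
    (Phi : seq 'rV[R]_m) : set ('rV[R]_m -> 'rV[R]_m) :=
  [set g | exists t (l : seq 'rV[R]_m),
     [/\ coweight_lattice Phi t, {subset l <= Phi}
       & forall v, g v = t + foldr (@reflection R m) v l]].

(* Types are numbered from 0: the ordinal i : 'I_n stands for the type i + 1.
   The values of [tau] outside of the quasi-special edges are irrelevant. *)
Definition coxeter_ordering (R : realType) (m n : nat) (Phi : seq 'rV[R]_m)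
    (tau : 'rV[R]_m -> 'rV[R]_m -> 'I_n) : Prop :=
  [/\ forall s x, top_simplex (coxeter_complex Phi) s -> s x ->
        special Phi x -> set_bij (s `\ x) setT (tau x),
      forall g a b, extended_affine_weyl Phi g -> quasi_special Phi a b ->
        tau (g a) (g b) = tau a b
    & forall x y a b a' b', special_segment Phi x y ->
        edge_on Phi x y a b -> codirected x y a b ->
        edge_on Phi x y a' b' -> codirected x y a' b' ->
        tau a b = tau a' b'].

(* The closures of the components of the complement in V of the walls through
   u, for u special, so that each root is constant on some wall through u; the
   component is given by one of its points p. *)
Definition sector (R : realType) (m : nat) (Phi : seq 'rV[R]_m)
    (u : 'rV[R]_m) (S : set 'rV[R]_m) : Prop :=
  exists p, [/\ p \in <<Phi>>%VS,
    forall alpha, alpha \in Phi -> dot (p - u) alpha != 0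
    & S = [set v | v \in <<Phi>>%VS /\
             forall alpha, alpha \in Phi ->
               0 < dot (p - u) alpha -> 0 <= dot (v - u) alpha]].

(** * The root systems A_n, B_n, C_n *)

Inductive cartan_type := TypeA | TypeB | TypeC.

Definition admissible_rank (X : cartan_type) (n : nat) : bool :=
  if X is TypeA then (1 <= n)%N else (2 <= n)%N.

Definition ambient_dim (X : cartan_type) (n : nat) : nat :=
  if X is TypeA then n.+1 else n.

(* Coordinates are numbered from 0; for B_n and C_n, [eps k] is the basis
   vector of index k + 1 in Bourbaki. *)
Definition eps (R : realType) (m k : nat) : 'rV[R]_m :=
  \row_(j < m) ((j : nat) == k)%:R.
Arguments eps {R m} k.

Definition root_system (R : realType) (X : cartan_type) (n : nat) :
    seq 'rV[R]_(ambient_dim X n) :=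
  let coords := iota 0 (ambient_dim X n) in
  let minus := [seq eps i - eps j | i <- coords,
                                    j <- [seq j <- coords | j != i]] in
  let plus := [seq eps i + eps j | i <- coords,
                                   j <- [seq j <- coords | j != i]] in
  let axis (a : R) := [seq a *: eps i | i <- coords] in
  match X with
  | TypeA => minus
  | TypeB => minus ++ plus ++ map -%R plus ++ axis 1 ++ axis (- 1)
  | TypeC => minus ++ plus ++ map -%R plus ++ axis 2 ++ axis (- 2)
  end.
Arguments root_system R X n : clear implicits.

Definition simple_roots (R : realType) (X : cartan_type) (n : nat)
    (i : 'I_n) : 'rV[R]_(ambient_dim X n) :=
  match X with
  | TypeA => eps i - eps i.+1
  | TypeB => if i.+1 == n then eps i else eps i - eps i.+1
  | TypeC => if i.+1 == n then 2 *: eps i else eps i - eps i.+1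
  end.
Arguments simple_roots R X n i : clear implicits.

Definition fundamental_coweights (R : realType) (m n : nat)
    (Phi : seq 'rV[R]_m) (Pi : 'I_n -> 'rV[R]_m) (omega : 'I_n -> 'rV[R]_m) :
    Prop :=
  (forall i, omega i \in <<Phi>>%VS) /\
  (forall i j, dot (omega i) (Pi j) = (i == j)%:R).

Definition highest_root (R : realType) (m n : nat) (Phi : seq 'rV[R]_m)
    (Pi : 'I_n -> 'rV[R]_m) (theta : 'rV[R]_m) : Prop :=
  theta \in Phi /\
  forall beta, beta \in Phi ->
    exists2 a : 'I_n -> R, (forall i, 0 <= a i)
      & theta - beta = \sum_i a i *: Pi i.

Definition highest_root_coefficients (R : realType) (m n : nat)
    (Phi : seq 'rV[R]_m) (Pi : 'I_n -> 'rV[R]_m) (c : 'I_n -> R) : Prop :=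
  highest_root Phi Pi (\sum_i c i *: Pi i).

(** * Euclidean buildings *)

(* The building is of type Phi when [Sigma0] is the Coxeter complex of Phi. *)
Record euclidean_building (R : realType) (Sigma0 Delta : pecomplex R)
    (Apt : set (set (set Delta))) : Prop := EuclideanBuilding {
  building_complex : is_pecomplex Delta;
  building_apartment : forall A, Apt A -> is_subcomplex A;
  building_cover : simplices Delta = \bigcup_(A in Apt) A;
  building_B0 : forall A, Apt A ->
    exists f : Sigma0 -> subcomplex A, simplicial_isometry f;
  building_B1 : forall s t, simplices Delta s -> simplices Delta t ->
    exists A, [/\ Apt A, A s & A t];
  building_B2 : forall A A' s, Apt A -> Apt A' ->
    top_simplex (subcomplex A) s -> top_simplex (subcomplex A') s ->
    exists2 f : subcomplex A -> subcomplex A', simplicial_isometry f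
      & forall x : Delta, vertices (subcomplex A) x ->
          vertices (subcomplex A') x -> f x = x }.

(* A chart is an identification of an apartment with the Coxeter complex. *)
Definition chart (R : realType) (m : nat) (Phi : seq 'rV[R]_m)
    (Delta : pecomplex R) (Apt : set (set (set Delta)))
    (phi : 'rV[R]_m -> Delta) : Prop :=
  exists2 A, Apt A
    & @simplicial_isometry R (coxeter_complex Phi) (subcomplex A) phi.

Definition building_special (R : realType) (m : nat) (Phi : seq 'rV[R]_m)
    (Delta : pecomplex R) (Apt : set (set (set Delta))) (x : Delta) : Prop :=
  exists phi u, [/\ chart Phi Apt phi, special Phi u & phi u = x].

(* A line segment of the building lies in an apartment. *)
Definition building_quasi_special (R : realType) (m : nat)
    (Phi : seq 'rV[R]_m) (Delta : pecomplex R) (Apt : set (set (set Delta)))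
    (x y : Delta) : Prop :=
  exists phi a b,
    [/\ chart Phi Apt phi, quasi_special Phi a b, phi a = x & phi b = y].

Definition building_ordering (R : realType) (m n : nat) (Phi : seq 'rV[R]_m)
    (Delta : pecomplex R) (Apt : set (set (set Delta)))
    (tau : Delta -> Delta -> 'I_n) : Prop :=
  forall phi, chart Phi Apt phi ->
    coxeter_ordering Phi (fun a b => tau (phi a) (phi b)).

Definition standard_ordering (R : realType) (m n : nat) (Phi : seq 'rV[R]_m)
    (omega : 'I_n -> 'rV[R]_m) (c : 'I_n -> R)
    (Delta : pecomplex R) (Apt : set (set (set Delta)))
    (tau : Delta -> Delta -> 'I_n) : Prop :=
  building_ordering Phi Apt tau /\
  exists2 phi, chart Phi Apt phi
    & forall i, tau (phi 0) (phi ((c i)^-1 *: omega i)) = i.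

(* The scalar product of the directed edges (x, y) and (z, t) is r. *)
Definition edge_scalar_product (R : realType) (m : nat) (Phi : seq 'rV[R]_m)
    (Delta : pecomplex R) (Apt : set (set (set Delta)))
    (x y z t : Delta) (r : R) : Prop :=
  exists phi a b a' b',
    [/\ chart Phi Apt phi,
        edge (coxeter_complex Phi) a b /\ phi a = x /\ phi b = y,
        edge (coxeter_complex Phi) a' b' /\ phi a' = z /\ phi b' = t
      & r = dot (b - a) (b' - a')].

(* The angle at y between the edges {x, y} and {y, z} is theta. *)
Definition edge_angle (R : realType) (m : nat) (Phi : seq 'rV[R]_m)
    (Delta : pecomplex R) (Apt : set (set (set Delta)))
    (x y z : Delta) (theta : R) : Prop :=
  exists phi a b c,
    [/\ chart Phi Apt phi,
        edge (coxeter_complex Phi) a b /\ edge (coxeter_complex Phi) b c,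
        [/\ phi a = x, phi b = y & phi c = z]
      & theta = angle (a - b) (c - b)].

(** * The combing *)

(* Edge paths are nonempty lists of vertices.  Here x :: s is the edge path
   that runs along the line segment from x to y; s is empty when x = y. *)
Definition segment_path (R : realType) (m : nat) (Phi : seq 'rV[R]_m)
    (x y : 'rV[R]_m) (s : seq 'rV[R]_m) : Prop :=
  path (fun a b => `[< edge_on Phi x y a b /\ codirected x y a b >]) x s /\
  last x s = y.

(* p is the path alpha_xy, for x and y special: [z i] are the vertices of the alcove at u = x in a
   sector S, numbered by their type, v = y is the endpoint, [node k] the k-th
   break point, and [t k] the path from [node k] to [node k.+1] without its
   origin. *)
Definition combing_path (R : realType) (m n : nat) (Phi : seq 'rV[R]_m)
    (Delta : pecomplex R) (Apt : set (set (set Delta)))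
    (tau : Delta -> Delta -> 'I_n) (x y : Delta) (p : seq Delta) : Prop :=
  exists phi u v S (z : 'I_n -> 'rV[R]_m) (mu : 'I_n -> R)
      (t : 'I_n -> seq 'rV[R]_m),
    let node k := u + \sum_(i < n | (i < k)%N) mu i *: (z i - u) in
    [/\ [/\ chart Phi Apt phi, phi u = x, phi v = y, special Phi u
          & special Phi v],
        [/\ sector Phi u S, S v,
            top_simplex (coxeter_complex Phi) (u |` range z),
            u |` range z `<=` S
          & forall i, tau (phi u) (phi (z i)) = i],
        (forall i, 0 <= mu i) /\ v = u + \sum_i mu i *: (z i - u),
        forall k : 'I_n, segment_path Phi (node k) (node k.+1) (t k)
      & p = map phi (u :: flatten [seq t k | k <- enum 'I_n])].

Definition combing (R : realType) (m n : nat) (Phi : seq 'rV[R]_m)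
    (Delta : pecomplex R) (Apt : set (set (set Delta)))
    (tau : Delta -> Delta -> 'I_n) : set (seq Delta) :=
  [set p | exists x y q (k : nat),
     combing_path Phi Apt tau x y q /\ p = take k.+1 q].

(** * The locally defined family of paths *)

Definition admissible_pair (R : realType) (m n : nat) (Phi : seq 'rV[R]_m)
    (omega : 'I_n -> 'rV[R]_m) (c : 'I_n -> R)
    (Delta : pecomplex R) (Apt : set (set (set Delta)))
    (tau : Delta -> Delta -> 'I_n) (x y z : Delta) : Prop :=
  let i := tau x y in
  let j := tau y z in
  [/\ building_quasi_special Phi Apt x y, building_quasi_special Phi Apt y z
    & edge_angle Phi Apt x y z pi \/
      [/\ (i < j)%N, building_special Phi Apt y
        & edge_scalar_product Phi Apt x y y z
            (dot ((c i)^-1 *: omega i) ((c j)^-1 *: omega j))]].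

(* As for the paths of the combing, the origin has to be a special vertex:
   otherwise the condition on consecutive edges would be void for paths with at
   most one edge, e.g. a single edge issuing from a nonspecial vertex. *)
Definition local_combing (R : realType) (m n : nat) (Phi : seq 'rV[R]_m)
    (omega : 'I_n -> 'rV[R]_m) (c : 'I_n -> R)
    (Delta : pecomplex R) (Apt : set (set (set Delta)))
    (tau : Delta -> Delta -> 'I_n) : set (seq Delta) :=
  [set p | exists x s,
     [/\ p = x :: s, building_special Phi Apt x,
         path (fun a b => `[< edge Delta a b >]) x s
       & forall p1 a b d p2, p = p1 ++ [:: a, b, d & p2] ->
           admissible_pair Phi omega c Apt tau a b d]].

(* Main.v *)
(* Fix a chart phi that identifies an apartment with the Coxeter complex and carries
   the types of the edges at a special vertex x to the standard ones (a standard
   chart).  The path alpha_xy is then the walk from 0 whose steps are fundamental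
   coweights divided by their marks, taken in the order of their types, and the
   combing is the set of the images of the initial segments of such walks under
   standard charts.

   Paths of the combing are obviously locally admissible.  Conversely, extend a walk from
   x to y by one edge [y, z], and take an apartment containing x and [y, z].  It
   contains the whole walk: otherwise retract the walk onto the apartment, centred at
   an alcove containing the first edge of the walk read in that apartment which is
   not an edge of the walk.  The image is a path with the same types and
   endpoints as a walk, but a sum of vectors in the Weyl orbits of fundamental
   coweights equals the sum of the coweights themselves only if all the
   vectors do.  So everything happens in one Coxeter complex.  If the last two edges
   are straight, the walk goes on.  If their types are i < j and their scalar product
   is that of the coweights, then some w in the stabilizer of omega_i maps omega_j to
   the new direction.  As the Dynkin diagram is a path, w can be chosen to
   fix omega_k for all k <= i, and changing the chart by w straightens the walk. *)

(* The obstacle is that isomorphisms of apartments are only simplicial isometries, given on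
   vertices. They may lie outside the extended affine Weyl group, so they need not respect types,
   and nothing says at once that they respect special vertices. Rigidity turns them into Euclidean
   isometries; the heights of an alcove then detect its special vertices; and prescribing the types
   at one special vertex cuts the transition maps between charts of an apartment down to the
   extended affine Weyl group. The retraction is used only as a relation between a vertex and its
   possible images: its uniqueness suffices, and no map on the building is constructed. It produces
   vectors in the Weyl orbits of the [z i]. Each [z i] minus an element of its orbit is a
   nonnegative combination of simple roots, which is why equality of the sums forces equality of the
   terms. The marks of the classical types are 1 or 2. Hence a vertex of a walk is either special or
   the midpoint of a segment between special vertices, and only the parity of one multiplicity has
   to be tracked. *)
Require Import Defs.
From HB Require Import structures.
From mathcomp Require Import all_boot all_order all_algebra.
From mathcomp Require Import mathcomp_extra boolp classical_sets functions.
From mathcomp Require Import cardinality reals trigo.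
From mathcomp Require Import zify ring lra.

Set Implicit Arguments.
Unset Strict Implicit.
Unset Printing Implicit Defensive.
Import Order.TTheory GRing.Theory Num.Theory.
Local Open Scope classical_set_scope.
Local Open Scope ring_scope.

(** * Euclidean geometry *)

Section Dot.
Variables (R : realType) (m : nat).
Implicit Types u v w : 'rV[R]_m.

Lemma dotC u v : dot u v = dot v u.
Proof. by apply: eq_bigr => i _; rewrite mulrC. Qed.

Lemma dotDl u v w : dot (u + v) w = dot u w + dot v w.
Proof. by rewrite -big_split; apply: eq_bigr => i _; rewrite mxE mulrDl. Qed.

Lemma dotZl a u w : dot (a *: u) w = a * dot u w.
Proof. by rewrite mulr_sumr; apply: eq_bigr => i _; rewrite mxE mulrA. Qed.

Lemma dotDr u v w : dot w (u + v) = dot w u + dot w v.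
Proof. by rewrite dotC dotDl !(dotC w). Qed.

Lemma dotZr a u w : dot w (a *: u) = a * dot w u.
Proof. by rewrite dotC dotZl dotC. Qed.

Lemma dotNl u w : dot (- u) w = - dot u w.
Proof. by rewrite -scaleN1r dotZl mulN1r. Qed.

Lemma dotNr u w : dot w (- u) = - dot w u.
Proof. by rewrite dotC dotNl dotC. Qed.

Lemma dotBl u v w : dot (u - v) w = dot u w - dot v w.
Proof. by rewrite dotDl dotNl. Qed.

Lemma dotBr u v w : dot w (u - v) = dot w u - dot w v.
Proof. by rewrite dotDr dotNr. Qed.

Lemma dot0l w : dot 0 w = 0.
Proof. by rewrite -(scale0r 0) dotZl mul0r. Qed.

Lemma dot0r w : dot w 0 = 0.
Proof. by rewrite dotC dot0l. Qed.

Lemma dot_suml I (r : seq I) (P : pred I) (F : I -> 'rV[R]_m) w :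
  dot (\sum_(i <- r | P i) F i) w = \sum_(i <- r | P i) dot (F i) w.
Proof.
by apply: (big_morph (fun u => dot u w)); [move=> ? ?; rewrite dotDl|rewrite dot0l].
Qed.

Lemma dot_sumr I (r : seq I) (P : pred I) (F : I -> 'rV[R]_m) w :
  dot w (\sum_(i <- r | P i) F i) = \sum_(i <- r | P i) dot w (F i).
Proof. by rewrite dotC dot_suml; apply: eq_bigr => i _; rewrite dotC. Qed.

Definition dotE := (dotDl, dotDr, dotBl, dotBr, dotNl, dotNr, dotZl, dotZr,
  dot0l, dot0r).

Lemma dot_ge0 u : 0 <= dot u u.
Proof. by apply: sumr_ge0 => i _; rewrite -expr2 sqr_ge0. Qed.

Lemma dot_eq0 u : dot u u = 0 -> u = 0.
Proof.
move=> /eqP; rewrite psumr_eq0 => [/allP h|i _]; last by rewrite -expr2 sqr_ge0.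
apply/rowP => i; rewrite mxE; apply/eqP.
by have := h i (mem_index_enum i); rewrite mulf_eq0 orbb.
Qed.

Lemma dot_gt0 u : u != 0 -> 0 < dot u u.
Proof.
move=> u0; rewrite lt_def dot_ge0 andbT; apply/eqP => /dot_eq0 h.
by rewrite h eqxx in u0.
Qed.

Lemma enorm_inj u v : enorm u = enorm v -> dot u u = dot v v.
Proof.
by move=> h; rewrite -[LHS]sqr_sqrtr ?dot_ge0 // -[RHS]sqr_sqrtr ?dot_ge0 // -/(enorm u) h.
Qed.

Lemma reflectionE (al u : 'rV[R]_m) :
  reflection al u = u - (2 * dot u al / dot al al) *: al.
Proof. by []. Qed.

Lemma reflection_is_linear al : linear (@reflection R m al).
Proof.
move=> a u v; rewrite !reflectionE !dotE.
rewrite scalerBr scalerA addrACA -opprD -scalerDl; congr (_ - _ *: _); ring.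
Qed.

Lemma dot_reflection al u v :
  al != 0 -> dot (reflection al u) (reflection al v) = dot u v.
Proof.
move=> /dot_gt0 a0; rewrite !reflectionE !dotE (dotC al).
by field; rewrite gt_eqF.
Qed.

Lemma reflectionK al : al != 0 -> involutive (@reflection R m al).
Proof.
move=> /dot_gt0 a0 u; rewrite !reflectionE !dotE -addrA -opprD -scalerDl.
rewrite [X in X *: _](_ : _ = 0) ?scale0r ?subr0 //.
by field; rewrite gt_eqF.
Qed.

Lemma cauchy_schwarz u v : dot u v ^+ 2 <= dot u u * dot v v.
Proof.
have [->|v0] := eqVneq v 0; first by rewrite !dot0r expr0n mulr0.
have := dot_ge0 (u - (dot u v / dot v v) *: v); have d := dot_gt0 v0.
rewrite !dotE (dotC v u) => h.
have : 0 <= dot u u - dot u v ^+ 2 / dot v v.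
  apply: le_trans h _; rewrite le_eqVlt; apply/orP; left; apply/eqP; field; exact: lt0r_neq0.
by rewrite subr_ge0 ler_pdivrMr.
Qed.

(** The angle pi makes [dot u v] the opposite of the product of the norms, and then [v] plus the
    proper multiple of [u] has norm zero. Cauchy-Schwarz enters because [acosK] requires an argument
    in [-1, 1]. *)
Lemma angle_pi u v : u != 0 -> v != 0 -> angle u v = pi ->
  exists2 r : R, 0 < r & v = - (r *: u).
Proof.
move=> u0 v0; rewrite /angle; set t := _ / _ => at_pi.
have du := dot_gt0 u0; have dv := dot_gt0 v0.
have eu : enorm u ^+ 2 = dot u u by rewrite sqr_sqrtr ?dot_ge0.
have ev : enorm v ^+ 2 = dot v v by rewrite sqr_sqrtr ?dot_ge0.
have nu : 0 < enorm u by rewrite sqrtr_gt0.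
have nv : 0 < enorm v by rewrite sqrtr_gt0.
have tt : t ^+ 2 <= 1.
  rewrite /t expr_div_n exprMn eu ev ler_pdivrMr ?mulr_gt0 // mul1r.
  exact: cauchy_schwarz.
have t1 : t \in `[(-1), 1].
  by rewrite in_itv /= -ler_norml -(expr_le1 (n := 2)) // real_normK ?num_real.
have et : t = -1 by rewrite -(acosK t1) at_pi cospi.
have euv : dot u v = - (enorm u * enorm v).
  have nn : enorm u * enorm v != 0 by rewrite mulf_neq0 ?gt_eqF.
  by apply: (mulIf (invr_neq0 nn)); rewrite -/t et mulNr divff.
exists (enorm v / enorm u); first exact: divr_gt0.
apply/eqP; rewrite -addr_eq0; apply/eqP/dot_eq0.
rewrite !dotE (dotC v u) euv -eu -ev; field; exact: lt0r_neq0.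
Qed.

End Dot.

Section Isometry.
Variables (R : realType) (m : nat) (V : {vspace 'rV[R]_m}).
Implicit Types (u v w : 'rV[R]_m) (g : 'rV[R]_m -> 'rV[R]_m).

Definition dsq u v := dot (u - v) (u - v).

Lemma dsq_eq0 u v : dsq u v = 0 -> u = v.
Proof. by move=> /dot_eq0 /eqP; rewrite subr_eq0 => /eqP. Qed.

Lemma dsqxx u : dsq u u = 0.
Proof. by rewrite /dsq subrr dot0l. Qed.

Lemma polarization u v w :
  dot (u - w) (v - w) = (dsq u w + dsq v w - dsq u v) / 2.
Proof. by rewrite /dsq !dotE (dotC w u) (dotC w v) (dotC v u); field. Qed.

Lemma polarization4 a b c d :
  dot (b - a) (d - c) = (dsq b c - dsq b d - dsq a c + dsq a d) / 2.
Proof.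
rewrite /dsq !dotE (dotC c b) (dotC d b) (dotC c a) (dotC d a); by field.
Qed.

(** Isometries are controlled on the span of the roots, which in type A is smaller than the ambient
    space. They turn out to be affine ([eisometry_sum]) and onto ([eisometry_onto]). *)
Definition eisometry g :=
  {in V, forall u, g u \in V} /\ {in V &, forall u v, dsq (g u) (g v) = dsq u v}.

Lemma eisometry_dot g a b c d : eisometry g -> a \in V -> b \in V -> c \in V -> d \in V ->
  dot (g b - g a) (g d - g c) = dot (b - a) (d - c).
Proof. by move=> [_ h] *; rewrite !polarization4 !h. Qed.

Lemma eisometry_comp g g' : eisometry g -> eisometry g' -> eisometry (g \o g').
Proof.
move=> [h1 h2] [h3 h4]; split=> [u uV|u v uV vV] /=; first by rewrite h1 ?h3.
by rewrite h2 ?h3 // h4.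
Qed.

(** The squared distance between the two sides expands into scalar products of differences of
    images; [eisometry_dot] carries them back to the equation for [u], where they cancel. *)
Lemma eisometry_sum g w (I : finType) (k : I -> R) (x : I -> 'rV[R]_m) u :
  eisometry g -> w \in V -> (forall i, x i \in V) ->
  u = w + \sum_i k i *: (x i - w) -> g u = g w + \sum_i k i *: (g (x i) - g w).
Proof.
move=> gI wV xV e.
have uV : u \in V.
  by rewrite e memvD // memv_suml // => i _; rewrite memvZ // memvB.
apply: dsq_eq0; rewrite /dsq opprD addrA.
set S := \sum_i _; set a := g u - g w.
have eu : u - w = \sum_i k i *: (x i - w) by rewrite e addrC addKr.
have ea : dot a a = dot (u - w) (u - w) by rewrite eisometry_dot.
have eS : dot a S = dot (u - w) (u - w).
  rewrite dot_sumr {2}eu dot_sumr; apply: eq_bigr => i _.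
  by rewrite !dotZr eisometry_dot.
have eSS : dot S S = dot (u - w) (u - w).
  rewrite eu !dot_sumr; apply: eq_bigr => i _.
  rewrite !dotZr; congr (_ * _); rewrite dotC [RHS]dotC !dot_sumr.
  by apply: eq_bigr => j _; rewrite !dotZr eisometry_dot.
clearbody a S; rewrite !dotE (dotC S a) ea eS eSS; ring.
Qed.

Lemma eisometry_line g w r x y : eisometry g -> w \in V -> x \in V -> y \in V ->
  y - w = r *: (x - w) -> g y - g w = r *: (g x - g w).
Proof.
move=> gI wV xV yV e.
have := @eisometry_sum g w 'I_1 (fun=> r) (fun=> x) y gI wV (fun=> xV).
rewrite !big_ord1 -e addrC subrK => /(_ erefl) ->.
by rewrite addrC addKr.
Qed.

Lemma eisometry_inj g : eisometry g -> {in V &, injective g}.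
Proof.
by move=> [_ h] u v uV vV e; apply: dsq_eq0; rewrite -h // e dsqxx.
Qed.

(** This is [eisometry_sum] at the base point [p], with coefficient [r] at [b] and [- r] at [a]. *)
Lemma eisometry_parallel g r p q a b :
  eisometry g -> p \in V -> q \in V -> a \in V -> b \in V ->
  q - p = r *: (b - a) -> g q - g p = r *: (g b - g a).
Proof.
move=> gI pV qV aV bV e.
pose k (i : bool) := if i then r else - r; pose x (i : bool) := if i then b else a.
have xV i : x i \in V by case: i.
have sumE (f : 'rV[R]_m -> 'rV[R]_m) :
    \sum_i k i *: (f (x i) - f p) = r *: (f b - f a).
  by rewrite big_bool /= scaleNr -scalerBr opprB addrA subrK.
have eq : q = p + \sum_i k i *: (x i - p) by rewrite (sumE id) -e addrC subrK.
by rewrite (eisometry_sum gI pV xV eq) sumE addrC addKr.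
Qed.

End Isometry.

(** * Simplicial isometries *)

Section SimplicialIsometry.
Variable R : realType.
Implicit Types K L M : pecomplex R.

Lemma sim_inj K L (f : K -> L) x y : simplicial_isometry f ->
  vertices K x -> vertices K y -> f x = f y -> x = y.
Proof. by move=> [h _ _] xv yv; apply: h; rewrite inE. Qed.

Lemma sim_simplex K L (f : K -> L) s : simplicial_isometry f ->
  simplices K s -> simplices L (f @` s).
Proof. by move=> [_ <- _] hs; exists s. Qed.

Lemma sim_simplexV K L (f : K -> L) t : simplicial_isometry f ->
  simplices L t -> exists2 s, simplices K s & t = f @` s.
Proof. by move=> [_ <- _] [s hs <-]; exists s. Qed.

Lemma sim_vertex K L (f : K -> L) x : simplicial_isometry f ->
  vertices K x -> vertices L (f x).
Proof. by move=> fI [s hs sx]; exists (f @` s); [exact: sim_simplex|exists x]. Qed.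

Lemma sim_vertexV K L (f : K -> L) y : simplicial_isometry f ->
  vertices L y -> exists2 x, vertices K x & f x = y.
Proof.
move=> fI [t /(sim_simplexV fI)[s hs ->] [x sx <-]].
by exists x => //; exists s.
Qed.

Lemma sim_mem K L (f : K -> L) s x : simplicial_isometry f ->
  simplices K s -> vertices K x -> (f @` s) (f x) -> s x.
Proof.
move=> fI hs xv [y sy /(sim_inj fI)]; move=> <- //.
by exists s.
Qed.

Lemma sim_comp K L M (f : K -> L) (g : L -> M) :
  simplicial_isometry f -> simplicial_isometry g -> simplicial_isometry (g \o f).
Proof.
move=> fI gI; split.
- move=> x y /set_mem xv /set_mem yv /= /(sim_inj gI) e.
  by apply: (sim_inj fI) => //; apply: e; apply: sim_vertex.
- apply/seteqP; split=> [_ [s hs <-]|t /(sim_simplexV gI)[s /(sim_simplexV fI)[r hr ->] ->]].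
    by rewrite -image_comp; apply: (sim_simplex gI); apply: sim_simplex.
  by exists r => //; rewrite -image_comp.
- move=> s x y hs sx sy /=; case: (gI) => _ _ h.
  rewrite (h (f @` s)); [|exact: sim_simplex|by exists x|by exists y].
  by case: (fI) => _ _ hf; apply: (hf s).
Qed.

(** On vertices [h] is [f] followed by the inverse of [f']. The carrier may contain more than the
    vertices, and [d] supplies the values there. *)
Lemma sim_factor K K' L (d : K -> K') (f : K -> L) (f' : K' -> L) :
  simplicial_isometry f -> simplicial_isometry f' ->
  exists h : K -> K', simplicial_isometry h /\
    forall x, vertices K x -> vertices K' (h x) /\ f x = f' (h x).
Proof.
move=> fI fI'.
have /choice[h hh] x : exists y, vertices K x -> vertices K' y /\ f x = f' y.
  have [xv|nv] := pselect (vertices K x); last by exists (d x).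
  by have [y yv e] := sim_vertexV fI' (sim_vertex fI xv); exists y.
exists h; split=> //.
have him s s' : simplices K s -> simplices K' s' -> f @` s = f' @` s' -> h @` s = s'.
  move=> hs hs' e; apply/seteqP; split=> [_ [x sx <-]|y sy].
    have xv : vertices K x by exists s.
    have [hv hf] := hh x xv.
    by apply: (sim_mem fI' hs' hv); rewrite -hf -e; exists x.
  have : (f' @` s') (f' y) by exists y.
  rewrite -e => -[x sx ex]; have xv : vertices K x by exists s.
  have [hv hf] := hh x xv; have yv : vertices K' y by exists s'.
  by exists x => //; apply: (sim_inj fI') => //; rewrite -hf.
have hS s : simplices K s -> simplices K' (h @` s).
  move=> hs; have [s' hs' e] := sim_simplexV fI' (sim_simplex fI hs).
  by rewrite (him _ _ hs hs' e).
split.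
- move=> x y /set_mem xv /set_mem yv e; apply: (sim_inj fI) => //.
  by rewrite (hh x xv).2 (hh y yv).2 e.
- apply/seteqP; split=> [_ [s hs <-]|s' hs']; first exact: hS.
  have [s hs e] := sim_simplexV fI (sim_simplex fI' hs').
  by exists s => //; apply: him.
- move=> s x y hs sx sy.
  have xv : vertices K x by exists s.
  have yv : vertices K y by exists s.
  case: (fI) => _ _ hf; case: (fI') => _ _ hf'.
  rewrite -(hf s x y hs sx sy) (hh x xv).2 (hh y yv).2 (hf' (h @` s)) //.
  exact: hS.
Qed.

End SimplicialIsometry.

(** * Discreteness and elementary bounds *)

Lemma positive_residue (R : realType) (xs : seq R) :
  exists2 d : R, 0 < d & forall x (k : int), x \in xs -> 0 < x + k%:~R -> d <= x + k%:~R.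
Proof.
elim: xs => [|y xs [d d0 h]]; first by exists 1.
pose e := y + (Num.floor (- y) + 1)%:~R.
have e0 : 0 < e.
  by rewrite /e addrC -ltrBlDr sub0r; apply: floorD1_gt.
exists (Num.min d e) => [|x k]; first by rewrite lt_min d0.
rewrite inE => /orP[/eqP ->|xs' p]; last by rewrite ge_min h.
move=> p; rewrite ge_min; apply/orP; right; rewrite lerD2l ler_int.
by rewrite lezD1 floor_lt_int -subr_gt0 opprK addrC.
Qed.

(** The inverse of one plus the sum of the inverses is a bound that also covers the empty family. *)
Lemma positive_family_bound (R : realType) (I : finType) (F : I -> R) :
  (forall i, 0 < F i) -> exists2 e : R, 0 < e & forall i, e <= F i.
Proof.
move=> h; exists (1 + \sum_i (F i)^-1)^-1 => [|i].
  by rewrite invr_gt0 ltr_pwDl // sumr_ge0 // => i _; rewrite invr_ge0 ltW.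
rewrite -[leRHS]invrK lef_pV2 ?posrE ?invr_gt0 //; last first.
  by rewrite ltr_pwDl // sumr_ge0 // => j _; rewrite invr_ge0 ltW.
rewrite (bigD1 i) //= addrCA lerDl addr_ge0 //.
by rewrite sumr_ge0 // => j _; rewrite invr_ge0 ltW.
Qed.

(** Pigeonhole: an injection of a finite type into itself is onto, so its values exhaust the type.
    It recognizes the simplices with [n.+1] vertices as alcoves. *)
Lemma card_le_all (T : finType) (J : pred (option T)) :
  ([set: option T] #<= [set o | J o])%card -> forall o, J o.
Proof.
move=> /pcard_leP[g] o.
have gi : injective g by move=> x y e; apply: 'inj_g e; rewrite inE.
have /codomP[o' ->] := injF_onto gi o.
exact: ('funS_g).
Qed.

Lemma segment_reparam (R : realType) (m : nat) (x e : 'rV[R]_m) (N r s t : R) :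
  N * s = r + t ->
  (1 - s) *: x + s *: (x + N *: e) = (1 - t) *: (x + r *: e) + t *: (x + (r + 1) *: e).
Proof.
move=> h; apply/rowP => i; rewrite !mxE.
transitivity (x 0 i + (N * s) * e 0 i); first ring.
by rewrite h; ring.
Qed.

Lemma nseq_rcons (T : Type) N (x : T) : rcons (nseq N x) x = nseq N.+1 x.
Proof. by elim: N => [//|N IH] /=; rewrite IH. Qed.

(** * Simplices of the Coxeter complex *)

(* The part of the theory of root systems that is used here.  [rd_orth] says that the
   Dynkin diagram is a path in its numbering.  The height of the standard alcove over
   the wall opposite to [omega i] is the inverse of the norm of [c i *: Pi i], so
   [rd_norm] lets one recognize the special vertices of an alcove from its metric. *)
Record root_datum (R : realType) (m n : nat) (Phi : seq 'rV[R]_m)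
    (Pi omega : 'I_n -> 'rV[R]_m) (c : 'I_n -> R) : Prop := RootDatum {
  rd_rank : (0 < n)%N;
  rd_opp : {in Phi, forall al, - al \in Phi};
  rd_refl : {in Phi &, forall al be, reflection al be \in Phi};
  rd_neq0 : {in Phi, forall al, al != 0};
  rd_prim : {in Phi &, forall al be r, be = r *: al -> r = 1 \/ r = -1};
  rd_simple : forall i, Pi i \in Phi;
  rd_orth : forall i j k : 'I_n, (i < j < k)%N -> dot (Pi i) (Pi k) = 0;
  rd_omega : fundamental_coweights Phi Pi omega;
  rd_sign : {in Phi, forall be, (forall i, 0 <= dot (omega i) be) \/
                                (forall i, dot (omega i) be <= 0)};
  rd_int : {in Phi, forall be i, dot (omega i) be \is a Num.int};
  rd_span : {in Phi, forall be, be = \sum_i dot (omega i) be *: Pi i};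
  rd_highest_in : \sum_i c i *: Pi i \in Phi;
  rd_highest : {in Phi, forall be i, dot (omega i) be <= c i};
  rd_coroot : {in Phi, forall be, let theta := \sum_i c i *: Pi i in
     2 * dot theta be / dot theta theta \is a Num.int};
  rd_mark : forall i, c i = 1 \/
    c i = 2 /\ exists2 l, {subset l <= Phi} &
      {in <<Phi>>%VS, forall v, foldr (@reflection R m) v l = - v};
  rd_norm : forall i, let theta := \sum_i c i *: Pi i in
    c i = 1 <-> c i ^+ 2 * dot (Pi i) (Pi i) = dot theta theta }.

Section RootDatum.
Variables (R : realType) (m n : nat) (Phi : seq 'rV[R]_m).
Variables (Pi omega : 'I_n -> 'rV[R]_m) (c : 'I_n -> R).
Hypothesis rd : root_datum Phi Pi omega c.

Notation V := (<<Phi>>%VS).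
Notation EW := (extended_affine_weyl Phi).
Notation wact l v := (foldr (@reflection R m) v l).
Notation Sigma := (coxeter_complex Phi).
Implicit Types (u v w p q : 'rV[R]_m) (g : 'rV[R]_m -> 'rV[R]_m).

(** * The Weyl group and the extended affine Weyl group *)

Lemma rootV al : al \in Phi -> al \in V.
Proof. exact: memv_span. Qed.

Lemma wact_linear l : linear (fun v => wact l v).
Proof.
elim: l => [//|al l IH] a u v /=.
by rewrite IH reflection_is_linear.
Qed.

Lemma wactD l u v : wact l (u + v) = wact l u + wact l v.
Proof. by rewrite -{1}(scale1r u) wact_linear scale1r. Qed.

Lemma wact0 l : wact l 0 = 0.
Proof. by have := wact_linear l (-1) 0 0; rewrite scaler0 addr0 scaleN1r addNr. Qed.

Lemma wactZ l a u : wact l (a *: u) = a *: wact l u.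
Proof. by have := wact_linear l a u 0; rewrite wact0 !addr0. Qed.

Lemma wactN l u : wact l (- u) = - wact l u.
Proof. by rewrite -!scaleN1r wactZ. Qed.

Lemma wact_dot l u v : {subset l <= Phi} -> dot (wact l u) (wact l v) = dot u v.
Proof.
elim: l => [//|al l IH] /= h; rewrite dot_reflection ?IH //.
  by move=> x xl; apply: h; rewrite inE xl orbT.
by apply: (rd_neq0 rd); apply: h; rewrite inE eqxx.
Qed.

Lemma wactK l u : {subset l <= Phi} -> wact (rev l) (wact l u) = u.
Proof.
elim: l u => [//|al l IH] u /= h.
rewrite rev_cons foldr_rcons reflectionK ?IH //.
  by move=> x xl; apply: h; rewrite inE xl orbT.
by apply: (rd_neq0 rd); apply: h; rewrite inE eqxx.
Qed.

Lemma subset_rev l : {subset l <= Phi} -> {subset rev l <= Phi}.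
Proof. by move=> h x; rewrite mem_rev; apply: h. Qed.

Lemma wactKV l u : {subset l <= Phi} -> wact l (wact (rev l) u) = u.
Proof. by move=> /subset_rev h; have := wactK u h; rewrite revK. Qed.

Lemma wact_dotC l u v : {subset l <= Phi} ->
  dot (wact l u) v = dot u (wact (rev l) v).
Proof. by move=> h; rewrite -{1}(wactKV v h) wact_dot. Qed.

Lemma wact_root l be : {subset l <= Phi} -> be \in Phi -> wact l be \in Phi.
Proof.
elim: l => [//|al l IH] /= h b; apply: (rd_refl rd).
  by apply: h; rewrite inE eqxx.
by apply: IH => // x xl; apply: h; rewrite inE xl orbT.
Qed.

Lemma reflectionV al u : al \in V -> u \in V -> reflection al u \in V.
Proof. by move=> aV uV; rewrite memvB // memvZ. Qed.

Lemma wactV l u : {subset l <= Phi} -> u \in V -> wact l u \in V.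
Proof.
elim: l => [//|al l IH] /= h b; apply: reflectionV.
  by apply/rootV/h; rewrite inE eqxx.
by apply: IH => // x xl; apply: h; rewrite inE xl orbT.
Qed.

Lemma latticeP t : coweight_lattice Phi t <->
  t \in V /\ {in Phi, forall al, dot t al \is a Num.int}.
Proof.
split=> -[tV h]; split=> // al /h; first by move=> [k ->]; rewrite intr_int.
by move=> /intrP [k ->]; exists k.
Qed.

Lemma lattice_wact l t : {subset l <= Phi} ->
  coweight_lattice Phi t -> coweight_lattice Phi (wact l t).
Proof.
move=> h /latticeP[tV ht]; apply/latticeP; split; first exact: wactV.
by move=> al aP; rewrite wact_dotC // ht // wact_root //; apply: subset_rev.
Qed.

Lemma latticeD t t' : coweight_lattice Phi t -> coweight_lattice Phi t' ->
  coweight_lattice Phi (t + t').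
Proof.
move=> /latticeP[tV ht] /latticeP[tV' ht']; apply/latticeP; split.
  exact: memvD.
by move=> al aP; rewrite dotDl rpredD ?ht ?ht'.
Qed.

Lemma latticeN t : coweight_lattice Phi t -> coweight_lattice Phi (- t).
Proof.
move=> /latticeP[tV ht]; apply/latticeP; split; first by rewrite memvN.
by move=> al aP; rewrite dotNl rpredN ht.
Qed.

Lemma lattice0 : coweight_lattice Phi 0.
Proof.
by apply/latticeP; split=> [|al _]; rewrite ?mem0v // dot0l.
Qed.

Lemma ew_shift t : coweight_lattice Phi t -> EW (fun v => t + v).
Proof. by move=> h; exists t, [::]; split. Qed.

Lemma ew_wact l : {subset l <= Phi} -> EW (fun v => wact l v).
Proof.
by move=> h; exists 0, l; split=> // [|v]; [exact: lattice0|rewrite add0r].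
Qed.

Lemma ew_id : EW id.
Proof. exact: (@ew_wact [::]). Qed.

Lemma ew_comp g g' : EW g -> EW g' -> EW (g \o g').
Proof.
move=> [t [l [tL lP h]]] [t' [l' [tL' lP' h']]].
exists (t + wact l t'), (l ++ l'); split.
- by apply: latticeD => //; apply: lattice_wact.
- by move=> x; rewrite mem_cat => /orP[/lP|/lP'].
- by move=> v; rewrite /= h h' wactD foldr_cat addrA.
Qed.

Lemma ew_inv g : EW g -> exists g', [/\ EW g', cancel g g' & cancel g' g].
Proof.
move=> [t [l [tL lP h]]]; have lP' := subset_rev lP.
exists (fun v => wact (rev l) (- t) + wact (rev l) v); split.
- exists (wact (rev l) (- t)), (rev l); split=> //.
  by apply: lattice_wact => //; apply: latticeN.
- by move=> v; rewrite h -wactD addKr wactK.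
- by move=> v; rewrite h -wactD wactKV // addNKr.
Qed.

Lemma ew_eisometry g : EW g -> eisometry V g.
Proof.
move=> [t [l [/latticeP[tV _] lP h]]]; split=> [u uV|u v _ _].
  by rewrite h memvD // wactV.
by rewrite /dsq !h opprD addrACA subrr add0r -wactN -wactD wact_dot.
Qed.

Lemma ewV g u : EW g -> u \in V -> g u \in V.
Proof. by move=> /ew_eisometry[h _]; apply: h. Qed.

Lemma ew_inj g : EW g -> injective g.
Proof. by move=> /ew_inv[g' [_ /can_inj]]. Qed.

(** Walls go to walls: an affine root composed with [g] is again an affine root, the integrality of
    the shift coming from the coweight lattice. *)
Lemma ew_root g be : EW g -> be \in Phi ->
  exists be' (k : int), be' \in Phi /\ forall q, dot (g q) be = dot q be' + k%:~R.
Proof.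
move=> [t [l [[tV tL] lP h]]] bP; have [k ek] := tL _ bP.
exists (wact (rev l) be), k; split.
  by apply: wact_root => //; apply: subset_rev.
by move=> q; rewrite h dotDl ek wact_dotC // addrC.
Qed.

(** * The standard alcove in barycentric coordinates *)

Notation theta := (\sum_i c i *: Pi i).

(* The walls of the standard alcove, indexed by the opposite vertices, are the
   zero sets of the functions [aff o]. *)
Definition aroot (o : option 'I_n) := if o is Some i then Pi i else - theta.
Definition ashift (o : option 'I_n) : R := if o is Some _ then 0 else 1.
Definition mark (o : option 'I_n) : R := if o is Some i then c i else 1.
Definition corner (o : option 'I_n) := if o is Some i then (c i)^-1 *: omega i else 0.
Notation z i := (corner (Some i)).
Definition aff o q := dot q (aroot o) + ashift o.
Definition arefl o q := q - (2 * aff o q / dot (aroot o) (aroot o)) *: aroot o.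
Definition aword (l : seq (option 'I_n)) q := foldr arefl q l.
Definition alcove0 := [set q | q \in V /\ forall o, 0 <= aff o q].

Lemma omegaV i : omega i \in V.
Proof. exact: (rd_omega rd).1. Qed.

Lemma omegaPi i j : dot (omega i) (Pi j) = (i == j)%:R.
Proof. exact: (rd_omega rd).2. Qed.

Lemma dot_omega_theta i : dot (omega i) theta = c i.
Proof.
rewrite dot_sumr (bigD1 i) //= big1 => [|j ji]; rewrite dotZr omegaPi.
  by rewrite eqxx mulr1 addr0.
by rewrite eq_sym (negbTE ji) mulr0.
Qed.

Lemma c_gt0 i : 0 < c i.
Proof. by case: (rd_mark rd i) => [->|[-> _]]. Qed.

Lemma mark_gt0 o : 0 < mark o.
Proof. by case: o => [i|] //=; apply: c_gt0. Qed.

Lemma aroot_root o : aroot o \in Phi.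
Proof.
case: o => [i|] /=; first exact: (rd_simple rd).
by apply: (rd_opp rd); apply: (rd_highest_in rd).
Qed.

Lemma aroot_neq0 o : aroot o != 0.
Proof. by apply: (rd_neq0 rd); apply: aroot_root. Qed.

Lemma dot_aroot_gt0 o : 0 < dot (aroot o) (aroot o).
Proof. by apply/dot_gt0/aroot_neq0. Qed.

Lemma cornerV o : corner o \in V.
Proof. by case: o => [i|] /=; [rewrite memvZ // omegaV|rewrite mem0v]. Qed.

Lemma big_option (T : nmodType) (F : option 'I_n -> T) :
  \sum_o F o = F None + \sum_i F (Some i).
Proof.
rewrite (bigD1 None) //=; congr (_ + _).
rewrite (reindex_omap Some id) => [|[i|] //].
by apply: eq_bigl => i; rewrite eqxx.
Qed.

Lemma aff_corner o o' : aff o (corner o') = (o == o')%:R / mark o.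
Proof.
rewrite /aff; case: o o' => [i|] [j|] /=; rewrite ?dotE ?omegaPi ?dot_omega_theta ?add0r ?addr0.
- rewrite (inj_eq (@Some_inj _)) eq_sym; case: eqVneq => [->|_]; last by rewrite mulr0 mul0r.
  by rewrite mulr1 mul1r.
- by rewrite mul0r.
- by rewrite mulVf ?gt_eqF ?c_gt0 // addNr mul0r.
- by rewrite oppr0 add0r divr1.
Qed.

Lemma sum_mark_aroot : \sum_o mark o *: aroot o = 0.
Proof. by rewrite big_option /= scale1r addNr. Qed.

Lemma expand_omega q : q \in V -> q = \sum_i dot (omega i) q *: Pi i.
Proof.
move=> qV.
have [k ->] : exists k : 'I_(size Phi) -> R, q = \sum_j k j *: Phi`_j.
  by exists (fun j => coord (in_tuple Phi) j q); exact: (coord_span (X := in_tuple Phi)).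
rewrite [RHS](eq_bigr (fun i => \sum_j k j *: (dot (omega i) Phi`_j *: Pi i))); last first.
  move=> i _; rewrite dot_sumr scaler_suml; apply: eq_bigr => j _.
  by rewrite dotZr scalerA.
rewrite exchange_big; apply: eq_bigr => j _ /=.
by rewrite -scaler_sumr -(rd_span rd) // mem_nth.
Qed.

(** The difference of the two sides is orthogonal to every simple root, hence to itself by
    [expand_omega]. *)
Lemma expand_Pi q : q \in V -> q = \sum_i dot q (Pi i) *: omega i.
Proof.
move=> qV; apply/eqP; rewrite -subr_eq0; apply/eqP/dot_eq0.
set d := q - _; have dV : d \in V.
  by rewrite memvB // memv_suml // => i _; rewrite memvZ // omegaV.
have h j : dot d (Pi j) = 0.
  rewrite /d dotBl dot_suml (bigD1 j) //= big1 => [|i ij]; rewrite dotZl omegaPi.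
    by rewrite eqxx mulr1 addr0 subrr.
  by rewrite (negbTE ij) mulr0.
by rewrite {2}(expand_omega dV) dot_sumr big1 // => i _; rewrite dotZr h mulr0.
Qed.

(** By [aff_corner] the functions [mark o * aff o] are the barycentric coordinates of the alcove;
    the term of [None] contributes nothing because that corner is the origin. *)
Lemma barycentric q : q \in V -> q = \sum_o (mark o * aff o q) *: corner o.
Proof.
move=> qV; rewrite big_option /= scaler0 add0r {1}(expand_Pi qV).
apply: eq_bigr => i _; rewrite /aff /= addr0 scalerA; congr (_ *: _).
by rewrite mulrAC divff ?mul1r // gt_eqF // c_gt0.
Qed.

Lemma sum_aff q : \sum_o mark o * aff o q = 1.
Proof.
under eq_bigr do rewrite mulrDr -dotZr.
rewrite big_split /= -dot_sumr sum_mark_aroot dot0r add0r big_option /=.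
by rewrite mul1r big1 ?addr0 // => i _; rewrite mulr0.
Qed.

Lemma aff_inj p q : p \in V -> q \in V -> (forall o, aff o p = aff o q) -> p = q.
Proof.
by move=> pV qV h; rewrite (barycentric pV) (barycentric qV); apply: eq_bigr => o _; rewrite h.
Qed.

Lemma corner_inj : injective corner.
Proof.
move=> o o' /(congr1 (aff o)); rewrite !aff_corner eqxx; case: eqVneq => // _ /eqP.
by rewrite mul1r mul0r invr_eq0 gt_eqF // mark_gt0.
Qed.

Lemma corner_alcove0 o : alcove0 (corner o).
Proof.
by split=> [|o']; [exact: cornerV|rewrite aff_corner divr_ge0 // ltW // mark_gt0].
Qed.

Lemma omega_lattice i : coweight_lattice Phi (omega i).
Proof.
apply/latticeP; split; first exact: omegaV.
by move=> al aP; apply: (rd_int rd).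
Qed.

Lemma areflE o q : arefl o q = reflection (aroot o) q - (2 * ashift o / dot (aroot o) (aroot o)) *: aroot o.
Proof.
rewrite /arefl reflectionE -addrA -opprD -scalerDl; congr (_ - _ *: _).
by rewrite -mulrDl /aff mulrDr.
Qed.

(** The translation part of the reflection in the wall [theta] = 1 is the coroot of [theta], a
    coweight by [rd_coroot]. *)
Lemma ew_arefl o : EW (arefl o).
Proof.
exists (- ((2 * ashift o / dot (aroot o) (aroot o)) *: aroot o)), [:: aroot o]; split.
- apply/latticeP; split.
    by rewrite memvN memvZ // rootV // aroot_root.
  move=> al aP; rewrite dotNl dotZl rpredN.
  case: o => [i|]; first by rewrite /= mulr0 !mul0r.
  have := rd_coroot rd aP; rewrite /= !dotNl !dotNr opprK mulr1 mulrN rpredN.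
  by rewrite mulrAC.
- by move=> x; rewrite inE => /eqP ->; apply: aroot_root.
- by move=> v; rewrite areflE /= addrC.
Qed.

Lemma ew_aword l : EW (aword l).
Proof.
elim: l => [|o l IH]; first exact: ew_id.
exact: (ew_comp (ew_arefl o) IH).
Qed.

Lemma aff_arefl o q : aff o (arefl o q) = - aff o q.
Proof.
rewrite {1}/aff /arefl dotBl dotZl divfK ?gt_eqF ?dot_aroot_gt0 //.
by rewrite /aff; ring.
Qed.

Lemma areflK o : involutive (arefl o).
Proof.
move=> q; rewrite {1}/arefl aff_arefl mulrN mulNr scaleNr opprK /arefl.
by rewrite subrK.
Qed.

Lemma arefl_fix o q : aff o q = 0 -> arefl o q = q.
Proof. by rewrite /arefl => ->; rewrite mulr0 mul0r scale0r subr0. Qed.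

Lemma awordK l : cancel (aword l) (aword (rev l)).
Proof.
elim: l => [//|o l IH] q; rewrite rev_cons /aword foldr_rcons /= areflK.
exact: IH.
Qed.

Lemma awordKV l : cancel (aword (rev l)) (aword l).
Proof. by move=> q; have := awordK (rev l) q; rewrite revK. Qed.

(** Reflecting [q] in a wall that separates it from [r] brings it closer to [r]. This is the
    potential behind [descent]. *)
Lemma dsq_arefl o q r :
  dsq (arefl o q) r = dsq q r + 4 * aff o q * aff o r / dot (aroot o) (aroot o).
Proof.
have a0 := dot_aroot_gt0 o.
rewrite /dsq /arefl !dotE (dotC (aroot o) q) (dotC (aroot o) r) (dotC r q).
rewrite /aff; move: (dot q (aroot o)) (dot r (aroot o)) (ashift o) a0 => x y k a0.
by field; rewrite gt_eqF.
Qed.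

(** * Interior points and reduction to the alcove *)

Lemma aff_comb (t : option 'I_n -> R) o : \sum_o' t o' = 1 ->
  aff o (\sum_o' t o' *: corner o') = t o / mark o.
Proof.
move=> t1; rewrite /aff dot_suml -[ashift o]mul1r -t1 mulr_suml -big_split /=.
rewrite (bigD1 o) //= big1 => [|o' oo']; rewrite dotZl -mulrDr -/(aff _ _) aff_corner.
  by rewrite eqxx addr0 mulrA mulr1.
by rewrite eq_sym (negbTE oo') mul0r mulr0.
Qed.

(** For nonempty [J], a point in the relative interior of the face spanned by these corners; for
    [xpredT] it is interior to the alcove. *)
Definition barycenter (J : pred (option 'I_n)) :=
  \sum_o ((J o)%:R / (\sum_o (J o)%:R)) *: corner o.

Lemma barycenterV J : barycenter J \in V.
Proof. by rewrite memv_suml // => o _; rewrite memvZ // cornerV. Qed.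

Lemma aff_barycenter (J : pred (option 'I_n)) o : (exists o, J o) ->
  0 <= aff o (barycenter J) /\ (aff o (barycenter J) == 0) = ~~ J o.
Proof.
move=> [o0 Jo0]; pose s : R := \sum_o (J o)%:R; rewrite /barycenter -/s.
have s0 : 0 < s.
  rewrite /s (bigD1 o0) //= Jo0 ltr_pwDl // sumr_ge0 // => o' _; exact: ler0n.
rewrite aff_comb; last by rewrite -mulr_suml divff // gt_eqF.
split; first by rewrite !divr_ge0 ?ler0n ?ltW ?mark_gt0.
by rewrite !mulf_eq0 !invr_eq0 (gt_eqF s0) (gt_eqF (mark_gt0 o)) !orbF pnatr_eq0 eqb0.
Qed.

(** Reflect [p] repeatedly in a wall of [P] that separates it from an interior point of the alcove.
    Along the orbit the affine roots take values in finitely many classes modulo the integers, so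
    each reflection decreases the squared distance by a fixed amount and the process stops. The
    invariant [Q] records what is needed about the endpoint. The choice of [P] selects the group:
    all walls for the affine group, [isSome] for the Weyl group, fewer for a parabolic subgroup. *)
Lemma descent (P : pred (option 'I_n)) (Q : 'rV[R]_m -> Prop) p :
  p \in V -> Q p ->
  (forall q o, q \in V -> P o -> Q q -> aff o q < 0 -> Q (arefl o q)) ->
  exists l, [/\ all P l, Q (aword l p) & forall o, P o -> 0 <= aff o (aword l p)].
Proof.
move=> pV Qp Qs.
have [d d0 hd] := positive_residue [seq dot p be | be <- Phi].
pose r := barycenter xpredT.
have rpos o : 0 < aff o r.
  have [|h1 h2] := @aff_barycenter xpredT o; first by exists o.
  by rewrite lt_def h1 h2.
(* [e] is the decrease of the squared distance guaranteed at each reflection. *)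
have [e e0 he] : exists2 e : R, 0 < e & forall o, e <= 4 * d * aff o r / dot (aroot o) (aroot o).
  apply: positive_family_bound => o.
  by rewrite divr_gt0 ?dot_aroot_gt0 // !mulr_gt0.
suff H N l : dsq (aword l p) r < N%:R * e -> all P l -> Q (aword l p) ->
    exists l, [/\ all P l, Q (aword l p) & forall o, P o -> 0 <= aff o (aword l p)].
  apply: (H (Num.bound (dsq p r / e)) [::]) => //.
  by rewrite -ltr_pdivrMr //; apply: archi_boundP; rewrite divr_ge0 ?dot_ge0 // ltW.
elim: N l => [|N IH] l; first by rewrite mul0r ltNge dot_ge0.
move=> hl Pl Ql.
have [[o Po neg]|h] := pselect (exists2 o, P o & aff o (aword l p) < 0); last first.
  exists l; split=> // o Po; rewrite leNgt; apply/negP => neg.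
  by apply: h; exists o.
have sV : aword l p \in V by apply: ewV => //; apply: ew_aword.
apply: (IH (o :: l)) => /=; [|by rewrite Po|exact: Qs].
(* Pulled back to [p], the opposite of the negative value is the value of a root at [p] plus an
   integer, hence at least [d]. *)
have [be [k [beP hk]]] := ew_root (ew_aword l) (rd_opp rd (aroot_root o)).
have dle : d <= - aff o (aword l p).
  have [k' ek'] : exists k' : int, ashift o = k'%:~R.
    by case: (o) => [i|]; [exists 0|exists 1].
  have -> : - aff o (aword l p) = dot p be + (k - k')%:~R.
    by rewrite rmorphB addrA -hk /aff dotNr ek' opprD.
  apply: hd; first exact: map_f.
  by rewrite rmorphB addrA -hk /= -ek' dotNr -opprD oppr_gt0.
rewrite dsq_arefl; move: hl (he o) (rpos o) (dot_aroot_gt0 o).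
set x := aff o (aword l p) in neg dle *; set a := dot _ _; set y := aff o r.
set D := dsq _ _ => h1 h2 y0 a0.
have : 4 * d * y / a <= 4 * (- x) * y / a.
  by rewrite ler_pM2r ?invr_gt0 // ler_pM2r // ler_pM2l.
rewrite mulrN !mulNr => h3.
have h4 := le_trans h2 h3; rewrite -natr1 mulrDl mul1r in h1.
by rewrite -ltrBrDr (lt_le_trans h1) // -lerBlDl; move: h4; lra.
Qed.

Lemma aword_alcove0 p : p \in V -> exists l, alcove0 (aword l p).
Proof.
move=> pV; have [|l [_ _ h]] := @descent xpredT (fun=> True) p pV I; first by [].
exists l; split=> [|o]; last exact: h.
by apply: ewV => //; apply: ew_aword.
Qed.

(** * Cells and simplices *)

Lemma dot_root p al : al \in Phi -> dot p al = \sum_i dot (omega i) al * dot p (Pi i).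
Proof.
by move=> /(rd_span rd) {1}->; rewrite dot_sumr; apply: eq_bigr => i _; rewrite dotZr.
Qed.

Lemma dot_theta p : dot p theta = \sum_i c i * dot p (Pi i).
Proof. by rewrite dot_sumr; apply: eq_bigr => i _; rewrite dotZr. Qed.

Lemma alcove0_simple p i : alcove0 p -> 0 <= dot p (Pi i).
Proof. by move=> [_ /(_ (Some i))]; rewrite /aff /= addr0. Qed.

Lemma alcove0_theta p : alcove0 p -> dot p theta <= 1.
Proof. by move=> [_ /(_ None)]; rewrite /aff /= dotNr addrC subr_ge0. Qed.

(** The coefficients of a positive root are at most those of [theta], so on the alcove its values
    lie between 0 and those of [theta]. In particular no wall crosses the interior. *)
Lemma alcove0_pos p al : alcove0 p -> al \in Phi ->
  (forall i, 0 <= dot (omega i) al) -> 0 <= dot p al <= 1.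
Proof.
move=> pA aP ah; rewrite dot_root // sumr_ge0 => [|i _] /=; last first.
  by rewrite mulr_ge0 // alcove0_simple.
apply: le_trans (alcove0_theta pA); rewrite dot_theta; apply: ler_sum => i _.
by rewrite ler_wpM2r ?alcove0_simple // (rd_highest rd).
Qed.

Definition cell_le p q := forall o, aff o p = 0 -> aff o q = 0.

Lemma sum_vanish (x y : 'I_n -> R) (a : 'I_n -> R) : (forall i, 0 <= a i) ->
  (forall i, 0 <= x i) -> (forall i, x i = 0 -> y i = 0) ->
  \sum_i a i * x i = 0 -> \sum_i a i * y i = 0.
Proof.
move=> a0 x0 xy /eqP; rewrite psumr_eq0 => [/allP h|i _]; last exact: mulr_ge0.
apply: big1 => i _; have := h i (mem_index_enum i).
by rewrite mulf_eq0 => /orP[/eqP ->|/eqP/xy ->]; rewrite ?mul0r ?mulr0.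
Qed.

(** Both a positive root and its difference from [theta] are nonnegative combinations of simple
    roots, and a sum of nonnegative terms vanishes only term by term. A wall through [p] thus
    contains every point lying on the alcove walls through [p]. *)
Lemma cell_le_pos p q al : alcove0 p -> alcove0 q -> cell_le p q -> al \in Phi ->
  (forall i, 0 <= dot (omega i) al) ->
  (dot p al = 0 -> dot q al = 0) /\ (dot p al = 1 -> dot q al = 1).
Proof.
move=> pA qA pq aP ah.
have s0 i : dot p (Pi i) = 0 -> dot q (Pi i) = 0.
  by move=> h; have := pq (Some i); rewrite /aff /= !addr0; apply.
have p0 i := alcove0_simple i pA.
split; first by rewrite !dot_root //; apply: sum_vanish.
move=> p1.
have dE r : dot r theta - dot r al = \sum_i (c i - dot (omega i) al) * dot r (Pi i).
  by rewrite dot_theta dot_root // -sumrB; apply: eq_bigr => i _; rewrite mulrBl.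
have cpos i : 0 <= c i - dot (omega i) al by rewrite subr_ge0 (rd_highest rd).
have pd0 : 0 <= dot p theta - dot p al.
  by rewrite dE sumr_ge0 // => i _; rewrite mulr_ge0.
have t1 : dot p theta = 1.
  by apply/eqP; rewrite eq_le alcove0_theta // -p1 -subr_ge0 pd0.
have q1 : dot q theta = 1.
  have := pq None; rewrite /aff /= !dotNr => /(_ _)/eqP.
  by rewrite t1 addNr addrC subr_eq0 eq_sym => /(_ erefl)/eqP.
apply/eqP; rewrite eq_sym -subr_eq0 -q1 dE; apply/eqP.
by apply: (sum_vanish cpos p0) => //; rewrite -dE t1 p1 subrr.
Qed.

(** A cell is cut out by all the walls, but inside the alcove its own walls suffice: a positive root
    stays in [0, 1] there, so only the levels 0 and 1 can be attained, and [cell_le_pos] handles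
    them. *)
Lemma cell_alcove0 p q : alcove0 p -> q \in V ->
  closed_cell Phi p q <-> alcove0 q /\ cell_le p q.
Proof.
move=> pA qV; split.
  move=> [_ h].
  have hk (o : option 'I_n) : exists k : int, k%:~R = - ashift o.
    by case: o => [i|]; [exists 0; rewrite /= oppr0|exists (-1)].
  split; first split=> // o.
    have [k ek] := hk o; have [_] := h _ k (aroot_root o).
    by rewrite ek -![- ashift o <= _]subr_ge0 !opprK ; apply; case: (pA) => _; apply.
  move=> o p0; have [k ek] := hk o; have [h1 h2] := h _ k (aroot_root o).
  apply/eqP; rewrite /aff addr_eq0 -ek eq_le.
  have e : dot p (aroot o) = k%:~R by apply/eqP; rewrite ek -addr_eq0; apply/eqP.
  by rewrite h1 ?h2 // e.
move=> [qA pq]; split=> // al k aP.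
suff H be (l : int) : be \in Phi -> (forall i, 0 <= dot (omega i) be) ->
    (dot p be <= l%:~R -> dot q be <= l%:~R) /\ (l%:~R <= dot p be -> l%:~R <= dot q be).
  case: (rd_sign rd aP) => [h|h]; first exact: H.
  have [|i|h1 h2] := H (- al) (- k).
  - exact: (rd_opp rd).
  - by rewrite dotNr oppr_ge0.
  - by move: h1 h2; rewrite !dotNr rmorphN !lerN2.
move=> bP bh; have [e0 e1] := cell_le_pos pA qA pq bP bh.
have /andP[p0 p1] := alcove0_pos pA bP bh.
have /andP[q0 q1] := alcove0_pos qA bP bh.
split=> hl.
  have l0 : 0 <= l by rewrite -(@ler_int R) (le_trans p0).
  have [l1|l1] := lerP 1 l; first by apply: le_trans q1 _; rewrite (@ler_int R 1).
  have el : l = 0 by apply/eqP; rewrite eq_le l0 andbT -ltzD1.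
  by rewrite el e0 //; apply/eqP; rewrite eq_le p0 andbT; rewrite el in hl.
have l1 : l <= 1 by rewrite -(@ler_int R) (le_trans hl).
have [l0|l0] := lerP l 0; first by apply: le_trans q0; rewrite (@ler_int R _ 0).
have el : l = 1 by apply/eqP; rewrite eq_le l1 -gtz0_ge1.
by rewrite el e1 //; apply/eqP; rewrite eq_le p1 /=; rewrite el in hl.
Qed.

Lemma ew_cell_sub g p q : EW g -> closed_cell Phi p q -> closed_cell Phi (g p) (g q).
Proof.
move=> gE [qV h]; split=> [|al k aP]; first exact: ewV.
have [be [j [bP e]]] := ew_root gE aP.
have [h1 h2] := h be (k - j) bP.
by rewrite !e; split; [rewrite -!lerBrDr -intrB|rewrite -!lerBlDr -intrB].
Qed.

Lemma ew_cell g p q : EW g -> closed_cell Phi (g p) (g q) <-> closed_cell Phi p q.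
Proof.
move=> gE; split=> h; last exact: ew_cell_sub.
have [g' [gE' k1 k2]] := ew_inv gE.
by rewrite -(k1 p) -(k1 q); apply: ew_cell_sub.
Qed.

Lemma cell_vertex_corner o : cell_vertex Phi (corner o).
Proof.
split; first exact: cornerV.
apply/seteqP; split=> [q|q ->]; last first.
  by apply/(cell_alcove0 (corner_alcove0 o) (cornerV o)); split=> //; apply: corner_alcove0.
move=> h; have qV := h.1; move/(cell_alcove0 (corner_alcove0 o) qV): h => [qA h].
have e0 o' : o' != o -> aff o' q = 0.
  by move=> oo; apply: h; rewrite aff_corner (negbTE oo) mul0r.
have eo p : p \in V -> mark o * aff o p = 1 - \sum_(o' | o' != o) mark o' * aff o' p.
  by move=> pV; rewrite -(sum_aff p) (bigD1 o) //= addrK.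
apply: aff_inj => //; first exact: cornerV.
move=> o'; have [->|oo] := eqVneq o' o; last first.
  by rewrite e0 // aff_corner (negbTE oo) mul0r.
apply: (mulfI (lt0r_neq0 (mark_gt0 o))).
rewrite !eo ?cornerV //; congr (_ - _); apply: eq_bigr => o1 oo.
by rewrite e0 // aff_corner (negbTE oo) mul0r.
Qed.

(** The barycentric coordinates of [q] add up to 1, so some [aff o q] is nonzero; then [corner o]
    lies in the closed cell of [q], which is a single point. *)
Lemma alcove0_vertex q : alcove0 q -> cell_vertex Phi q -> exists o, q = corner o.
Proof.
move=> qA [qV e].
have [o ho] : exists o, aff o q != 0.
  apply: contrapT => /forallNP h; have := sum_aff q.
  rewrite big1 => [/eqP|o _]; first by rewrite eq_sym oner_eq0.
  by have /negP := h o; rewrite negbK => /eqP ->; rewrite mulr0.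
exists o; apply/esym; suff : closed_cell Phi q (corner o) by rewrite e.
apply/(cell_alcove0 qA (cornerV o)); split; first exact: corner_alcove0.
move=> o' h; rewrite aff_corner; case: eqVneq => [eo|_]; last by rewrite mul0r.
by rewrite -eo h eqxx in ho.
Qed.

Lemma ew_vertex g p : EW g -> cell_vertex Phi p -> cell_vertex Phi (g p).
Proof.
move=> gE [pV e]; split; first exact: ewV.
have [g' [gE' k1 k2]] := ew_inv gE.
apply/seteqP; split=> [q|q ->].
  rewrite -{1}(k2 q) => /(ew_cell _ _ gE); rewrite e => <-.
  by rewrite k2.
by apply/ew_cell => //; rewrite e.
Qed.

Lemma vertexP v : cell_vertex Phi v <-> exists l o, v = aword l (corner o).
Proof.
split=> [vv|[l [o ->]]]; last first.
  by apply: ew_vertex; [apply: ew_aword|apply: cell_vertex_corner].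
have [l h] := aword_alcove0 vv.1.
have [o e] := alcove0_vertex h (ew_vertex (ew_aword l) vv).
by exists (rev l), o; rewrite -e awordK.
Qed.

Definition face g (J : pred (option 'I_n)) := [set x | exists2 o, J o & x = g (corner o)].

(** After moving a point into the standard alcove, the vertices of its cell are the corners whose
    barycentric coordinate at that point is nonzero. Conversely a barycenter generates the cell with
    prescribed corners. *)
Lemma simplexP s : simplices Sigma s <->
  exists g (J : pred (option 'I_n)), [/\ EW g, exists o, J o & s = face g J].
Proof.
split=> [[p /= pV <-]|[g [J [gE Jo ->]]]].
  have [l h] := aword_alcove0 pV; set q := aword l p in h.
  exists (aword (rev l)), (fun o => aff o q != 0); split.
  - exact: ew_aword.
  - apply: contrapT => /forallNP k; have := sum_aff q.
    rewrite big1 => [/eqP|o _]; first by rewrite eq_sym oner_eq0.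
    by have /negP := k o; rewrite negbK => /eqP ->; rewrite mulr0.
  have gE := ew_aword l.
  apply/seteqP; split=> [x [/(ew_cell _ _ gE) h1 h2]|x [o ho ->]].
    have xV : aword l x \in V by apply: ewV => //; apply: h2.1.
    have [h3 h4] := (cell_alcove0 h xV).1 h1.
    have [o e] := alcove0_vertex h3 (ew_vertex gE h2).
    exists o; last by rewrite -e awordK.
    apply/eqP => /h4; rewrite e aff_corner eqxx mul1r => /eqP.
    by rewrite invr_eq0 gt_eqF // mark_gt0.
  split; last by apply: ew_vertex; [apply: ew_aword|apply: cell_vertex_corner].
  apply/(ew_cell _ _ gE); rewrite awordKV; apply/(cell_alcove0 h (cornerV o)).
  split=> [|o' h']; first exact: corner_alcove0.
  rewrite aff_corner; case: eqVneq => [eo|_]; last by rewrite mul0r.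
  by rewrite -eo h' eqxx in ho.
have bV := barycenterV J.
have bA : alcove0 (barycenter J).
  by split=> // o; apply: (aff_barycenter o Jo).1.
exists (g (barycenter J)); first exact: ewV.
have [g' [gE' k1 k2]] := ew_inv gE.
apply/seteqP; split=> [x [h1 h2]|x [o ho ->]].
  move: h1; rewrite -{1}(k2 x) => /(ew_cell _ _ gE) h1.
  have [h3 h4] := (cell_alcove0 bA h1.1).1 h1.
  have [o e] := alcove0_vertex h3 (ew_vertex gE' h2).
  exists o; last by rewrite -e k2.
  apply: contraT => nJ; have [_ e0] := aff_barycenter o Jo.
  have e1 : aff o (barycenter J) = 0 by apply/eqP; rewrite e0 nJ.
  by have := h4 o e1; rewrite e aff_corner eqxx => /eqP; rewrite mul1r invr_eq0 gt_eqF // mark_gt0.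
split; last by apply: ew_vertex => //; apply: cell_vertex_corner.
apply/ew_cell => //; apply/(cell_alcove0 bA (cornerV o)).
split=> [|o' h']; first exact: corner_alcove0.
rewrite aff_corner; case: eqVneq => [eo|_]; last by rewrite mul0r.
have [_] := aff_barycenter o' Jo; rewrite h' eqxx eo.
by rewrite ho.
Qed.

Lemma face_card g (J : pred (option 'I_n)) : EW g -> (face g J #= [set o | J o])%card.
Proof.
move=> gE; have -> : face g J = (g \o corner) @` [set o | J o].
  by apply/seteqP; split=> [x [o Jo ->]|x [o Jo <-]]; exists o.
by apply: inj_card_eq => o o' _ _ /(ew_inj gE)/corner_inj.
Qed.

Lemma simplex_card s : simplices Sigma s -> (s #<= [set: option 'I_n])%card.
Proof.
move=> /simplexP[g [J [gE _ ->]]].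
by rewrite (card_le_eql (face_card J gE)); apply: subset_card_le.
Qed.

Lemma full_simplex s : simplices Sigma s -> ([set: option 'I_n] #<= s)%card ->
  exists2 g, EW g & s = face g xpredT.
Proof.
move=> /simplexP[g [J [gE _ ->]]].
rewrite (card_le_eqr (face_card J gE)) => /card_le_all h; exists g => //.
by apply/seteqP; split=> x [o _ ->]; exists o.
Qed.

Lemma face_simplex g (J : pred (option 'I_n)) : EW g -> (exists o, J o) -> simplices Sigma (face g J).
Proof. by move=> gE h; apply/simplexP; exists g, J. Qed.

Lemma full_face_card g : EW g -> (face g xpredT #= [set: option 'I_n])%card.
Proof.
move=> gE; rewrite (card_eql (face_card xpredT gE)).
by rewrite (_ : [set _ | _] = setT) //; apply/seteqP; split.
Qed.

Lemma top_simplexP s : top_simplex Sigma s <-> exists2 g, EW g & s = face g xpredT.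
Proof.
split=> [[h1 h2]|[g gE ->]].
  apply: full_simplex => //; have := h2 _ (face_simplex (J:=xpredT) ew_id (ex_intro _ None isT)).
  by rewrite (card_le_eql (full_face_card ew_id)).
split; first by apply: face_simplex => //; exists None.
by move=> t /simplex_card h; rewrite (card_le_eqr (full_face_card gE)).
Qed.

Lemma vertexEW v : cell_vertex Phi v <-> exists g o, EW g /\ v = g (corner o).
Proof.
split=> [/vertexP[l [o ->]]|[g [o [gE ->]]]].
  by exists (aword l), o; split=> //; apply: ew_aword.
by apply: ew_vertex => //; apply: cell_vertex_corner.
Qed.

Lemma verticesP v : vertices Sigma v <-> cell_vertex Phi v.
Proof.
split=> [[s /simplexP[g [J [gE _ ->]]] [o _ ->]]|/vertexEW[g [o [gE ->]]]].
  by apply/vertexEW; exists g, o.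
exists (face g xpredT); first by apply: face_simplex => //; exists None.
by exists o.
Qed.

Lemma simplex_vertex s v : simplices Sigma s -> s v -> cell_vertex Phi v.
Proof. by move=> hs sv; apply/verticesP; exists s. Qed.

Lemma ew_corner_vertex g o : EW g -> cell_vertex Phi (g (corner o)).
Proof. by move=> gE; apply/vertexEW; exists g, o. Qed.

Lemma edgeP a b : edge Sigma a b <->
  exists g o o', [/\ EW g, o != o', a = g (corner o) & b = g (corner o')].
Proof.
split=> [[ab /simplexP[g [J [gE _ e]]]]|[g [o [o' [gE oo -> ->]]]]].
  have : face g J a by rewrite -e; left.
  have : face g J b by rewrite -e; right.
  move=> [o' _ eb] [o _ ea]; exists g, o, o'; split=> //.
  by apply/eqP => oo; apply: ab; rewrite ea eb oo.
split; first by move=> /(ew_inj gE)/corner_inj/eqP; rewrite (negbTE oo).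
apply/simplexP; exists g, (pred2 o o'); split=> //; first by exists o; rewrite /= eqxx.
apply/seteqP; split=> [x [->|->]|x [o1 /= /orP[/eqP ->|/eqP ->] ->]].
- by exists o; rewrite //= eqxx.
- by exists o'; rewrite //= eqxx orbT.
- by left.
- by right.
Qed.

Lemma edge_sym a b : edge Sigma a b -> edge Sigma b a.
Proof.
move=> /edgeP[g [o [o' [gE oo ea eb]]]]; apply/edgeP; exists g, o', o.
by rewrite eq_sym.
Qed.

Lemma ew_edge g a b : EW g -> edge Sigma a b -> edge Sigma (g a) (g b).
Proof.
move=> gE /edgeP[g' [o [o' [gE' oo -> ->]]]]; apply/edgeP; exists (g \o g'), o, o'.
by split=> //; apply: ew_comp.
Qed.

Lemma edge_vertex a b : edge Sigma a b -> cell_vertex Phi a /\ cell_vertex Phi b.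
Proof. by move=> /edgeP[g [o [o' [gE _ -> ->]]]]; split; apply: ew_corner_vertex. Qed.

Lemma vertexV v : cell_vertex Phi v -> v \in V.
Proof. by case. Qed.

Lemma closed_cell_convex p a b t : 0 <= t <= 1 ->
  closed_cell Phi p a -> closed_cell Phi p b -> closed_cell Phi p ((1 - t) *: a + t *: b).
Proof.
move=> /andP[t0 t1] [aV ha] [bV hb]; split; first by rewrite memvD // memvZ.
move=> al k aP; rewrite !dotE; have [h1 h2] := ha al k aP; have [h3 h4] := hb al k aP.
split=> h.
  have := h1 h; have := h3 h; nra.
have := h2 h; have := h4 h; nra.
Qed.

(** The vertex [y] is on the segment from [x] to [y'], hence in the closed cell with vertices [x]
    and [y'], which has no third vertex. *)
Lemma edge_ray_le r x y y' : edge Sigma x y -> edge Sigma x y' ->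
  0 < r <= 1 -> y - x = r *: (y' - x) -> y = y'.
Proof.
move=> [xy xys] [xy' [p pV e]] /andP[r0 r1] er.
have yv : cell_vertex Phi y by apply: (simplex_vertex xys); right.
have : (closed_cell Phi p `&` cell_vertex Phi) y.
  split=> //; have -> : y = (1 - r) *: x + r *: y'.
    by rewrite scalerBl scale1r -addrA (addrC (- _)) -scalerBr -er addrC subrK.
  have [h1 _] : (closed_cell Phi p `&` cell_vertex Phi) x by rewrite e; left.
  have [h2 _] : (closed_cell Phi p `&` cell_vertex Phi) y' by rewrite e; right.
  by apply: closed_cell_convex => //; rewrite ltW.
by rewrite e => -[yx|//]; case: xy; rewrite yx.
Qed.

Lemma edge_ray r x y y' : edge Sigma x y -> edge Sigma x y' ->
  0 < r -> y - x = r *: (y' - x) -> y = y'.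
Proof.
move=> xy xy' r0 e; have [r1|r1] := lerP r 1; first by apply: (edge_ray_le (r:=r) xy xy'); rewrite ?r0.
apply/esym; apply: (edge_ray_le (r:=r^-1) xy' xy).
  by rewrite invr_gt0 r0 invf_le1 // ltW.
by rewrite e scalerA mulVf ?scale1r // gt_eqF.
Qed.

(** * Special vertices *)

Lemma specialP x : special Phi x <-> coweight_lattice Phi x.
Proof.
split=> [[xv h]|xL]; last first.
  have gE := ew_shift xL.
  split.
    by have := ew_corner_vertex None gE; rewrite /corner addr0.
  have [xV xi] := xL.
  move=> al k aP; have [l el] := xi _ aP; exists al, l; split=> //.
  have a0 := dot_gt0 (rd_neq0 rd aP).
  have aV := rootV aP.
  (* The multiple of the root that shifts level [k] to level [l]. *)
  pose t := ((l - k)%:~R / dot al al) *: al.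
  have tV : t \in V by rewrite memvZ.
  have ta : dot t al = l%:~R - k%:~R by rewrite dotZl divfK ?gt_eqF // intrB.
  exists t; apply/seteqP; split=> [v [vV ev]|v [w [wV ew] <-]].
    exists (v - t); last by rewrite addrC subrK.
    by split; [rewrite memvB|rewrite dotBl ev ta; ring].
  by split; [rewrite memvD|rewrite dotDl ew ta; ring].
apply/latticeP; split; first exact: xv.1.
move=> al aP; have [be [l [bP [t e]] [_ xl]]] := h al 0 aP.
have a0 := dot_gt0 (rd_neq0 rd aP).
(* Parallelism of the walls puts the hyperplane orthogonal to [al] inside the one orthogonal to
   [be]. So [be] is a multiple of [al], and then plus or minus [al] because the system is
   reduced. *)
have inw d : d \in V -> dot d al = 0 -> dot d be = 0.
  move=> dV d0.
  have w0 : wall Phi be l (t + 0).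
    by rewrite e; exists 0 => //; split; rewrite ?mem0v ?dot0l.
  have w1 : wall Phi be l (t + d) by rewrite e; exists d.
  have [_ e0] := w0; have [_ e1] := w1; move: e0 e1.
  by rewrite addr0 dotDl => -> e1; apply: (addrI l%:~R); rewrite addr0.
have aV := rootV aP; have bV := rootV bP.
pose d := be - (dot be al / dot al al) *: al.
have dV : d \in V by rewrite memvB // memvZ.
have d0 : dot d al = 0 by rewrite /d dotBl dotZl divfK ?subrr // gt_eqF.
have [r eb] : exists r, be = r *: al.
  exists (dot be al / dot al al); apply/eqP; rewrite -subr_eq0; apply/eqP/dot_eq0; rewrite -/d.
  by rewrite {2}/d dotBr dotZr d0 (inw d) // mulr0 subrr.
have := rd_prim rd aP bP eb; move: xl; rewrite eb => xl [k1|k1].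
  by rewrite k1 scale1r in xl; rewrite xl intr_int.
rewrite k1 scaleN1r dotNr in xl.
by rewrite -rpredN xl intr_int.
Qed.

Lemma half_not_int : (2^-1 : R) \isn't a Num.int.
Proof.
apply/negP => /intrP[k e].
have : (1 : R) = (2 * k)%:~R by rewrite intrM -e divff // pnatr_eq0.
by move/(intr_inj (x1 := 1)); lia.
Qed.

Lemma special_corner_iff o : special Phi (corner o) <-> mark o = 1.
Proof.
rewrite specialP; case: o => [i|] /=; last by split=> // _; apply: lattice0.
split=> [/latticeP[_ /(_ _ (rd_simple rd i))]|->]; last first.
  by rewrite invr1 scale1r; apply: omega_lattice.
case: (rd_mark rd i) => [//|[-> _]].
by rewrite dotZl omegaPi eqxx mulr1 => h; move: half_not_int; rewrite h.
Qed.

Lemma special0 : special Phi 0.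
Proof. by rewrite -[0]/(corner None); apply/special_corner_iff. Qed.

Lemma ew_special g x : EW g -> special Phi x -> special Phi (g x).
Proof.
move=> [t [l [tL lP h]]] /specialP xL; apply/specialP; rewrite h.
by apply: latticeD => //; apply: lattice_wact.
Qed.

Lemma ew_special_iff g x : EW g -> special Phi (g x) <-> special Phi x.
Proof.
move=> gE; split=> [h|]; last exact: ew_special.
have [g' [gE' k1 k2]] := ew_inv gE; rewrite -(k1 x).
exact: ew_special.
Qed.

Lemma special_vertex x : special Phi x -> cell_vertex Phi x.
Proof. by case. Qed.

(** Translate by [- omega i], then move the alcove, which now has 0 among its vertices, into the
    dominant chamber by a Weyl group element. The result is the standard alcove again, so all
    corners of mark 1 look alike. *)
Lemma corner_congruence i : c i = 1 -> exists g,
  [/\ EW g, g (corner (Some i)) = 0 & face g xpredT = face id xpredT].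
Proof.
move=> ci; have zi : corner (Some i) = omega i by rewrite /= ci invr1 scale1r.
pose r := barycenter xpredT.
have r0 o : 0 < aff o r.
  have [|h1 h2] := @aff_barycenter xpredT o; first by exists o.
  by rewrite lt_def h1 h2.
have rV : r \in V by apply: barycenterV.
have rA : alcove0 r by split=> // o; apply: ltW.
have pV : r - omega i \in V by rewrite memvB // omegaV.
(* Restricting to [isSome] uses only walls through the origin, so the resulting word is linear. *)
have [|l [lP _ hl]] := @descent isSome (fun=> True) _ pV I; first by [].
have [ws [wP hw]] : exists ws, {subset ws <= Phi} /\ forall q, aword l q = wact ws q.
  elim: l lP {hl} => [|[j|] l IH] //= lP; first by exists [::].
  have [ws [wP hw]] := IH lP; exists (Pi j :: ws); split.
    by move=> x; rewrite inE => /orP[/eqP ->|/wP //]; apply: (rd_simple rd).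
  by move=> q; rewrite /= -hw (areflE) /= mulr0 mul0r scale0r subr0.
have shE : EW (fun v => - omega i + v).
  by apply: ew_shift; apply: latticeN; apply: omega_lattice.
pose g := fun v => wact ws (- omega i + v).
have gE : EW g := ew_comp (ew_wact wP) shE.
have g0 : g (corner (Some i)) = 0 by rewrite /g /= -/(corner (Some i)) zi addNr wact0.
have grA : alcove0 (g r).
  split=> [|[j|]]; first exact: ewV.
    by have := hl (Some j) isT; rewrite hw addrC.
  rewrite /aff /= dotNr addrC subr_ge0 wact_dotC // addrC.
  have tP : wact (rev ws) theta \in Phi.
    by apply: wact_root; [apply: subset_rev|apply: (rd_highest_in rd)].
  rewrite dotBl; case: (rd_sign rd tP) => h.
    have /andP[_ h1] := alcove0_pos rA tP h.
    by rewrite lerBlDr (le_trans h1) // lerDl.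
  have hN j : 0 <= dot (omega j) (- wact (rev ws) theta) by rewrite dotNr oppr_ge0.
  have /andP[h0 _] := alcove0_pos rA (rd_opp rd tP) hN.
  (* Here the mark 1 is decisive: translating by [- omega i] adds at most 1 to the value of the
     root. *)
  move: h0 (rd_highest rd (rd_opp rd tP) i); rewrite ci !dotNr; lra.
have map o : exists o', g (corner o) = corner o'.
  apply: alcove0_vertex; last exact: ew_corner_vertex.
  have : closed_cell Phi (g r) (g (corner o)).
    apply/(ew_cell _ _ gE); apply/(cell_alcove0 rA (cornerV o)).
    split=> [|o' h]; first exact: corner_alcove0.
    by have := r0 o'; rewrite h ltxx.
  by case/(cell_alcove0 grA (ewV gE (cornerV o))).
have [s hs] := choice map.
have si : injective s.
  move=> o o' e; apply: corner_inj; apply: (ew_inj gE).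
  by rewrite !hs e.
exists g; split=> //; apply/seteqP; split=> [x [o _ ->]|x [o _ ->]].
  by exists (s o) => //; rewrite hs.
have /codomP[o' ->] := injF_onto si o.
by exists o' => //; rewrite hs.
Qed.

Lemma alcove_corner g x : EW g -> face g xpredT x -> special Phi x ->
  exists g', [/\ EW g', g' 0 = x & face g' xpredT = face g xpredT].
Proof.
move=> gE [o _ ->] /(ew_special_iff _ gE)/special_corner_iff.
case: o => [i|] /= ci; last by exists g.
have [h [hE h0 hf]] := corner_congruence ci.
have [h' [hE' k1 k2]] := ew_inv hE.
exists (g \o h'); split; first exact: ew_comp.
  by rewrite /= -h0 k1.
apply/seteqP; split=> [x' [o _ ->]|x' [o _ ->]] /=.
  have : face id xpredT (corner o) by exists o.
  by rewrite -hf => -[o' _ ->]; exists o' => //; rewrite k1.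
have : face h xpredT (h (corner o)) by exists o.
by rewrite hf => -[o' _ e]; exists o' => //=; rewrite -e k1.
Qed.

(** The images of the [n] simple roots, taken relative to the image of 0, are free by injectivity,
    and [V] has dimension at most [n]. *)
Lemma eisometry_onto g : eisometry V g -> forall y, y \in V -> exists2 x, x \in V & g x = y.
Proof.
move=> gI y yV.
have PiV i : Pi i \in V by apply/rootV/(rd_simple rd).
have g0V : g 0 \in V by apply: gI.1; rewrite mem0v.
pose X := [tuple g (Pi i) - g 0 | i < n].
have XE (k : 'I_n -> R) : g (\sum_i k i *: Pi i) = g 0 + \sum_i k i *: X`_i.
  rewrite (eisometry_sum (k := k) (x := Pi) gI (mem0v _) PiV).
    by congr (_ + _); apply: eq_bigr => i _; rewrite -tnth_nth tnth_mktuple.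
  by rewrite add0r; under [in RHS]eq_bigr do rewrite subr0.
have Xfree : free X.
  apply/freeP => k k0 i; have := XE k; rewrite k0 addr0 => /(eisometry_inj gI).
  rewrite mem0v memv_suml => [|j _]; last by rewrite memvZ.
  move=> /(_ isT isT) /(congr1 (dot (omega i))); rewrite dot0r dot_sumr (bigD1 i) //=.
  rewrite dotZr omegaPi eqxx mulr1 big1 ?addr0 // => j ji.
  by rewrite dotZr omegaPi eq_sym (negbTE ji) mulr0.
have XV : (<<X>> <= V)%VS.
  apply/span_subvP => x /mapP[i _ ->]; rewrite memvB //; exact: gI.1.
have dV : (\dim V <= n)%N.
  have -> : n = size [tuple Pi i | i < n] by rewrite size_tuple.
  apply: leq_trans (dim_span _); apply: dimvS; apply/subvP => v vV.
  rewrite (expand_omega vV) memv_suml // => i _; rewrite memvZ // memv_span //.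
  by apply/tnthP; exists i; rewrite tnth_mktuple.
have eV : (<<X>> = V)%VS.
  by apply/eqP; rewrite eqEdim XV (eqP Xfree) size_tuple.
have yX : y - g 0 \in <<X>>%VS by rewrite eV memvB.
exists (\sum_i coord X i (y - g 0) *: Pi i).
  by rewrite memv_suml // => i _; rewrite memvZ.
by rewrite XE -(coord_span yX) addrC subrK.
Qed.

(** The distances to the other corners force the displacement [D] to be a multiple of [aroot o]. The
    remaining equation is quadratic in the factor, with one root for the corner and one for its
    mirror image. *)
Lemma mirror_positions o x : x \in V ->
  (forall j, j != o -> dsq x (corner j) = dsq (corner o) (corner j)) ->
  x = corner o \/ x = arefl o (corner o).
Proof.
move=> xV h; pose D := x - corner o.
have DV : D \in V by rewrite memvB // cornerV.
have eqD j : j != o -> 2 * dot D (corner j) = dot D D + 2 * dot D (corner o).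
  move=> /h; rewrite /dsq /D !dotE !(dotC (corner j)) !(dotC (corner o)); lra.
(* The common scalar product of [D] with the corners other than [o]. Subtracting [ka] times the
   relation [sum_mark_aroot] cancels all their terms in the expansion of [D]. *)
pose ka := (dot D D + 2 * dot D (corner o)) / 2.
have eD : D = (mark o * (dot D (corner o) - ka)) *: aroot o.
  rewrite {1}(expand_omega DV).
  transitivity (\sum_o' (mark o' * dot D (corner o')) *: aroot o').
    rewrite big_option /= dot0r mulr0 scale0r add0r; apply: eq_bigr => i _.
    rewrite dotZr mulrA divff ?mul1r 1?dotC // gt_eqF //; exact: c_gt0.
  have := sum_mark_aroot => e0.
  transitivity (\sum_o' (mark o' * dot D (corner o')) *: aroot o' - ka *: \sum_o' mark o' *: aroot o').
    by rewrite e0 scaler0 subr0.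
  rewrite scaler_sumr -sumrB (bigD1 o) //= big1 => [|j jo].
    by rewrite addr0 scalerA -scalerBl; congr (_ *: _); ring.
  rewrite scalerA -scalerBl [X in X *: _](_ : _ = 0) ?scale0r //.
  by have := eqD j jo; rewrite /ka => <-; field.
have [j jo] : exists j, j != o.
  case: (o) => [i|]; first by exists None.
  by exists (Some (Ordinal (rd_rank rd))).
have := eqD j jo; rewrite eD.
set t := mark o * _; move=> ht.
have a0 := dot_aroot_gt0 o.
have eo : dot (aroot o) (corner o) - dot (aroot o) (corner j) = (mark o)^-1.
  have := aff_corner o o; have := aff_corner o j.
  rewrite /aff eqxx eq_sym (negbTE jo) !(dotC (aroot o)) mul0r mul1r => h1 h2.
  by rewrite -h2; move: h1; lra.
have : t = 0 \/ t * dot (aroot o) (aroot o) + 2 / mark o = 0.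
  have [->|t0] := eqVneq t 0; [by left|right].
  apply: (mulfI t0); rewrite -eo mulr0; move: ht; rewrite !dotE; lra.
move=> [t0|t1]; [left|right]; apply/eqP.
  by rewrite -subr_eq0 -/D eD -/t t0 scale0r.
have -> : x = corner o + D by rewrite addrC subrK.
rewrite eD -/t /arefl aff_corner eqxx mul1r -scaleNr; apply/eqP; congr (_ + _ *: _).
apply: (mulIf (lt0r_neq0 a0)); rewrite mulNr divfK ?gt_eqF //.
by apply/eqP; rewrite -addr_eq0; apply/eqP.
Qed.

(** * Rigidity *)

(* Two maps that agree on an alcove agree on the vertex beyond each of its
   panels: that vertex has only two possible images, the other one being taken. *)
Lemma rigidity (h g u : 'rV[R]_m -> 'rV[R]_m) :
  (forall v, cell_vertex Phi v -> h v \in V) ->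
  (forall v w, cell_vertex Phi v -> cell_vertex Phi w -> h v = h w -> v = w) ->
  (forall s v w, simplices Sigma s -> s v -> s w -> dsq (h v) (h w) = dsq v w) ->
  eisometry V g -> EW u -> (forall o, h (u (corner o)) = g (u (corner o))) ->
  forall v, cell_vertex Phi v -> h v = g v.
Proof.
move=> hV hinj hd gI uE hu v vv.
have [u' [uE' k1 k2]] := ew_inv uE.
have [l [o e]] := (vertexP _).1 (ew_vertex uE' vv).
rewrite -(k2 v) e {v vv e}.
(* A word is a gallery: dropping its last letter crosses one panel, and only the corner opposite to
   that panel moves. *)
elim/last_ind: l o => [|l o1 IH] o; first exact: hu.
have -> : aword (rcons l o1) (corner o) = aword l (arefl o1 (corner o)).
  by rewrite /aword foldr_rcons.
have [eo|oo1] := eqVneq o1 o; last first.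
  by rewrite (arefl_fix (o:=o1)) ?aff_corner ?(negbTE oo1) ?mul0r // IH.
rewrite {o1}eo.
have wE : EW (u \o aword l) by apply: ew_comp => //; apply: ew_aword.
have wsE : EW (u \o aword l \o arefl o) by apply: ew_comp => //; apply: ew_arefl.
set w := u \o aword l in wE wsE; rewrite -[u (aword l _)]/(w (arefl o (corner o))).
have zzw j : cell_vertex Phi (w (corner j)) by apply: ew_corner_vertex.
have vw : cell_vertex Phi (w (arefl o (corner o))) by apply: (ew_corner_vertex o wsE).
have [a aV ea] := eisometry_onto gI (hV _ vw).
have [w' [wE' j1 j2]] := ew_inv wE.
have sfix j : j != o -> arefl o (corner j) = corner j.
  by move=> jo; rewrite (arefl_fix (o:=o)) // aff_corner eq_sym (negbTE jo) mul0r.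
have [wV wd] := ew_eisometry wE; have [gV gd] := gI.
have srE := ew_eisometry (ew_arefl o); have [sV sd] := srE.
have [||e|e] := @mirror_positions o (w' a).
- exact: ewV.
- move=> j jo.
  have waV : w' a \in V by apply: ewV.
  have zV o' : corner o' \in V by apply: cornerV.
  have e1 : dsq (w' a) (corner j) = dsq (h (w (arefl o (corner o)))) (g (w (corner j))).
    by rewrite -wd // j2 -ea gd //; apply: wV.
  have e2 : dsq (corner o) (corner j) = dsq (w (arefl o (corner o))) (w (corner j)).
    by rewrite -sd // (sfix j jo) wd //; apply: sV.
  rewrite e1 e2.
  rewrite -[g (w _)]IH; apply: (hd (face (w \o arefl o) xpredT)).
  + by apply: face_simplex => //; exists None.
  + by exists o.
  + by exists j => //=; rewrite sfix.
- have : h (w (arefl o (corner o))) = h (w (corner o)) by rewrite -ea -(j2 a) e [RHS]IH.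
  move/hinj => /(_ vw (zzw o))/(ew_inj wE)/(congr1 (aff o)).
  rewrite aff_arefl aff_corner eqxx mul1r => h1.
  have := mark_gt0 o; rewrite -invr_gt0 => h2.
  have := h2; rewrite -{1}h1 oppr_gt0 => h3.
  by have := lt_trans h2 h3; rewrite ltxx.
- by rewrite -ea -(j2 a) e.
Qed.

(** [g] is the affine extension of [h] from the standard alcove, [c i * dot v (Pi i)] being the
    coordinate of [v] at the corner [Some i]. It is an isometry because [h] preserves the edge
    lengths of the alcove, hence the Gram matrix of its corners. Rigidity does the rest. *)
Lemma sim_isometry_ext (h : Sigma -> Sigma) : simplicial_isometry h ->
  exists2 g, eisometry V g & forall v, cell_vertex Phi v -> h v = g v.
Proof.
move=> hI.
have hv v : cell_vertex Phi v -> cell_vertex Phi (h v).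
  by move=> /verticesP vv; apply/verticesP; apply: (sim_vertex hI).
have hV v : cell_vertex Phi v -> h v \in V by move=> /hv[].
have hd s v w : simplices Sigma s -> s v -> s w -> dsq (h v) (h w) = dsq v w.
  by move=> hs sv sw; apply: enorm_inj; case: hI => _ _ /(_ s v w hs sv sw).
pose X i := h (corner (Some i)) - h 0.
have zv o : cell_vertex Phi (corner o) by apply: cell_vertex_corner.
have XV i : X i \in V by rewrite memvB ?hV //; apply: (zv None).
have XX i j : dot (X i) (X j) = dot (corner (Some i)) (corner (Some j)).
  rewrite -[in RHS](subr0 (corner (Some i))) -[in RHS](subr0 (corner (Some j))) !polarization.
  have d o o' : dsq (h (corner o)) (h (corner o')) = dsq (corner o) (corner o').
    apply: (hd (face id xpredT)); [|by exists o|by exists o'].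
    by apply: face_simplex; [apply: ew_id|exists None].
  have := d (Some i) None; have := d (Some j) None; have := d (Some i) (Some j).
  by rewrite /= => -> -> ->.
pose g v := h 0 + \sum_i (c i * dot v (Pi i)) *: X i.
have gI : eisometry V g.
  split=> [v vV|v w vV wV].
    by rewrite memvD ?hV ?memv_suml //; [exact: (zv None)|move=> i _; rewrite memvZ].
  rewrite /dsq /g opprD addrACA subrr add0r -sumrB.
  under eq_bigr do rewrite -scalerBl -mulrBr -dotBl.
  have dV : v - w \in V by rewrite memvB.
  have eD : v - w = \sum_i (c i * dot (v - w) (Pi i)) *: corner (Some i).
    rewrite {1}(barycentric dV) big_option /= scaler0 add0r.
    by apply: eq_bigr => i _; rewrite /aff /= addr0.
  have eDD : dot (v - w) (v - w) = dot (\sum_i (c i * dot (v - w) (Pi i)) *: corner (Some i))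
      (\sum_i (c i * dot (v - w) (Pi i)) *: corner (Some i)) by rewrite -eD.
  rewrite [RHS]eDD.
  rewrite dot_suml [RHS]dot_suml; apply: eq_bigr => i _.
  rewrite dotZl [RHS]dotZl; congr (_ * _).
  rewrite dot_sumr [RHS]dot_sumr; apply: eq_bigr => j _.
  by rewrite dotZr [RHS]dotZr XX.
exists g => //; apply: (rigidity _ _ _ gI ew_id) => //.
  move=> v w /verticesP vv /verticesP ww; exact: (sim_inj hI vv ww).
move=> [j|] /=; rewrite /g.
  rewrite (bigD1 j) //= big1 => [|i ij]; rewrite dotZl omegaPi.
    by rewrite eqxx mulr1 divff ?gt_eqF ?c_gt0 // scale1r addr0 /X addrC subrK.
  by rewrite eq_sym (negbTE ij) !mulr0 scale0r.
by rewrite big1 ?addr0 // => i _; rewrite dot0l mulr0 scale0r.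
Qed.

(** An isometry that permutes the corners preserves the heights of the alcove, and the height over
    the wall [o] is the inverse of the norm of [mark o *: aroot o]. *)
Lemma eisometry_perm_mark g (s : option 'I_n -> option 'I_n) :
  eisometry V g -> injective s -> (forall o, g (corner o) = corner (s o)) ->
  forall o, mark o ^+ 2 * dot (aroot o) (aroot o) = mark (s o) ^+ 2 * dot (aroot (s o)) (aroot (s o)).
Proof.
move=> gI si gs.
have gaff x o : x \in V -> mark (s o) * aff (s o) (g x) = mark o * aff o x.
  move=> xV; pose t o := mark o * aff o x.
  have t1 : \sum_o t o = 1 by apply: sum_aff.
  have ex : x = corner None + \sum_o t o *: (corner o - corner None).
    rewrite add0r {1}(barycentric xV); apply: eq_bigr => o' _.
    by rewrite subr0.
  have [s' k1 k2] := injF_bij si.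
  rewrite (eisometry_sum gI (cornerV None) cornerV ex).
  have -> : g (corner None) + \sum_o0 t o0 *: (g (corner o0) - g (corner None)) =
            \sum_o0 t (s' o0) *: corner o0.
    under eq_bigr do rewrite scalerBr.
    rewrite sumrB -scaler_suml t1 scale1r addrC subrK [RHS](reindex s) /=.
      by apply: eq_bigr => o' _; rewrite k1 gs.
    by apply: onW_bij; exists s'.
  rewrite aff_comb ?k1; last first.
    by rewrite -t1 [RHS](reindex s') //=; apply: onW_bij; exists s.
  by rewrite mulrCA divff ?mulr1 // gt_eqF // mark_gt0.
pose N o := mark o ^+ 2 * dot (aroot o) (aroot o).
have le o : N o <= N (s o).
  pose a := mark o *: aroot o; pose b := mark (s o) *: aroot (s o).
  have aV : a \in V by rewrite memvZ // rootV // aroot_root.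
  have Na : N o = dot a a by rewrite /N dotZl dotZr mulrA expr2.
  have Nb : N (s o) = dot b b by rewrite /N dotZl dotZr mulrA expr2.
  have N0 : 0 < N o by rewrite /N mulr_gt0 ?dot_aroot_gt0 // exprn_gt0 // mark_gt0.
  have e : dot (g a - g 0) b = dot a a.
    have := gaff a o aV; have := gaff 0 o (mem0v _).
    rewrite /aff /b /a dotZr dotBl !dotE; lra.
  (* The scalar product with [b] reproduces the norm of [a], so Cauchy-Schwarz bounds the norm of
     [a] by that of [b]. *)
  have := cauchy_schwarz (g a - g 0) b; rewrite e (eisometry_dot gI) ?mem0v // subr0 -Na -Nb.
  by rewrite expr2 ler_pM2l.
(* A permutation preserves the total, so the inequalities [le] are all equalities. *)
have : \sum_o (N (s o) - N o) = 0.
  rewrite sumrB [X in _ - X](reindex s) ?subrr //; apply: onW_bij; exact: injF_bij.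
move=> /eqP; rewrite psumr_eq0 => [/allP h o|o _]; last by rewrite subr_ge0.
have := h o (mem_index_enum o); rewrite /= subr_eq0 => /eqP h'.
by rewrite -/(N o) -/(N (s o)) h'.
Qed.

Lemma mark_norm o : mark o = 1 <-> mark o ^+ 2 * dot (aroot o) (aroot o) = dot theta theta.
Proof.
case: o => [i|] /=; first exact: (rd_norm rd).
by split=> // _; rewrite expr1n mul1r dotNl dotNr opprK.
Qed.

Lemma ew_special_corner g o : EW g -> special Phi (g (corner o)) <-> mark o = 1.
Proof. by move=> gE; rewrite ew_special_iff // special_corner_iff. Qed.

Lemma sim_alcove (h : Sigma -> Sigma) g : simplicial_isometry h -> EW g ->
  exists2 g', EW g' & h @` face g xpredT = face g' xpredT.
Proof.
move=> hI gE; have hs : simplices Sigma (face g xpredT).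
  by apply: face_simplex => //; exists None.
apply: full_simplex; first exact: (sim_simplex hI).
rewrite (card_le_eqr (inj_card_eq _)).
  by rewrite (card_le_eqr (full_face_card gE)).
move=> x y /set_mem sx /set_mem sy; apply: (sim_inj hI).
  by exists (face g xpredT).
by exists (face g xpredT).
Qed.

(** Specialness is visible in the metric of an alcove: carried back to the standard alcove, [h]
    permutes the corners isometrically, which preserves heights, and by [mark_norm] the heights
    single out the corners of mark 1. *)
Lemma sim_special (h : Sigma -> Sigma) x : simplicial_isometry h ->
  special Phi x -> special Phi (h x).
Proof.
move=> hI xs; have [g1 [o [gE1 ex]]] := (vertexEW _).1 (special_vertex xs).
have [g2 gE2 e2] := sim_alcove hI gE1.
have [g gI hg] := sim_isometry_ext hI.
have [g2' [gE2' k1 k2]] := ew_inv gE2.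
have map o' : exists o'', h (g1 (corner o')) = g2 (corner o'').
  have : (h @` face g1 xpredT) (h (g1 (corner o'))) by exists (g1 (corner o')) => //; exists o'.
  by rewrite e2 => -[o'' _ ->]; exists o''.
have [s hs] := choice map.
have hv o' : h (g1 (corner o')) = g (g1 (corner o')) by apply: hg; apply: ew_corner_vertex.
have [g1V _] := ew_eisometry gE1.
have si : injective s.
  move=> a b e; have : g (g1 (corner a)) = g (g1 (corner b)) by rewrite -!hv !hs e.
  move/(eisometry_inj gI); rewrite !g1V ?cornerV // => /(_ isT isT).
  by move/(ew_inj gE1)/corner_inj.
have GI : eisometry V (g2' \o (g \o g1)).
  apply: eisometry_comp; first exact: ew_eisometry.
  by apply: eisometry_comp => //; apply: ew_eisometry.
have Gs o' : (g2' \o (g \o g1)) (corner o') = corner (s o') by rewrite /= -hv hs k1.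
have := eisometry_perm_mark GI si Gs o.
move: xs; rewrite ex hs !ew_special_corner // => co e.
by apply/mark_norm; rewrite -e; apply/mark_norm.
Qed.

Lemma ew_sim g : EW g -> @simplicial_isometry R Sigma Sigma g.
Proof.
move=> gE; split.
- by move=> x y _ _; apply: (ew_inj gE).
- have img h s : EW h -> simplices Sigma s -> simplices Sigma (h @` s).
    move=> hE /simplexP[k [J [kE Jo ->]]]; apply/simplexP.
    exists (h \o k), J; split=> //; first exact: ew_comp.
    apply/seteqP; split=> [_ [_ [o Jo' ->] <-]|_ [o Jo' ->]]; first by exists o.
    by exists (k (corner o)) => //; exists o.
  have [g' [gE' k1 k2]] := ew_inv gE.
  apply/seteqP; split=> [_ [s hs <-]|s hs]; first exact: img.
  exists (g' @` s); first exact: img.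
  rewrite image_comp; apply/seteqP; split=> [_ [x sx <-]|x sx] /=; first by rewrite k2.
  by exists x => //=; rewrite k2.
- move=> s x y hs sx sy /=; rewrite /enorm; congr Num.sqrt.
  have [_ h] := ew_eisometry gE.
  by apply: h; apply: (vertexV (simplex_vertex hs _)).
Qed.

(** * Types of edges *)

Lemma ew_affine g x y t : EW g ->
  g ((1 - t) *: x + t *: y) = (1 - t) *: g x + t *: g y.
Proof.
move=> [T [l [_ _ h]]]; rewrite !h wactD !wactZ !scalerDr addrACA -scalerDl.
by rewrite subrK scale1r.
Qed.

Lemma ew_segment g x y : EW g -> segment (g x) (g y) = g @` segment x y.
Proof.
move=> gE; apply/seteqP; split=> [_ [t t01 <-]|_ [_ [t t01 <-] <-]].
  by exists ((1 - t) *: x + t *: y); [exists t|rewrite ew_affine].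
by exists t; rewrite // ew_affine.
Qed.

Lemma ew_special_segment g x y : EW g ->
  special_segment Phi x y -> special_segment Phi (g x) (g y).
Proof.
move=> gE [xs ys h]; split; [exact: ew_special|exact: ew_special|].
rewrite ew_segment // => _ [q /h [a [b [hab q_ab]]] <-].
exists (g a), (g b); split; last by rewrite ew_segment //; exists q.
by have := sim_simplex (ew_sim gE) hab; rewrite image_setU !image_set1.
Qed.

Lemma ew_edge_on g x y a b : EW g ->
  edge_on Phi x y a b -> edge_on Phi (g x) (g y) (g a) (g b).
Proof.
move=> gE [hab h]; split; first exact: ew_edge.
by rewrite !ew_segment //; apply: image_subset.
Qed.

Lemma zE i : z i = (c i)^-1 *: omega i. Proof. by []. Qed.

Lemma c_z i : c i *: z i = omega i.
Proof. by rewrite scalerA divff ?scale1r // gt_eqF // c_gt0. Qed.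

Lemma edge_0z i : edge Sigma 0 (z i).
Proof.
apply/edgeP; exists id, None, (Some i).
by split=> //; apply: ew_id.
Qed.

Lemma mark_step i (k : nat) : k.+1%:R <= c i -> k = 0%N \/ k = 1%N /\ c i = 2.
Proof.
case: (rd_mark rd i) => [->|[-> _]]; first by rewrite (ler_nat R _ 1); left; lia.
rewrite ler_nat => h; have [->|k0] := eqVneq k 0%N; [by left|right; split=> //; lia].
Qed.

(* For a mark 2, the point inversion of the ray exchanges its two halves. *)
Lemma step_edge i (k : nat) : k.+1%:R <= c i -> edge Sigma (k%:R *: z i) (k.+1%:R *: z i).
Proof.
move=> /mark_step[->|[-> c2]].
  by rewrite scale0r scale1r; apply: edge_0z.
have [e|[_ [l lP hl]]] := rd_mark rd i.
  by move: c2; rewrite e => /eqP; rewrite eq_sym (eqr_nat R 2 1).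
have gE : EW (fun v => omega i + wact l v).
  by exists (omega i), l; split=> //; apply: omega_lattice.
have := ew_edge gE (edge_0z i); rewrite wact0 addr0 (hl (z i)) ?cornerV //.
have -> : omega i - z i = z i.
  by rewrite -(c_z i) c2 -[in X in _ - X](scale1r (z i)) -scalerBl addrK scale1r.
by rewrite scale1r -c2 c_z => /edge_sym.
Qed.

Lemma step_segment i (k : nat) : k.+1%:R <= c i ->
  segment (k%:R *: z i) (k.+1%:R *: z i) `<=` segment 0 (omega i).
Proof.
move=> h _ [t /andP[t0 t1] <-]; have c0 := c_gt0 i.
exists ((k%:R + t) / c i); last first.
  rewrite scaler0 add0r zE !scalerA -scalerDl; congr (_ *: _).
  by rewrite -natr1; field; rewrite gt_eqF.
have k0 : (0 : R) <= k%:R by apply: ler0n.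
apply/andP; split; first by rewrite divr_ge0 ?addr_ge0 // ltW.
rewrite ler_pdivrMr // mul1r; move: h; rewrite -natr1; lra.
Qed.

Lemma step_codirected i (k : nat) : codirected 0 (omega i) (k%:R *: z i) (k.+1%:R *: z i).
Proof.
exists (c i)^-1; first by rewrite invr_gt0 c_gt0.
by rewrite -scalerBl -natr1 addrC addKr scale1r subr0.
Qed.

Lemma omega_segment i : special_segment Phi 0 (omega i).
Proof.
split; [exact: special0|by apply/specialP/omega_lattice|].
move=> _ [t /andP[t0 t1] <-]; rewrite scaler0 add0r -c_z.
have step (k : nat) s : k.+1%:R <= c i -> 0 <= s <= 1 ->
    skeleton1 Phi ((k%:R + s) *: z i).
  move=> hk hs; exists (k%:R *: z i), (k.+1%:R *: z i); split.
    by have [] := step_edge hk.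
  exists s => //; rewrite !scalerA -scalerDl -natr1; congr (_ *: _); ring.
case: (rd_mark rd i) => [c1|[c2 _]].
  have -> : t *: (c i *: z i) = (0%:R + t) *: z i by rewrite add0r c1 scale1r.
  by apply: step; rewrite ?c1 // t0.
have [th|th] := lerP t (2^-1).
  have -> : t *: (c i *: z i) = (0%:R + t * 2) *: z i by rewrite add0r scalerA c2.
  by apply: step; [rewrite c2 ler_nat|apply/andP; split; lra].
have -> : t *: (c i *: z i) = (1%:R + (t * 2 - 1)) *: z i.
  by rewrite addrC subrK scalerA c2.
by apply: step; [rewrite c2|apply/andP; split; lra].
Qed.

Lemma step_edge_on g i (k : nat) : EW g -> k.+1%:R <= c i ->
  edge_on Phi (g 0) (g (omega i)) (g (k%:R *: z i)) (g (k.+1%:R *: z i)).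
Proof.
move=> gE h; apply: ew_edge_on => //; split; first exact: step_edge.
exact: step_segment.
Qed.

Lemma step_quasi_special g i (k : nat) : EW g -> k.+1%:R <= c i ->
  quasi_special Phi (g (k%:R *: z i)) (g (k.+1%:R *: z i)).
Proof.
move=> gE h; exists (g 0), (g (omega i)); split; last exact: step_edge_on.
by apply: ew_special_segment => //; apply: omega_segment.
Qed.

Section Ordering.
Variable T : 'rV[R]_m -> 'rV[R]_m -> 'I_n.
Hypotheses (TO : coxeter_ordering Phi T) (Tz : forall i, T 0 (z i) = i).

Lemma one_le_c i : 1%:R <= c i.
Proof. by case: (rd_mark rd i) => [->|[-> _]]; rewrite ?lexx ?(ler_nat R 1 2). Qed.

Lemma ordering_edge g i : EW g -> T (g 0) (g (z i)) = i.
Proof.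
move=> gE; have [_ h _] := TO; rewrite h ?Tz //.
have := step_quasi_special ew_id (one_le_c i).
by rewrite /= scale0r scale1r.
Qed.

(** Invariance reduces to [g] = [id]; constancy along the segment from 0 to [omega i] then reduces
    to its first edge. *)
Lemma ordering_step g i (k : nat) : EW g -> k.+1%:R <= c i ->
  T (g (k%:R *: z i)) (g (k.+1%:R *: z i)) = i.
Proof.
move=> gE hk; have [_ h h3] := TO.
rewrite h //; last exact: (step_quasi_special ew_id).
transitivity (T 0 (z i)); last exact: Tz.
apply: (h3 0 (omega i)).
- exact: omega_segment.
- exact: (step_edge_on ew_id).
- exact: step_codirected.
- by have := step_edge_on ew_id (one_le_c i); rewrite /= scale0r scale1r.
- by have := step_codirected i 0; rewrite scale0r scale1r.
Qed.

(* The dominant element of the Weyl orbit of a vertex adjacent to 0 is a vertex of the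
   standard alcove, and it has the same type. *)
Lemma dominance (w : seq 'rV[R]_m) (j k : 'I_n) : {subset w <= Phi} ->
  0 <= dot (omega k) (z j - wact w (z j)).
Proof.
move=> wP; set la := wact w (z j).
have laV : la \in V by rewrite /la wactV // cornerV.
pose Q q := exists2 l : seq 'rV[R]_m, {subset l <= Phi} &
  q = wact l (z j) /\ forall i, 0 <= dot (omega i) (q - la).
have [||l [lP [l' lP' [e hQ]] hl]] := @descent isSome Q la laV.
- by exists w => //; split=> // i; rewrite subrr dot0r.
- move=> q [i|] // qV _ [l lP [e hq]] neg; exists (Pi i :: l).
    by move=> x; rewrite inE => /orP[/eqP ->|/lP //]; apply: (rd_simple rd).
  split; first by rewrite (areflE) /= mulr0 mul0r scale0r subr0 e.
  move=> i'; rewrite /arefl addrAC dotBr dotZr omegaPi addr_ge0 // -mulNr.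
  rewrite mulr_ge0 ?ler0n // oppr_ge0 mulr_le0_ge0 ?invr_ge0 ?dot_ge0 //.
  by rewrite mulr_ge0_le0 // ltW.
rewrite e in hQ; set q := wact l' (z j) in e hQ.
have qV : q \in V by rewrite /q wactV // cornerV.
have qA : alcove0 q.
  split=> // -[i|]; first by rewrite -e; apply: hl.
  rewrite /aff /= dotNr addrC subr_ge0 wact_dotC //.
  have tP : wact (rev l') theta \in Phi.
    by apply: wact_root; [apply: subset_rev|apply: (rd_highest_in rd)].
  have zA := corner_alcove0 (Some j).
  case: (rd_sign rd tP) => h; first by have /andP[] := alcove0_pos zA tP h.
  have hN i : 0 <= dot (omega i) (- wact (rev l') theta) by rewrite dotNr oppr_ge0.
  have /andP[h0 _] := alcove0_pos zA (rd_opp rd tP) hN.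
  by move: h0; rewrite dotNr oppr_ge0 => /le_trans; apply.
have lE := ew_wact lP'.
have [o eo] : exists o, q = corner o.
  apply: alcove0_vertex => //.
  by apply: (ew_vertex lE); apply: cell_vertex_corner.
have qj : q = z j.
  have := ordering_edge j lE; rewrite wact0 -/q eo.
  case: o eo => [i|] eo; first by rewrite Tz => ->.
  have : wact l' (z j) = wact l' (corner None) by rewrite -/q eo wact0.
  by move=> /(ew_inj lE)/corner_inj.
by rewrite -qj; apply: hQ.
Qed.

(** By [dominance] every [z (t y) - d y] has nonnegative coordinates in the simple roots. They add
    up to 0, so each of them vanishes. *)
Lemma sum_extremal (I : finType) (t : I -> 'I_n) (d : I -> 'rV[R]_m) :
  (forall x, exists2 w : seq 'rV[R]_m, {subset w <= Phi} & d x = wact w (z (t x))) ->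
  \sum_x d x = \sum_x z (t x) -> forall x, d x = z (t x).
Proof.
move=> hd e x.
have dV y : d y \in V.
  by have [w wP ->] := hd y; apply: wactV => //; apply: cornerV.
have ge k y : 0 <= dot (omega k) (z (t y) - d y).
  by have [w wP ->] := hd y; apply: dominance.
have DV : z (t x) - d x \in V by rewrite memvB ?cornerV.
apply/esym/eqP; rewrite -subr_eq0; apply/eqP.
rewrite (expand_omega DV) big1 // => k _.
have : \sum_y dot (omega k) (z (t y) - d y) = 0.
  by rewrite -dot_sumr sumrB e subrr dot0r.
move=> /eqP; rewrite psumr_eq0 => [/allP h|y _]; last exact: ge.
by have /eqP -> := h x (mem_index_enum x); rewrite scale0r.
Qed.

Lemma reflection_fix al v : dot v al = 0 -> reflection al v = v.
Proof. by move=> h; rewrite reflectionE h mulr0 mul0r scale0r subr0. Qed.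

(* The stabilizer of [omega i] is the product of the parabolic subgroups on the nodes
   below i and above i; the former fixes [omega j] and the latter fixes
   [omega k] for every k <= i. *)
Lemma parabolic_transport (i j : 'I_n) (w : seq 'rV[R]_m) : (i < j)%N -> {subset w <= Phi} ->
  dot (z i) (wact w (z j)) = dot (z i) (z j) ->
  exists l : seq 'rV[R]_m, [/\ {subset l <= Phi}, forall k : 'I_n, (k <= i)%N -> wact l (z k) = z k
    & wact l (z j) = wact w (z j)].
Proof.
move=> ij wP e; set la := wact w (z j) in e *.
have laV : la \in V by rewrite /la wactV // cornerV.
have subPi (l : seq 'I_n) : {subset map Pi l <= Phi}.
  by move=> x /mapP[k _ ->]; apply: (rd_simple rd).
pose P (o : option 'I_n) := if o is Some k then k != i else false.
pose Q q := exists l : seq 'I_n, [/\ all (predC1 i) l, q = wact (map Pi l) la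
  & dot (omega i) q = dot (omega i) la].
have [||l0 [_ [l [lP el hq]] hl]] := @descent P Q la laV.
- by exists [::].
- move=> q [k|] // qV ki [l [lP el hq]] _; exists (k :: l); split.
  + by rewrite /= lP andbT.
  + by rewrite areflE /= mulr0 mul0r scale0r subr0 el.
  + by rewrite /arefl dotBr dotZr omegaPi eq_sym (negbTE ki) mulr0 subr0.
set q := aword l0 la in el hq hl.
have eq : q = wact (map Pi l ++ w) (z j) by rewrite foldr_cat.
have uP : {subset map Pi l ++ w <= Phi}.
  by move=> x; rewrite mem_cat => /orP[/subPi|/wP].
have qV : q \in V by rewrite eq; apply: wactV => //; apply: cornerV.
pose D := z j - q.
have DV : D \in V by rewrite memvB ?cornerV.
have Di : dot (omega i) D = 0.
  have ci : (c i)^-1 != 0 by rewrite invr_eq0 gt_eqF // c_gt0.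
  by move: e; rewrite /D dotBr hq zE !dotZl => /(mulfI ci) ->; rewrite subrr.
(* [q] is nonnegative on the simple roots other than [Pi i], and [D] is a nonnegative combination of
   exactly those. Since [q] and [q + D] have the same norm, this forces [D] to be 0. *)
have qD : 0 <= dot q D.
  rewrite (expand_omega DV) dot_sumr sumr_ge0 // => k _; rewrite dotZr.
  have [->|ki] := eqVneq k i; first by rewrite Di mul0r.
  apply: mulr_ge0; first by rewrite /D eq; apply: dominance.
  by have := hl (Some k) ki; rewrite /aff /= addr0.
have D0 : D = 0.
  apply: dot_eq0; apply/eqP; rewrite eq_le dot_ge0 andbT.
  have : dot (z j) (z j) = dot q q by rewrite eq wact_dot.
  have -> : z j = q + D by rewrite addrC subrK.
  rewrite dotDl !(dotDr q D) (dotC D q); lra.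
have ela : la = wact (map Pi (rev l)) (z j).
  have -> : z j = q by apply/eqP; rewrite -subr_eq0 -/D D0.
  by rewrite el map_rev wactK.
(* The letters below [i] can be erased: when they act, the vector has been moved only along simple
   roots above [i], to which theirs are orthogonal. *)
pose l' := [seq k : 'I_n <- rev l | (i < k)%N].
have orth (s : seq 'I_n) (k : 'I_n) : (k < i)%N -> all (fun x : 'I_n => (i < x)%N) s ->
    dot (wact (map Pi s) (z j)) (Pi k) = 0.
  move=> ki; elim: s => [_|x s IH /= /andP[ix hs]].
    rewrite /= dotZl omegaPi; case: eqP => [jk|_]; last by rewrite mulr0.
    by move: (ltn_trans ki ij); rewrite jk ltnn.
  have o0 : dot (Pi x) (Pi k) = 0 by rewrite dotC (rd_orth rd (j := i)) // ki.
  by rewrite reflectionE dotBl dotZl o0 mulr0 subr0 IH.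
exists (map Pi l'); split=> //.
- move=> k ki; rewrite /l'; elim: (rev l) => [//|x s IH] /=.
  case: ifP => // ix; rewrite /= IH reflection_fix // dotZl omegaPi.
  by case: eqP => [kx|_]; rewrite ?mulr0 //; move: ix; rewrite -kx ltnNge ki.
- rewrite ela /l'; have : all (predC1 i) (rev l) by rewrite all_rev.
  elim: (rev l) => [//|x s IH] /= /andP[xi /IH hs]; case: ifP => ix /=; rewrite hs //.
  rewrite reflection_fix // -hs; apply: orth; last exact: filter_all.
  by rewrite ltn_neqAle xi leqNgt ix.
Qed.

End Ordering.

(** * Standard charts *)

Variables (Delta : pecomplex R) (Apt : set (set (set Delta))).
Hypothesis hD : euclidean_building Sigma Apt.
Variable tau : Delta -> Delta -> 'I_n.
Hypothesis tauO : building_ordering Phi Apt tau.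

Definition chart_on A (phi : 'rV[R]_m -> Delta) :=
  Apt A /\ @simplicial_isometry R Sigma (subcomplex A) phi.

(** A chart of an apartment is determined only up to simplicial isometries, diagram symmetries
    included. Prescribing the types at 0 leaves only the extended affine Weyl group, by
    [standard_factor]. *)
Definition standard_chart A phi :=
  chart_on A phi /\ forall i, tau (phi 0) (phi (z i)) = i.

Lemma chart_on_chart A phi : chart_on A phi -> chart Phi Apt phi.
Proof. by move=> [hA hphi]; exists A. Qed.

Lemma exists_chart A : Apt A -> exists phi, chart_on A phi.
Proof. by move=> hA; have [f hf] := building_B0 hD hA; exists f. Qed.

Lemma chart_ew A phi g : EW g -> chart_on A phi -> chart_on A (phi \o g).
Proof. by move=> gE [hA hphi]; split=> //; apply: sim_comp hphi; apply: ew_sim. Qed.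

Lemma chart_vertex A phi v : chart_on A phi -> cell_vertex Phi v ->
  vertices (subcomplex A) (phi v).
Proof. by move=> [_ h] /verticesP vv; apply: (sim_vertex h). Qed.

Lemma chart_vertexV A phi x : chart_on A phi -> vertices (subcomplex A) x ->
  exists2 v, cell_vertex Phi v & phi v = x.
Proof. by move=> [_ h] /(sim_vertexV h)[v /verticesP vv <-]; exists v. Qed.

Lemma chart_inj A phi u v : chart_on A phi -> cell_vertex Phi u -> cell_vertex Phi v ->
  phi u = phi v -> u = v.
Proof. by move=> [_ h] /verticesP uv /verticesP vv; apply: (sim_inj h). Qed.

Lemma chart_simplex A phi s : chart_on A phi -> simplices Sigma s -> A (phi @` s).
Proof. by move=> [_ h] /(sim_simplex h). Qed.

Lemma chart_simplexV A phi t : chart_on A phi -> A t ->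
  exists2 s, simplices Sigma s & t = phi @` s.
Proof. by move=> [_ h] /(sim_simplexV h). Qed.

Lemma top_full A phi s : chart_on A phi -> A s ->
  ([set: option 'I_n] #<= s)%card -> top_simplex (subcomplex A) s.
Proof.
move=> hphi As h; split=> // t /(chart_simplexV hphi)[t0 /simplex_card ht ->].
by apply: card_le_trans (card_image_le _ _) (card_le_trans ht h).
Qed.

Lemma alcove_simplex g : EW g -> simplices Sigma (face g xpredT).
Proof. by move=> gE; apply: face_simplex => //; exists None. Qed.

Lemma chart_alcove_card A phi g : chart_on A phi -> EW g ->
  ([set: option 'I_n] #<= phi @` face g xpredT)%card.
Proof.
move=> [_ h] gE; rewrite (card_le_eqr (inj_card_eq _)).
  by rewrite (card_le_eqr (full_face_card gE)).
move=> x y /set_mem xs /set_mem ys; apply: (sim_inj h).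
  by exists (face g xpredT) => //; apply: alcove_simplex.
by exists (face g xpredT) => //; apply: alcove_simplex.
Qed.

Lemma apartment_simplex A s : Apt A -> A s -> simplices Delta s.
Proof. by move=> hA As; have [h _] := building_apartment hD hA; apply: h. Qed.

Lemma chart_full A phi s : chart_on A phi -> A s -> ([set: option 'I_n] #<= s)%card ->
  exists2 g, EW g & s = phi @` face g xpredT.
Proof.
move=> hphi /(chart_simplexV hphi)[t ht ->] h.
have [|g gE ->] := full_simplex ht; last by exists g.
exact: card_le_trans h (card_image_le _ _).
Qed.

Lemma sub_alcove s : simplices Sigma s -> exists2 g, EW g & s `<=` face g xpredT.
Proof.
by move=> /simplexP[g [J [gE _ ->]]]; exists g => // x [o _ ->]; exists o.
Qed.

Lemma chart_sub_alcove A phi t : chart_on A phi -> A t ->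
  exists2 g, EW g & t `<=` phi @` face g xpredT.
Proof.
move=> hphi /(chart_simplexV hphi)[s /sub_alcove[g gE h] ->].
by exists g => //; apply: image_subset.
Qed.

Lemma sim_fix (k : Sigma -> Sigma) (u : 'rV[R]_m -> 'rV[R]_m) : simplicial_isometry k -> EW u ->
  (forall o, k (u (corner o)) = u (corner o)) -> forall v, cell_vertex Phi v -> k v = v.
Proof.
move=> kI uE h v vv; have idI : eisometry V id by split.
apply: (rigidity _ _ _ idI uE h) => //.
- by move=> w /verticesP ww; apply: vertexV; apply/verticesP; apply: (sim_vertex kI).
- by move=> x y /verticesP xv /verticesP yv; apply: (sim_inj kI).
- by move=> s x y hs sx sy; apply: enorm_inj; case: kI => _ _ /(_ s x y hs sx sy).
Qed.

Lemma chart_factor A phi phi' : chart_on A phi -> chart_on A phi' ->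
  exists k : Sigma -> Sigma, simplicial_isometry k /\
    forall v, cell_vertex Phi v -> cell_vertex Phi (k v) /\ phi v = phi' (k v).
Proof.
move=> [_ h] [_ h']; have [k [kI hk]] := sim_factor (@id Sigma) h h'.
exists k; split=> // v /verticesP/hk[kv e]; split=> //.
exact/verticesP.
Qed.

(* The retraction onto an apartment centred at one of its alcoves is well defined. *)
Lemma retraction_unique A1 A2 f1 f2 g a b : chart_on A1 f1 -> chart_on A2 f2 -> EW g ->
  (forall o, f1 (g (corner o)) = f2 (g (corner o))) ->
  cell_vertex Phi a -> cell_vertex Phi b -> f1 a = f2 b -> a = b.
Proof.
move=> h1 h2 gE e av bv eab.
have es : f1 @` face g xpredT = f2 @` face g xpredT.
  apply/seteqP; split=> [_ [_ [o _ ->] <-]|_ [_ [o _ ->] <-]].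
    by exists (g (corner o)); [exists o|rewrite e].
  by exists (g (corner o)); [exists o|rewrite e].
have t1 : top_simplex (subcomplex A1) (f1 @` face g xpredT).
  apply: (top_full h1); last exact: chart_alcove_card h1 gE.
  by apply: chart_simplex h1 _; apply: alcove_simplex.
have t2 : top_simplex (subcomplex A2) (f1 @` face g xpredT).
  rewrite es; apply: (top_full h2); last exact: chart_alcove_card h2 gE.
  by apply: chart_simplex h2 _; apply: alcove_simplex.
have [h hI hfix] := building_B2 hD h1.1 h2.1 t1 t2.
have hc : chart_on A2 (h \o f1) by split; [exact: h2.1|apply: sim_comp hI; exact: h1.2].
have [k [kI hk]] := chart_factor hc h2.
have fix1 v w : cell_vertex Phi v -> cell_vertex Phi w -> f1 v = f2 w -> h (f1 v) = f1 v.
  move=> vv wv evw; apply: hfix; first exact: chart_vertex h1 vv.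
  by rewrite evw; apply: chart_vertex h2 wv.
have zv o : cell_vertex Phi (g (corner o)) by apply: ew_corner_vertex.
have kz o : k (g (corner o)) = g (corner o).
  have [kv ek] := hk _ (zv o); apply: (chart_inj h2 kv (zv o)).
  by rewrite -ek /= (fix1 _ _ (zv o) (zv o)) // e.
have [_] := hk _ av; rewrite (sim_fix kI gE kz av) /= (fix1 _ _ av bv eab) eab.
by move/(chart_inj h2 bv av).
Qed.

(** Agreement on a single alcove suffices: invariance of types carries the edges at 0 to those at
    [g 0], where the two charts coincide. *)
Lemma standard_agree A A' phi phi' g : standard_chart A phi -> chart_on A' phi' ->
  EW g -> (forall o, phi' (g (corner o)) = phi (g (corner o))) -> standard_chart A' phi'.
Proof.
move=> [hphi hstd] hphi' gE e; split=> // i.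
have q0 : quasi_special Phi 0 (z i).
  by have := step_quasi_special ew_id (one_le_c i); rewrite /= scale0r scale1r.
have [_ h _] := tauO (chart_on_chart hphi); have [_ h' _] := tauO (chart_on_chart hphi').
rewrite -(h' g) // -[0]/(corner None) !e h //; exact: hstd.
Qed.

Lemma standard_ew A phi g : EW g -> standard_chart A phi -> standard_chart A (phi \o g).
Proof.
move=> gE [hphi hstd]; split=> [|i]; first exact: chart_ew.
exact: (ordering_edge (tauO (chart_on_chart hphi)) hstd i gE).
Qed.

(** An alcove around [s] and one around [t] lie in a common apartment [B] by (B1); the chart is
    followed by isomorphisms from [A] to [B] and from [B] to [A'] given by (B2). Both fix the
    vertices of [s] and [t] that [A] and [A'] share. Standardness survives because consecutive
    charts agree on an alcove. *)
Lemma transport A A' phi s t : chart_on A phi -> Apt A' -> A s -> A' t ->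
  exists phi', [/\ chart_on A' phi',
    standard_chart A phi -> standard_chart A' phi'
    & forall u, cell_vertex Phi u -> vertices (subcomplex A') (phi u) ->
        s (phi u) \/ t (phi u) -> phi' u = phi u].
Proof.
move=> hphi hA' As A't; have hA := hphi.1.
have [psi hpsi] := exists_chart hA'.
have [g gE sg] := chart_sub_alcove hphi As.
have [g' gE' tg] := chart_sub_alcove hpsi A't.
set s1 := phi @` face g xpredT in sg; set t1 := psi @` face g' xpredT in tg.
have As1 : A s1 by apply: chart_simplex hphi _; apply: alcove_simplex.
have A't1 : A' t1 by apply: chart_simplex hpsi _; apply: alcove_simplex.
have cs1 := chart_alcove_card hphi gE; have ct1 := chart_alcove_card hpsi gE'.
have [B [hB Bs1 Bt1]] := building_B1 hD (apartment_simplex hA As1) (apartment_simplex hA' A't1).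
have [chi hchi] := exists_chart hB.
have [f1 f1I f1x] := building_B2 hD hA hB (top_full hphi As1 cs1) (top_full hchi Bs1 cs1).
have [f2 f2I f2x] := building_B2 hD hB hA' (top_full hchi Bt1 ct1) (top_full hpsi A't1 ct1).
have c1 : chart_on B (f1 \o phi) by split=> //; apply: sim_comp f1I; exact: hphi.2.
have c2 : chart_on A' (f2 \o (f1 \o phi)) by split=> //; apply: sim_comp f2I; exact: c1.2.
exists (f2 \o (f1 \o phi)); split=> //.
- move=> st.
  have st1 : standard_chart B (f1 \o phi).
    apply: (standard_agree st c1 gE) => o /=; apply: f1x.
      by apply: chart_vertex hphi _; apply: ew_corner_vertex.
    by exists s1 => //; exists (g (corner o)) => //; exists o.
  have [h hE et] := chart_full c1 Bt1 ct1.
  apply: (standard_agree st1 c2 hE) => o /=; apply: f2x.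
    by apply: (chart_vertex c1); apply: ew_corner_vertex.
  exists t1 => //; rewrite et; exists (h (corner o)) => //.
  by exists o.
- move=> u uv uA' hu /=.
  have e1 : f1 (phi u) = phi u.
    apply: f1x; first exact: chart_vertex hphi uv.
    by case: hu => [/sg|/tg]; [exists s1|exists t1].
  rewrite e1; apply: f2x => //.
  by case: hu => [/sg|/tg]; [exists s1|exists t1].
Qed.

Lemma vertex_simplex A x : Apt A -> vertices (subcomplex A) x -> A [set x].
Proof.
move=> hA [s As sx]; have [_ h] := building_apartment hD hA.
by apply: (h s) => // [y ->|] //; exists x.
Qed.

(** A vertex of the building is special as soon as some chart says so; [transport] brings that chart
    into [A], and [sim_special] shows that every chart of [A] agrees. *)
Lemma special_chart A phi u : chart_on A phi -> cell_vertex Phi u ->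
  building_special Phi Apt (phi u) -> special Phi u.
Proof.
move=> hphi uv [psi [u0 [[A1 hA1 hpsi] u0s e]]].
have cpsi : chart_on A1 psi by split.
have u0v := special_vertex u0s.
have vx := chart_vertex hphi uv; have vx1 := chart_vertex cpsi u0v.
have [psi' [cpsi' _ h]] := transport cpsi hphi.1 (vertex_simplex hA1 vx1) (vertex_simplex hphi.1 vx).
have [k [kI hk]] := chart_factor cpsi' hphi.
have e' : psi' u0 = phi u by rewrite h ?e //; left.
have [kv ek] := hk _ u0v.
rewrite (chart_inj hphi uv kv) -?ek ?e' //.
exact: (sim_special kI).
Qed.

Lemma chart_special A phi u : chart_on A phi -> special Phi u ->
  building_special Phi Apt (phi u).
Proof. by move=> /chart_on_chart h us; exists phi, u. Qed.

(** The transition to a standard chart, normalized by [g] so that [u] goes to 0, carries the alcove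
    [s] to the standard one, and invariance of types identifies the image of each vertex. The factor
    [k] remains a mere simplicial isometry, since [phi] need not be standard. *)
Lemma label A phi phi' u s : chart_on A phi -> standard_chart A phi' ->
  special Phi u -> top_simplex Sigma s -> s u ->
  exists g (k : Sigma -> Sigma), [/\ EW g, simplicial_isometry k,
    forall v, cell_vertex Phi v -> cell_vertex Phi (k v) /\ phi v = phi' (g (k v)),
    k u = 0 & forall v, s v -> v <> u -> k v = z (tau (phi u) (phi v))].
Proof.
move=> hphi st us /top_simplexP[g0 gE0 es] su.
have hphi' := st.1.
have [k [kI hk]] := chart_factor hphi hphi'.
have [g1 gE1 e1] := sim_alcove kI gE0.
have ks := sim_special kI us.
have ku : face g1 xpredT (k u) by rewrite -e1 -es; exists u.
have [g [gE g0u eg]] := alcove_corner gE1 ku ks.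
have [g' [gE' j1 j2]] := ew_inv gE.
have uv := special_vertex us.
have sS : simplices Sigma s by rewrite es; apply: alcove_simplex.
exists g, (g' \o k); split=> //.
- exact: (sim_comp kI (ew_sim gE')).

- move=> v /hk[kv e]; split; first exact: (ew_vertex gE' kv).
  by rewrite /= j2.
- by rewrite /= -g0u j1.
- move=> v sv vu /=.
  have vv := simplex_vertex sS sv.
  have : face g xpredT (k v) by rewrite eg -e1 -es; exists v.
  move=> [o _ eo]; rewrite eo j1.
  rewrite (hk u uv).2 (hk v vv).2 eo -g0u.
  case: o eo => [i|] eo.
    by rewrite (ordering_edge (tauO (chart_on_chart hphi')) st.2 i gE).
  case: vu; apply: (sim_inj kI).
  - by exists s.
  - by exists s.
  - by rewrite eo g0u.
Qed.

(** When both charts are standard, the factor [k] of [label] fixes the standard alcove, so it is the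
    identity on vertices by rigidity. *)
Lemma standard_factor A phi phi' : standard_chart A phi -> standard_chart A phi' ->
  exists2 g, EW g & forall v, cell_vertex Phi v -> phi v = phi' (g v).
Proof.
move=> st st'.
have ts : top_simplex Sigma (face id xpredT).
  by apply/top_simplexP; exists id => //; apply: ew_id.
have s0 : face id xpredT 0 by exists None.
have [g [k [gE kI hk k0 kz]]] := label st.1 st' special0 ts s0.
exists g => // v vv; rewrite (hk v vv).2; congr (phi' (g _)).
apply: (sim_fix kI ew_id) => // -[i|] //.
rewrite kz ?st.2 //; first by exists (Some i).
by rewrite -[0]/(corner None) => /corner_inj.
Qed.

Variables (A0 : set (set Delta)) (phi0 : 'rV[R]_m -> Delta).
Hypothesis st0 : standard_chart A0 phi0.

Lemma exists_standard A : Apt A -> exists phi, standard_chart A phi.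
Proof.
move=> hA; have [psi hpsi] := exists_chart hA.
have as0 : A0 (phi0 @` face id xpredT).
  by apply: (chart_simplex st0.1); apply: alcove_simplex; apply: ew_id.
have as1 : A (psi @` face id xpredT).
  by apply: (chart_simplex hpsi); apply: alcove_simplex; apply: ew_id.
have [phi [_ h _]] := transport st0.1 hA as0 as1.
by exists phi; apply: h.
Qed.

Lemma standard_at A x : Apt A -> vertices (subcomplex A) x ->
  building_special Phi Apt x -> exists2 phi, standard_chart A phi & phi 0 = x.
Proof.
move=> hA xA xs; have [phi st] := exists_standard hA.
have [u uv e] := chart_vertexV st.1 xA.
have us : special Phi u by apply: (special_chart st.1 uv); rewrite e.
have gE : EW (fun v => u + v) by apply: ew_shift; apply/specialP.
exists (phi \o (fun v => u + v)); first exact: standard_ew.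
by rewrite /= addr0.
Qed.

(** * Walks *)

Definition ole : rel 'I_n := fun i j => (i <= j)%N.

Lemma ole_trans : transitive ole. Proof. by move=> j i k; apply: leq_trans. Qed.
Lemma ole_anti : antisymmetric ole.
Proof. by move=> i j /andP[h1 h2]; apply/val_inj/eqP; rewrite eqn_leq; apply/andP. Qed.
Lemma ole_refl : reflexive ole. Proof. by move=> i; apply: leqnn. Qed.

Definition pos (L : seq 'I_n) : 'rV[R]_m := \sum_(i <- L) z i.

(* The sequences of types of the paths of the combing: the breakpoints are special. *)
Definition good (L : seq 'I_n) : Prop := sorted ole L /\
  forall i j : 'I_n, j \in L -> (i < j)%N -> (count_mem i L)%:R / c i \is a Num.int.

Lemma pos_nil : pos [::] = 0. Proof. by rewrite /pos big_nil. Qed.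
Lemma pos_rcons L i : pos (rcons L i) = pos L + z i.
Proof. by rewrite /pos big_rcons. Qed.
Lemma pos_cat L L' : pos (L ++ L') = pos L + pos L'.
Proof. by rewrite /pos big_cat. Qed.
Lemma pos_nseq N i : pos (nseq N i) = N%:R *: z i.
Proof.
elim: N => [|N IH]; first by rewrite pos_nil scale0r.
by rewrite /= -cat1s pos_cat IH /pos big_seq1 -nat1r scalerDl scale1r.
Qed.

Lemma pos_count L : pos L = \sum_i (count_mem i L)%:R *: z i.
Proof.
elim: L => [|j L IH]; first by rewrite pos_nil big1 // => i _; rewrite scale0r.
rewrite -cat1s pos_cat IH /pos big_seq1 [RHS](bigD1 j) //= eqxx natrD scalerDl scale1r.
rewrite -addrA; congr (_ + _); rewrite (bigD1 j) //=; congr (_ + _).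
by apply: eq_bigr => i ij; rewrite eq_sym (negbTE ij) add0n.
Qed.

Lemma dot_pos L i : dot (pos L) (Pi i) = (count_mem i L)%:R / c i.
Proof.
rewrite pos_count dot_suml (bigD1 i) //= big1 => [|j ji]; rewrite !dotZl omegaPi.
  by rewrite eqxx mulr1 addr0.
by rewrite (negbTE ji) !mulr0.
Qed.

Lemma posV L : pos L \in V.
Proof. by rewrite memv_suml // => i _; apply: cornerV. Qed.

Lemma lattice_coords v : v \in V -> (forall i, dot v (Pi i) \is a Num.int) ->
  coweight_lattice Phi v.
Proof.
move=> vV h; apply/latticeP; split=> // al aP; rewrite dot_root // rpred_sum // => i _.
by rewrite rpredM // (rd_int rd).
Qed.

Lemma pos_special L : special Phi (pos L) <->
  forall i, (count_mem i L)%:R / c i \is a Num.int.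
Proof.
rewrite specialP; split=> [/latticeP[_ h] i|h].
  by rewrite -dot_pos h // (rd_simple rd).
by apply: lattice_coords => [|i]; [apply: posV|rewrite dot_pos].
Qed.

Lemma good_nil : good [::]. Proof. by split. Qed.

Lemma sorted_cat_le (L1 L2 : seq 'I_n) i j : sorted ole (L1 ++ L2) -> i \in L1 -> j \in L2 ->
  (i <= j)%N.
Proof. by rewrite (sorted_pairwise ole_trans) pairwise_cat => /and3P[/allrelP h _ _]; apply: h. Qed.

Lemma sorted_ole_rcons (L : seq 'I_n) (j : 'I_n) : sorted ole L -> (forall k : 'I_n, k \in L -> (k <= j)%N) ->
  sorted ole (rcons L j).
Proof.
move=> hs hL; rewrite -cats1 (sorted_pairwise ole_trans) pairwise_cat /= andbT allrel1r.
by rewrite -(sorted_pairwise ole_trans) hs andbT; apply/allP => k /hL.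
Qed.

Lemma sorted_rcons_le (L : seq 'I_n) (i k : 'I_n) : sorted ole (rcons L i) -> k \in rcons L i -> (k <= i)%N.
Proof.
rewrite mem_rcons inE => hs /orP[/eqP ->//|kL].
by move: hs; rewrite -cats1 => hs; apply: (sorted_cat_le hs kL); rewrite mem_head.
Qed.

Lemma good_catl L1 L2 : good (L1 ++ L2) -> good L1.
Proof.
move=> [hs h]; split; first by move: hs; rewrite !(sorted_pairwise ole_trans) pairwise_cat => /and3P[].
move=> i j jL ij; have := h i j; rewrite mem_cat jL => /(_ isT ij).
rewrite count_cat; suff -> : count_mem i L2 = 0%N by rewrite addn0.
apply/count_memPn/negP => iL2; have := sorted_cat_le hs jL iL2.
by rewrite leqNgt ij.
Qed.

Lemma good_take k L : good L -> good (take k L).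
Proof. by rewrite -{1}(cat_take_drop k L); apply: good_catl. Qed.

Lemma good_rcons L i : good (rcons L i) -> good L.
Proof. by rewrite -cats1; apply: good_catl. Qed.

Lemma good_lt L i j : good (rcons (rcons L i) j) -> (i < j)%N -> special Phi (pos (rcons L i)).
Proof.
move=> [hs h] ij; apply/pos_special => k.
have [kj|jk] := ltnP k j.
  have := h k j; rewrite mem_rcons inE eqxx => /(_ isT kj).
  by rewrite -[rcons (rcons _ _) _]cats1 count_cat /= addn0 (_ : (j == k) = false) ?addn0 // -val_eqE gtn_eqF.
rewrite (_ : count_mem k _ = 0%N) ?mul0r ?rpred0 //; apply/count_memPn/negP => kL.
have hs' : sorted ole (rcons L i) by move: hs; rewrite -cats1 => /cat_sorted2[].
have := sorted_rcons_le hs' kL; rewrite leqNgt => /negP; apply.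
exact: leq_trans ij jk.
Qed.

(** Before the last step the types below [i] have multiplicities divisible by their marks and those
    above [i] do not occur, so only the residue of the multiplicity of [i] matters. The last edge is
    thus a coweight translate of an edge of the segment from 0 to [omega i]. *)
Lemma good_last L i : good (rcons L i) -> exists s (r : nat),
  [/\ coweight_lattice Phi s, pos L = s + r%:R *: z i & r.+1%:R <= c i].
Proof.
move=> hg; have hL := good_rcons hg; case: hg => hs h.
have hk k : k != i -> (count_mem k L)%:R / c k \is a Num.int.
  move=> ki; have [lt|ge] := ltnP k i.
    have := h k i; rewrite mem_rcons inE eqxx => /(_ isT lt).
    by rewrite -cats1 count_cat /= addn0 eq_sym (negbTE ki) addn0.
  rewrite (_ : count_mem k _ = 0%N) ?mul0r ?rpred0 //; apply/count_memPn/negP => kL.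
  move: hs; rewrite -cats1 => hs; have := sorted_cat_le hs kL (mem_head i [::]).
  by move=> le; move/eqP: ki; apply; apply: ole_anti; rewrite /ole le.
have hq (r : nat) : ((count_mem i L)%:R - r%:R) / c i \is a Num.int ->
    coweight_lattice Phi (pos L - r%:R *: z i).
  move=> hr; apply: lattice_coords => [|k].
    by rewrite memvB ?posV // memvZ // cornerV.
  rewrite dotBl dot_pos !dotZl omegaPi; case: eqVneq => [<-|ki].
    by rewrite mulr1 -mulrBl.
  by rewrite !mulr0 subr0 hk // eq_sym.
suff [r hr rc] : exists2 r : nat, ((count_mem i L)%:R - r%:R) / c i \is a Num.int & r.+1%:R <= c i.
  by exists (pos L - r%:R *: z i), r; split; rewrite ?subrK //; apply: hq.
case: (rd_mark rd i) => [->|[-> _]].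
  by exists 0%N; rewrite ?subr0 ?divr1 // natr_int.
(* For mark 2 the residue is the parity of the number of earlier steps of type [i]. *)
exists (odd (count_mem i L)); last by rewrite ler_nat; case: odd.
rewrite -{1}(odd_double_half (count_mem i L)) natrD [X in X - _]addrC addrK -muln2 natrM mulfK ?natr_int //.
by rewrite pnatr_eq0.
Qed.

Lemma good_step L i : good (rcons L i) -> exists g (r : nat),
  [/\ EW g, pos L = g (r%:R *: z i), pos (rcons L i) = g (r.+1%:R *: z i) & r.+1%:R <= c i].
Proof.
move=> /good_last[s [r [sL e rc]]]; exists (fun v => s + v), r; split=> //.
  exact: ew_shift.
by rewrite pos_rcons e -addrA -[r.+1%:R]natr1 scalerDl scale1r.
Qed.

Lemma good_edge L i : good (rcons L i) -> edge Sigma (pos L) (pos (rcons L i)).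
Proof.
move=> /good_step[g [r [gE -> -> rc]]].
by apply: ew_edge => //; apply: step_edge.
Qed.

Lemma good_quasi_special L i : good (rcons L i) -> quasi_special Phi (pos L) (pos (rcons L i)).
Proof.
by move=> /good_step[g [r [gE -> -> rc]]]; apply: step_quasi_special.
Qed.

Lemma good_vertex L : good L -> cell_vertex Phi (pos L).
Proof.
case/lastP: L => [|L i] h; last by have [_] := edge_vertex (good_edge h).
by rewrite pos_nil; apply: special_vertex; apply: special0.
Qed.

Lemma good_straight L i : good (rcons L i) -> good (rcons (rcons L i) i).
Proof.
move=> [hs h]; split.
  by apply: sorted_ole_rcons => // k; apply: sorted_rcons_le.
move=> k j; rewrite mem_rcons inE => hj kj.
have jL : j \in rcons L i.
  by case/orP: hj => [/eqP ->|//]; rewrite mem_rcons mem_head.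
have ki : (k < i)%N by apply: leq_trans kj _; apply: (sorted_rcons_le hs).
rewrite -[rcons (rcons _ _) _]cats1 count_cat /= addn0.
by rewrite (_ : (i == k) = false) ?addn0; [apply: h kj|rewrite -val_eqE gtn_eqF].
Qed.

Lemma good_turn (L : seq 'I_n) (i j : 'I_n) : good (rcons L i) -> special Phi (pos (rcons L i)) -> (i < j)%N ->
  good (rcons (rcons L i) j).
Proof.
move=> [hs h] /pos_special sp ij; split.
  by apply: sorted_ole_rcons => // k /(sorted_rcons_le hs) /leq_trans; apply; apply: ltnW.
move=> k k' hk kk'.
have kj : (k < j)%N.
  apply: leq_trans kk' _; move: hk; rewrite mem_rcons inE => /orP[/eqP ->//|].
  by move=> /(sorted_rcons_le hs) /leq_trans; apply; apply: ltnW.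
rewrite -[rcons (rcons _ _) _]cats1 count_cat /= addn0.
by rewrite (_ : (j == k) = false) ?addn0; [apply: sp|rewrite -val_eqE gtn_eqF].
Qed.

Definition walk_from v (L : seq 'I_n) := scanl (fun v i => v + z i) v L.
Definition walk L := 0 :: walk_from 0 L.

Lemma foldl_pos v L : foldl (fun v i => v + z i) v L = v + pos L.
Proof.
elim: L v => [|i L IH] v /=; first by rewrite pos_nil addr0.
by rewrite IH -[i :: L]cat1s pos_cat /pos big_seq1 addrA.
Qed.

Lemma walk_from_cat v L L' : walk_from v (L ++ L') = walk_from v L ++ walk_from (v + pos L) L'.
Proof. by rewrite /walk_from scanl_cat foldl_pos. Qed.

Lemma walk_rcons L i : walk (rcons L i) = rcons (walk L) (pos (rcons L i)).
Proof. by rewrite /walk -cats1 walk_from_cat /= add0r pos_cat /pos big_seq1 -cats1. Qed.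

Lemma last_walk_from v L : last v (walk_from v L) = v + pos L.
Proof. by elim: L v => [|i L IH] v /=; rewrite ?pos_nil ?addr0 // IH -[i :: L]cat1s pos_cat /pos big_seq1 addrA. Qed.

Lemma take_walk k L : take k.+1 (walk L) = walk (take k L).
Proof.
rewrite /walk /=; congr (_ :: _); move: 0 => v.
by elim: L v k => [|i L IH] v [|k] //=; rewrite IH.
Qed.

Lemma mem_walk v L : v \in walk L -> exists2 k, (k <= size L)%N & v = pos (take k L).
Proof.
elim/last_ind: L => [|L i IH].
  by rewrite inE => /eqP ->; exists 0%N; rewrite ?pos_nil.
rewrite walk_rcons mem_rcons inE => /orP[/eqP ->|/IH[k kL ->]].
  by exists (size (rcons L i)); rewrite ?take_size.
exists k; first by rewrite size_rcons leqW.
by rewrite -cats1 takel_cat.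
Qed.

(* Retract the path phi(walk L) onto the apartment of phi', centred at an alcove
   containing the next edge of phi'(walk L).  The image has the same types and the
   same endpoints as phi'(walk L), hence coincides with it by [sum_extremal]. *)
Lemma convexity A A' phi phi' L : standard_chart A phi -> standard_chart A' phi' ->
  good L -> phi 0 = phi' 0 -> phi (pos L) = phi' (pos L) ->
  forall k, (k <= size L)%N -> phi (pos (take k L)) = phi' (pos (take k L)).
Proof.
move=> st st' hL e0 eL; have [hphi _] := st; have [hphi' _] := st'.
pose d0 : 'I_n := Ordinal (rd_rank rd).
pose w k := pos (take k L).
have wS k : (k < size L)%N -> take k.+1 L = rcons (take k L) (nth d0 L k).
  by move=> h; rewrite (take_nth d0).
have wv k : cell_vertex Phi (w k) by apply: good_vertex; apply: good_take.
have we k : (k < size L)%N -> edge Sigma (w k) (w k.+1).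
  by move=> h; rewrite /w wS //; apply: good_edge; rewrite -wS //; apply: good_take.
elim=> [|k IH] kL; first by rewrite take0 pos_nil.
have ek : phi (w k) = phi' (w k) by apply: IH; apply: ltnW.
have [g gE sub] := sub_alcove (we k kL).2.
(* [P j r] says that [r] is an image of the vertex [phi (w j)] under the retraction centred at the
   alcove of [g], read in the chart [phi']. *)
pose P j r := exists A1 f, [/\ chart_on A1 f, forall o, f (g (corner o)) = phi' (g (corner o)),
  cell_vertex Phi r & f r = phi (w j)].
have uniq j r r' : P j r -> P j r' -> r = r'.
  move=> [A1 [f [c1 a1 v1 e1]]] [A2 [f' [c2 a2 v2 e2]]].
  apply: (retraction_unique c1 c2 gE) => //; last by rewrite e1 e2.
  by move=> o; rewrite a1 a2.
have P' j : phi (w j) = phi' (w j) -> P j (w j).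
  by move=> e; exists A', phi'.
(* An apartment through the edge and the central alcove retracts both ends with one chart, and its
   transition to [phi] is in the extended affine Weyl group. So the retracted edge stays in the Weyl
   orbit of the original one. *)
have edgeP j : (j < size L)%N -> exists r r' (l : seq 'rV[R]_m),
    [/\ P j r, P j.+1 r', {subset l <= Phi} & r' - r = wact l (z (nth d0 L j))].
  move=> jL; have ej := we j jL.
  have As : A (phi @` [set w j; w j.+1]) by apply: (chart_simplex hphi); exact: ej.2.
  have A's : A' (phi' @` face g xpredT).
    by apply: (chart_simplex hphi'); apply: alcove_simplex.
  have [B [hB Bs Bs']] := building_B1 hD (apartment_simplex hphi.1 As) (apartment_simplex hphi'.1 A's).
  have [f [hf stf fx]] := transport hphi' hB A's Bs'.
  have [chi [hchi stchi chix]] := transport hphi hB As Bs.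
  have [h hE hh] := standard_factor (stchi st) (stf st').
  have chij i : i = j \/ i = j.+1 -> chi (w i) = phi (w i).
    move=> ij; have im : (phi @` [set w j; w j.+1]) (phi (w i)).
      by exists (w i) => //; case: ij => ->; [left|right].
    by apply: chix; [|exists (phi @` [set w j; w j.+1])|left].
  have Ph i : i = j \/ i = j.+1 -> P i (h (w i)).
    move=> ij; exists B, f; split=> //.
    - move=> o; have im : (phi' @` face g xpredT) (phi' (g (corner o))).
        by exists (g (corner o)) => //; exists o.
      apply: fx; [exact: ew_corner_vertex|by exists (phi' @` face g xpredT)|by left].
    - exact: ew_vertex.
    - by rewrite -hh // chij.
  have [T [l [_ lP hl]]] := hE.
  exists (h (w j)), (h (w j.+1)), l; split=> //; [by apply: Ph; left|by apply: Ph; right|].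
  rewrite !hl opprD addrACA subrr add0r -wactN -wactD /w wS // pos_rcons.
  by rewrite addrAC subrr add0r.
have [r hr] : exists r : nat -> 'rV[R]_m, forall j, (j <= size L)%N -> P j (r j).
  suff /choice[r hr] : forall j, exists r, (j <= size L)%N -> P j r by exists r.
  move=> j; have [jL|jL] := leqP j (size L); last by exists 0.
  case: j jL => [|j] jL.
    by exists (w 0%N) => _; apply: P'; rewrite /w take0 pos_nil.
  by have [_ [r' [_ [_ h _ _]]]] := edgeP j jL; exists r'.
have dE j : (j < size L)%N -> exists2 l : seq 'rV[R]_m, {subset l <= Phi} &
    r j.+1 - r j = wact l (z (nth d0 L j)).
  move=> jL; have [r1 [r2 [l [h1 h2 lP e]]]] := edgeP j jL; exists l => //.
  by rewrite (uniq _ _ _ (hr j (ltnW jL)) h1) (uniq _ _ _ (hr j.+1 jL) h2).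
have r0 : r 0%N = 0.
  rewrite (uniq _ _ _ (hr 0%N (leq0n _)) (P' 0%N _)); first by rewrite /w take0 pos_nil.
  by rewrite /w take0 pos_nil.
have rN : r (size L) = pos L.
  rewrite (uniq _ _ _ (hr _ (leqnn _)) (P' (size L) _)); first by rewrite /w take_size.
  by rewrite /w take_size.
have h (j : 'I_(size L)) : r j.+1 - r j = z (nth d0 L j).
  pose t (j : 'I_(size L)) := nth d0 L j; rewrite -[nth d0 L j]/(t j).
  apply: (@sum_extremal _ (tauO (chart_on_chart hphi)) st.2 _ t
    (fun j => r j.+1 - r j)) => [x|]; first exact: dE.
  rewrite -(big_mkord xpredT (fun j => r j.+1 - r j)) telescope_sumr // r0 subr0 rN.
  by rewrite /pos (big_nth d0) big_mkord.
have rk : r k.+1 = w k.+1.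
  rewrite /w wS // pos_rcons -/(w k) -(h (Ordinal kL)) /=.
  by rewrite -(uniq _ _ _ (hr k (ltnW kL)) (P' k ek)) addrC subrK.
(* The image of the next vertex is a corner of the central alcove, where the retracting chart
   coincides with [phi']; so the vertex itself is the one of [phi']. *)
have [A1 [f [_ a1 _ e1]]] := hr k.+1 kL.
have : face g xpredT (w k.+1) by apply: sub; right.
move=> [o _ eo]; rewrite -/(w k.+1) -e1 rk eo; exact: a1.
Qed.

(** * Walks and the local condition *)

Lemma chart_segment A phi a b : chart_on A phi -> cell_vertex Phi a ->
  A [set phi a; b] -> exists2 b', phi b' = b & simplices Sigma [set a; b'] .
Proof.
move=> hphi av /(chart_simplexV hphi)[s hs es].
have : (phi @` s) b by rewrite -es; right.
move=> [b' sb' eb]; exists b' => //.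
suff -> : [set a; b'] = s by [].
have sub x : s x -> cell_vertex Phi x by move=> sx; apply: (simplex_vertex hs sx).
have : (phi @` s) (phi a) by rewrite -es; left.
move=> [a' sa' /(chart_inj hphi (sub _ sa') av) ea].
apply/seteqP; split=> [x [->|->] //|x sx]; first by rewrite -ea.
have : (phi @` s) (phi x) by exists x.
rewrite -es -eb => -[e|e]; [left|right]; apply: (chart_inj hphi) => //; exact: sub.
Qed.

Lemma transport_pair A psi B a b a' b' : chart_on A psi -> Apt B ->
  edge Sigma a b -> edge Sigma a' b' ->
  vertices (subcomplex B) (psi a) -> B [set psi a'; psi b'] -> vertices (subcomplex B) (psi b) ->
  exists psi', [/\ chart_on B psi', psi' a = psi a, psi' b = psi b,
    psi' a' = psi a' & psi' b' = psi b'].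
Proof.
move=> hpsi hB eab eab' va B' vb.
have As := chart_simplex hpsi eab.2.
have [f [hf _ fx]] := transport hpsi hB As B'.
have [av bv] := edge_vertex eab; have [av' bv'] := edge_vertex eab'.
exists f; split=> //.
- by apply: fx => //; left; exists a => //; left.
- by apply: fx => //; left; exists b => //; right.
- by apply: fx => //; [exists [set psi a'; psi b'] => //; left|right; left].
- by apply: fx => //; [exists [set psi a'; psi b'] => //; right|right; right].
Qed.

Notation admissible := (admissible_pair Phi omega c Apt tau).

(** The common description with which the combing and the local family are both compared. *)
Definition walk_paths : set (seq Delta) :=
  [set p | exists A phi L, [/\ standard_chart A phi, good L & p = map phi (walk L)]].

Lemma special_edge a b : edge Sigma a b -> special Phi a ->
  exists g k, [/\ EW g, g 0 = a & b = g (z k)].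
Proof.
move=> /edgeP[h [o [o' [hE oo ea eb]]]] sa.
have [|g [gE g0 eg]] := alcove_corner hE (x := a) _ sa; first by exists o.
have : face g xpredT b by rewrite eg; exists o'.
move=> [[k|] _ eb']; first by exists g, k.
move: oo; rewrite (corner_inj (ew_inj hE (_ : h (corner o) = h (corner o')))) ?eqxx //.
by rewrite -ea -eb eb' -g0.
Qed.

Lemma good_single (i : 'I_n) : good [:: i].
Proof.
split=> // k j; rewrite inE => /eqP -> ki /=.
by rewrite (_ : (i == k) = false) ?mul0r ?rpred0 // -val_eqE gtn_eqF.
Qed.

Lemma good_tau A phi L i : standard_chart A phi -> good (rcons L i) ->
  tau (phi (pos L)) (phi (pos (rcons L i))) = i.
Proof.
move=> st /good_step[g [r [gE -> -> rc]]].
exact: (ordering_step (tauO (chart_on_chart st.1)) st.2 gE rc).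
Qed.

Lemma walk_last L : exists q : seq 'rV[R]_m, walk L = rcons q (pos L).
Proof.
case/lastP: L => [|L i]; first by exists [::]; rewrite pos_nil.
by exists (walk L); rewrite walk_rcons.
Qed.

Lemma edge_neq a b : edge Sigma a b -> b - a != 0.
Proof. by move=> [ab _]; rewrite subr_eq0; apply/eqP => e; apply: ab. Qed.

(** Angles and scalar products are witnessed in a chart of an arbitrary apartment. The isometry [G]
    carries the two edges to the chart in use, so that they can be measured there. *)
Lemma chart_pair A chi psi B a b a' b' p q r : chart_on A psi -> chart_on B chi ->
  edge Sigma a b -> edge Sigma a' b' -> cell_vertex Phi p -> cell_vertex Phi q ->
  simplices Sigma [set q; r] ->
  psi a = chi p -> psi b = chi q -> psi a' = chi q -> psi b' = chi r ->
  exists2 G, eisometry V G & [/\ G a = p, G b = q, G a' = q & G b' = r].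
Proof.
move=> hpsi hchi eab eab' pv qv qr ea eb ea' eb'.
have rv : cell_vertex Phi r by apply: (simplex_vertex qr); right.
have [av bv] := edge_vertex eab; have [av' bv'] := edge_vertex eab'.
have [||| f [hf fa fb fa' fb']] := transport_pair hpsi hchi.1 eab eab'.
- by rewrite ea; apply: (chart_vertex hchi).
- rewrite ea' eb'; have := chart_simplex hchi qr.
  by rewrite image_setU !image_set1.
- by rewrite eb; apply: (chart_vertex hchi).
have [k [kI hk]] := chart_factor hf hchi.
have [G GI hG] := sim_isometry_ext kI.
exists G => //.
have at_ x y : cell_vertex Phi x -> cell_vertex Phi y -> f x = chi y -> G x = y.
  move=> xv yv e; have [kv ek] := hk _ xv; rewrite -hG //.
  by apply: (chart_inj hchi kv yv); rewrite -ek.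
by split; apply: at_ => //; rewrite ?fa ?fb ?fa' ?fb'.
Qed.

Lemma local_step A phi L y : standard_chart A phi -> good L ->
  edge Delta (phi (pos L)) y ->
  (forall L0 i, L = rcons L0 i -> admissible (phi (pos L0)) (phi (pos L)) y) ->
  exists A' phi' i, [/\ standard_chart A' phi', good (rcons L i) &
    map phi' (walk (rcons L i)) = rcons (map phi (walk L)) y].
Proof.
move=> st hL [yn ys] adm; have [hphi _] := st.
have v0 : cell_vertex Phi 0 by apply: special_vertex; apply: special0.
have Lv := good_vertex hL.
have As : A [set phi 0].
  by apply: (vertex_simplex hphi.1); apply: (chart_vertex hphi).
have [B [hB Bs By]] := building_B1 hD (apartment_simplex hphi.1 As) ys.
have [chi [hchi stchi' chix]] := transport hphi hB As By.
have stchi := stchi' st.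
have e0 : chi 0 = phi 0 by apply: chix => //; [exists [set phi 0]|left].
have eL : chi (pos L) = phi (pos L).
  by apply: chix => //; [exists [set phi (pos L); y] => //; left|right; left].
have conv := convexity stchi st hL e0 eL.
have eW : map chi (walk L) = map phi (walk L).
  by apply/eq_in_map => v /mem_walk[k kL ->]; apply: conv.
have By' : B [set chi (pos L); y] by rewrite eL.
have [Z eZ ZS] := chart_segment hchi Lv By'.
have eLZ : edge Sigma (pos L) Z by split=> // e; apply: yn; rewrite -eL -eZ e.
suff [A' [phi' [i [st' hg ew ez]]]] : exists A' phi' i, [/\ standard_chart A' phi',
    good (rcons L i), map phi' (walk L) = map chi (walk L) & phi' (pos (rcons L i)) = chi Z].
  exists A', phi', i; split=> //.
  by rewrite walk_rcons map_rcons ew eW ez eZ.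
case/lastP: L => [|L0 i] in hL Lv adm yn ys By chix eL conv eW By' ZS eLZ *.
  rewrite pos_nil in eLZ; have [g [k [gE g0 eg]]] := special_edge eLZ special0.
  exists B, (chi \o g), k; split.
  - exact: (standard_ew gE stchi).
  - exact: good_single.
  - by rewrite /= g0.
  - by rewrite /= eg /pos big_seq1.
have adm' := adm L0 i erefl.
set L := rcons L0 i in hL Lv adm yn ys By chix eL conv eW By' ZS eLZ adm' *.
have hL0 := good_rcons hL; have L0v := good_vertex hL0.
have eL0 : chi (pos L0) = phi (pos L0).
  have tL : take (size L0) L = L0 by rewrite /L -cats1 take_size_cat.
  by have := conv (size L0); rewrite tL; apply; rewrite /L size_rcons.
have eti : pos L - pos L0 = z i by rewrite /L pos_rcons addrC addKr.
case: adm' => _ _ [[psi [a [b [d [[A1 hA1 hpsi] [eab ebd] [ea eb ed] eth]]]]]|].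
  have cpsi : chart_on A1 psi by split.
  have [||||G GI [Ga Gb _ Gd]] := chart_pair cpsi hchi eab ebd L0v Lv ZS.
  - by rewrite ea eL0.
  - by rewrite eb eL.
  - by rewrite eb eL.
  - by rewrite ed eZ.
  have [av bv] := edge_vertex eab; have [_ dv] := edge_vertex ebd.
  have [||r r0 er] := @angle_pi _ _ (a - b) (d - b) _ _ (esym eth).
  - by rewrite -opprB oppr_eq0 edge_neq.
  - exact: edge_neq.
  have gd := good_straight hL.
  exists B, chi, i; split=> //; congr (chi _); apply/esym.
  (* The new edge and the continuation of the walk issue from one vertex in one direction, so they
     are equal. *)
  apply: (edge_ray eLZ (good_edge gd) r0).
  have -> : pos (rcons L i) - pos L = z i by rewrite [pos (rcons L i)]pos_rcons addrC addKr.
  rewrite -eti -Ga -Gb -Gd.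
  rewrite (eisometry_line (r := - r) GI (vertexV bv) (vertexV av) (vertexV dv)).
    by rewrite -[G b - G a]opprB scalerN scaleNr.
  by rewrite er scaleNr.
move=> [ij ysp [psi [a [b [a' [b' [[A1 hA1 hpsi] [eab [ea eb]] [eab' [ea' eb']] er]]]]]]].
have cpsi : chart_on A1 psi by split.
have [||||G GI [Ga Gb Ga' Gb']] := chart_pair cpsi hchi eab eab' L0v Lv ZS.
- by rewrite ea eL0.
- by rewrite eb eL.
- by rewrite ea' eL.
- by rewrite eb' eZ.
have [av bv] := edge_vertex eab; have [av' bv'] := edge_vertex eab'.
have sp : special Phi (pos L) by apply: (special_chart hchi Lv); rewrite eL.
have [g [j [gE g0 eg]]] := special_edge eLZ sp.
have ti : tau (phi (pos L0)) (phi (pos L)) = i by apply: good_tau st hL.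
have tj : tau (phi (pos L)) y = j.
  rewrite -eL -eZ -g0 eg.
  exact: (ordering_edge (tauO (chart_on_chart hchi)) stchi.2 j gE).
rewrite ti tj in ij er.
have [T [l [_ lP hl]]] := gE.
have ZE : Z = pos L + wact l (z j).
  by rewrite eg -g0 !hl wact0 addr0.
have e : dot (z i) (wact l (z j)) = dot (z i) (z j).
  rewrite er -(eisometry_dot GI) ?(vertexV av) ?(vertexV bv) ?(vertexV av') ?(vertexV bv') //.
  by rewrite Ga Gb Ga' Gb' eti ZE addrC addKr.
have [l' [lP' fix' e']] := parabolic_transport (tauO (chart_on_chart hchi)) stchi.2 ij lP e.
(* All types in [L] are at most [i], so [l'] fixes every vertex already reached and the new chart
   changes only the last edge. *)
have posfix M : {subset M <= L} -> wact l' (pos M) = pos M.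
  elim: M => [|k M IH] h; first by rewrite pos_nil wact0.
  rewrite -cat1s pos_cat wactD IH; last by move=> x xM; apply: h; rewrite inE xM orbT.
  congr (_ + _); rewrite /pos big_seq1 fix' //.
  by apply: (sorted_rcons_le hL.1); apply: h; rewrite mem_head.
exists B, (chi \o (fun v => wact l' v)), j; split.
- exact: (standard_ew (ew_wact lP') stchi).
- exact: good_turn.
- rewrite map_comp; congr map; rewrite -[RHS]map_id; apply/eq_in_map => v /mem_walk[k kL ->].
  by apply: posfix => x /mem_take.
- by rewrite /= pos_rcons wactD posfix // e' ZE.
Qed.

Lemma local_sub_walks : local_combing Phi omega c Apt tau `<=` walk_paths.
Proof.
move=> _ [x [s [-> xs]]].
elim/last_ind: s => [_ _|s y IH].
  have [psi [u [[A hA hpsi] us ex]]] := xs; have cpsi : chart_on A psi by split.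
  have xA : vertices (subcomplex A) x.
    by rewrite -ex; apply: (chart_vertex cpsi); apply: special_vertex.
  have [phi st e] := standard_at hA xA xs.
  by exists A, phi, [::]; split; [exact: st|exact: good_nil|rewrite /= e].
rewrite rcons_path => /andP[hs /asboolP hy] h.
have [|A [phi [L [st hL e]]]] := IH hs _.
  move=> p1 a b d p2 e; apply: (h p1 a b d (rcons p2 y)).
  by rewrite -rcons_cons e rcons_cat.
have eLs : last x s = phi (pos L).
  have [q eq] := walk_last L; rewrite -[last x s]/(last x (x :: s)) e eq map_rcons.
  by rewrite last_rcons.
rewrite eLs in hy.
have [|A' [phi' [i [st' hg e']]]] := local_step st hL hy _.
  move=> L0 i eL; have [q eq] := walk_last L0.
  apply: (h (map phi q) _ _ _ [::]).
  rewrite -rcons_cons e eL walk_rcons eq !map_rcons.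
  by rewrite -!cats1 -!catA.
by exists A', phi', (rcons L i); split=> //; rewrite e' -e.
Qed.

Lemma map_walk_split (phi : 'rV[R]_m -> Delta) v L (p1 p2 : seq Delta) (a b d : Delta) :
  map phi (v :: walk_from v L) = p1 ++ [:: a, b, d & p2] ->
  exists L0 i j L1, [/\ L = L0 ++ [:: i, j & L1], a = phi (v + pos L0),
    b = phi (v + pos (rcons L0 i)) & d = phi (v + pos (rcons (rcons L0 i) j))].
Proof.
elim: p1 v L => [|y p1 IH] v L.
  case: L => [|i [|j L]] //= [<- <- <- _]; exists [::], i, j, L.
  by rewrite /= pos_nil addr0 /pos !big_cons big_nil !addr0 addrA.
case: L => [|k L] /= [_].
  by case: p1 {IH}.
move=> /IH[L0 [i [j [L1 [-> -> -> ->]]]]]; exists (k :: L0), i, j, L1; split=> //.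
- by rewrite /pos big_cons addrA.
- by rewrite /pos big_cons addrA.
- by rewrite /pos big_cons addrA.
Qed.

Lemma walks_sub_local : walk_paths `<=` local_combing Phi omega c Apt tau.
Proof.
move=> _ [A [phi [L [st hL ->]]]]; have [hphi _] := st.
exists (phi 0), (map phi (walk_from 0 L)); split=> //.
- by apply: (chart_special hphi); apply: special0.
- elim/last_ind: L hL => [//|L i IH] hL.
  rewrite -cats1 walk_from_cat map_cat cat_path IH /= ?andbT; last exact: good_rcons hL.
  apply/asboolP; rewrite last_map last_walk_from !add0r.
  have := good_edge hL; rewrite pos_rcons => -[ne hs]; split.
    move=> e; apply: ne; apply: (chart_inj hphi) e.
      by apply: (simplex_vertex hs); left.
    by apply: (simplex_vertex hs); right.
  have := apartment_simplex hphi.1 (chart_simplex hphi hs).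
  by rewrite image_setU !image_set1.
- move=> p1 a b d p2 /(map_walk_split)[L0 [i [j [L1 [eL -> -> ->]]]]].
  rewrite !add0r.
  have hj : good (rcons (rcons L0 i) j).
    by apply: (good_catl (L2 := L1)); rewrite -!cats1 -!catA /= -eL.
  have hi := good_rcons hj.
  have qs (M : seq 'I_n) k : good (rcons M k) ->
      building_quasi_special Phi Apt (phi (pos M)) (phi (pos (rcons M k))).
    move=> h; exists phi, (pos M), (pos (rcons M k)); split=> //.
      exact: chart_on_chart hphi.
    exact: good_quasi_special.
  split; [exact: qs|exact: qs|].
  have ei := good_edge hi; have ej := good_edge hj.
  have [ij|ij] := eqVneq i j; [left|right].
    exists phi, (pos L0), (pos (rcons L0 i)), (pos (rcons (rcons L0 i) j)); split=> //.
      exact: chart_on_chart hphi.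
    have e1 : pos L0 - pos (rcons L0 i) = - z i by rewrite pos_rcons opprD addrA subrr sub0r.
    have e2 : pos (rcons (rcons L0 i) j) - pos (rcons L0 i) = z i.
      by rewrite pos_rcons addrC addKr ij.
    have n0 : 0 < dot (z i) (z i) by rewrite -e2; apply/dot_gt0/edge_neq.
    rewrite /angle e1 e2 /enorm !dotNl dotNr opprK -expr2 sqr_sqrtr ?dot_ge0 //.
    by rewrite mulNr divff ?gt_eqF // acosN1.
  have lt : (i < j)%N.
    rewrite ltn_neqAle ij /=; apply: (sorted_rcons_le hj.1).
    by rewrite mem_rcons inE mem_rcons mem_head orbT.
  rewrite !(good_tau st) //; split=> //.
    by apply: (chart_special hphi); apply: good_lt hj lt.
  exists phi, (pos L0), (pos (rcons L0 i)), (pos (rcons L0 i)), (pos (rcons (rcons L0 i) j)).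
  split=> //; first exact: chart_on_chart hphi.
  by rewrite !pos_rcons [in RHS](addrC (pos L0)) addrK addrC addrAC subrr add0r.
Qed.

(** * Paths of the combing as blocks of types *)

Lemma sim_edge (k : Sigma -> Sigma) a b : simplicial_isometry k ->
  edge Sigma a b -> edge Sigma (k a) (k b).
Proof.
move=> kI eab; have [av bv] := edge_vertex eab; have [ab hs] := eab.
split; first by move=> e; apply/ab/(sim_inj kI) => //; apply/verticesP.
by have := sim_simplex kI hs; rewrite image_setU !image_set1.
Qed.

Definition blocks (N : 'I_n -> nat) := flatten [seq nseq (N k) k | k <- enum 'I_n].

Lemma count_blocks N i : count_mem i (blocks N) = N i.
Proof.
rewrite /blocks count_flatten -map_comp sumnE big_map big_enum (bigD1 i) //= big1.
  by rewrite count_nseq /= eqxx mul1n addn0.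
by move=> j ji; rewrite count_nseq /= (negbTE ji).
Qed.

Lemma sorted_blocks N : sorted ole (blocks N).
Proof.
have h : pairwise (fun i j : 'I_n => (i < j)%N) (enum 'I_n).
  rewrite -(sorted_pairwise (fun _ _ _ => @ltn_trans _ _ _)).
  have := iota_ltn_sorted 0 n; rewrite -val_enum_ord sorted_map //.
rewrite (sorted_pairwise ole_trans) /blocks.
elim: (enum 'I_n) h => [//|k e IH] /= /andP[ke /IH he]; rewrite pairwise_cat he andbT.
apply/andP; split.
  apply/allrelP => i j /nseqP[-> _] /flattenP[s /mapP[l le ->] /nseqP[-> _]].
  by apply: ltnW; move/allP: ke; apply.
by elim: (N k) => [//|M IHM] /=; rewrite IHM andbT; apply/allP => x /nseqP[-> _]; apply: ole_refl.
Qed.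

Lemma blocks_unique N L : sorted ole L -> (forall i, count_mem i L = N i) -> L = blocks N.
Proof.
move=> sL h; apply: (sorted_eq ole_trans ole_anti) => //.
  exact: sorted_blocks.
by apply/permP => a; apply/permP: a; apply/allP => x _ /=; rewrite h count_blocks.
Qed.

Lemma good_blocks N : (forall i, (N i)%:R / c i \is a Num.int) -> good (blocks N).
Proof.
by move=> h; split; [exact: sorted_blocks|move=> i j _ _; rewrite count_blocks].
Qed.

Lemma pos_blocks N : pos (blocks N) = \sum_i (N i)%:R *: z i.
Proof. by rewrite pos_count; apply: eq_bigr => i _; rewrite count_blocks. Qed.

(** Truncating [N] strictly below [k] gives the walk to the [k]-th break point, from the origin at 0
    to the endpoint at [n]. *)
Definition below (N : 'I_n -> nat) (k : nat) (i : 'I_n) := if (i < k)%N then N i else 0%N.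

Lemma blocks_belowS N (k : 'I_n) :
  blocks (below N k.+1) = blocks (below N k) ++ nseq (N k) k.
Proof.
apply/esym/blocks_unique => [|i]; last first.
  rewrite count_cat count_blocks count_nseq /= /below ltnS.
  have [ki|ik|ki] := ltngtP i k.
  - by rewrite (_ : (k == i) = false) ?mul0n ?addn0 // -val_eqE /= gtn_eqF.
  - by rewrite (_ : (k == i) = false) ?mul0n ?addn0 // -val_eqE /= ltn_eqF.
  - by rewrite (val_inj ki) eqxx mul1n.
rewrite (sorted_pairwise ole_trans) pairwise_cat -(sorted_pairwise ole_trans) sorted_blocks /=.
apply/andP; split.
  apply/allrelP => i j hi /nseqP[-> _]; rewrite /ole leqNgt; apply/negP => ki.
  move: hi; rewrite -has_pred1 has_count count_blocks /below.
  by rewrite (_ : (i < k)%N = false) //; apply/negbTE; rewrite -leqNgt ltnW.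
by elim: (N k) => [//|M IHM] /=; rewrite IHM andbT; apply/allP => x /nseqP[-> _]; apply: ole_refl.
Qed.

Lemma blocks_below0 N : blocks (below N 0) = [::].
Proof. by apply/esym/blocks_unique. Qed.

Lemma blocks_belown N : blocks (below N n) = blocks N.
Proof.
by apply: blocks_unique => [|i]; rewrite ?sorted_blocks // count_blocks /below ltn_ord.
Qed.

Lemma flatten_walks N (t : 'I_n -> seq 'rV[R]_m) :
  (forall k : 'I_n, t k = walk_from (pos (blocks (below N k))) (nseq (N k) k)) ->
  flatten [seq t k | k <- enum 'I_n] = walk_from 0 (blocks N).
Proof.
move=> ht; suff h k : (k <= n)%N ->
    flatten [seq t i | i <- take k (enum 'I_n)] = walk_from 0 (blocks (below N k)).
  have := h n (leqnn n); rewrite blocks_belown take_oversize // size_enum_ord.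
  by [].
elim: k => [|k IH] kn; first by rewrite take0 blocks_below0.
pose o := Ordinal kn.
rewrite (take_nth o) ?size_enum_ord // map_rcons flatten_rcons IH; last exact: ltnW.
have -> : nth o (enum 'I_n) k = o by apply: val_inj; rewrite /= nth_enum_ord.
by rewrite ht (blocks_belowS N o) walk_from_cat add0r.
Qed.

(** By [edge_ray] a vertex has at most one edge in a given direction, so the path follows the walk.
    It cannot overrun the endpoint because the scalar product with [z j] strictly increases along
    it. *)
Lemma ray_path (L : seq 'I_n) j N s : good (L ++ nseq N j) ->
  path (fun p q => `[< edge Sigma p q /\ exists2 r : R, 0 < r & q - p = r *: z j >]) (pos L) s ->
  last (pos L) s = pos (L ++ nseq N j) -> s = walk_from (pos L) (nseq N j).
Proof.
elim: N L s => [|N IH] L s hg.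
  rewrite cats0; case: s => [//|q s] hs hl; exfalso.
  have z0 : 0 < dot (z j) (z j).
    by apply: dot_gt0; have := edge_neq (edge_0z j); rewrite subr0.
  have incr p s' : path (fun p q => `[< edge Sigma p q /\ exists2 r : R, 0 < r & q - p = r *: z j >]) p s' ->
      dot p (z j) <= dot (last p s') (z j).
    elim: s' p => [//|q' s' IHs] p /= /andP[/asboolP[_ [r r0 e]] /IHs]; apply: le_trans.
    rewrite -subr_ge0 -dotBl e dotZl; apply: mulr_ge0; exact: ltW.
  move: hs hl => /= /andP[/asboolP[_ [r r0 e]] /incr]; move=> h el.
  move: h; rewrite el -subr_ge0 -dotBl -opprB e dotNl dotZl oppr_ge0.
  by rewrite leNgt mulr_gt0.
have eL : L ++ nseq N.+1 j = rcons L j ++ nseq N j by rewrite cat_rcons.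
have hL : good (rcons L j) by move: hg; rewrite eL; apply: good_catl.
case: s => [_ hl|q s].
  have : pos L = pos (L ++ nseq N.+1 j) := hl.
  rewrite pos_cat pos_nseq => /eqP.
  rewrite -subr_eq0 opprD addrA subrr sub0r oppr_eq0 scaler_eq0 pnatr_eq0 /=.
  by have := edge_neq (edge_0z j); rewrite subr0 => /negbTE ->.
move=> /= /andP[/asboolP[eq [r r0 e]] hs] hl.
have eq' : q = pos (rcons L j).
  apply: (edge_ray eq (good_edge hL) r0).
  by rewrite e pos_rcons (addrC (pos L)) addrK.
have q' : q = pos L + z j by rewrite eq' pos_rcons.
rewrite -q'; congr (_ :: _); rewrite eq' in hs hl *.
by apply: IH; rewrite -?eL.
Qed.

(** The chart of a combing path need not be standard. [label] corrects it, and the isometry [G]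
    extending the correction maps the alcove at [u] to the standard one, the break points to
    positions of blocks and the segment paths to walks. *)
Lemma combing_sub_walks : combing Phi Apt tau `<=` walk_paths.
Proof.
move=> _ [x [y [q [k0 [[phi [u [v [S [z0 [mu [t hyp]]]]]]] ->]]]]].
move: hyp => /=.
pose node (k : nat) := u + \sum_(i < n | (i < k)%N) mu i *: (z0 i - u).
move=> [[[A hA hphi'] eu ev us vs] [_ _ ts _ tz] [mu0 evE] ht ->].
have {}ht (k : 'I_n) : segment_path Phi (node k) (node k.+1) (t k) := ht k.
have hphi : chart_on A phi by split.
have [phi' st'] := exists_standard hA.
have su : (u |` range z0) u by left.
have [g [k [gE kI hk ku kz]]] := label hphi st' us ts su.
have st2 := standard_ew gE st'.
have sz i : (u |` range z0) (z0 i) by right; exists i.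
(* The ordering is bijective on the vertices other than [u]: one of them has type [i], it is some
   [z0 j], and comparing types gives [j] = [i]. *)
have zu i : z0 i <> u.
  have [h _ _] := tauO (chart_on_chart hphi).
  have [_ _ hs] := h _ u ts su us.
  have [w [sw wu] ew] := hs i I.
  case: sw => [//|[j _ ej]]; rewrite -ej in wu ew.
  by have := tz j; rewrite ew => ->.
have kz' i : k (z0 i) = z i by rewrite kz // tz.
have [G GI hG] := sim_isometry_ext kI.
have uv := special_vertex us.
have sS : simplices Sigma (u |` range z0) by case: ts.
have z0v i : cell_vertex Phi (z0 i) by apply: (simplex_vertex sS).
have Gu : G u = 0 by rewrite -hG.
have Gz i : G (z0 i) = z i by rewrite -hG.
have z0V i := vertexV (z0v i).
have GE (a : 'I_n -> R) : G (u + \sum_i a i *: (z0 i - u)) = \sum_i a i *: z i.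
  rewrite (eisometry_sum GI (vertexV uv) z0V erefl) Gu add0r.
  by apply: eq_bigr => i _; rewrite Gz subr0.
have kv : special Phi (\sum_i mu i *: z i).
  by rewrite -GE -evE -(hG _ (special_vertex vs)); apply: (sim_special kI).
(* The endpoint is special, so its coordinates [mu i / c i] on the coweights are integers; this
   makes every break point special and every [mu i] a natural number. *)
have muc i : mu i / c i \is a Num.int.
  move/specialP/latticeP: kv => [_ /(_ _ (rd_simple rd i))].
  rewrite dot_suml (bigD1 i) //= big1 => [|j ji]; rewrite !dotZl omegaPi.
    by rewrite eqxx mulr1 addr0.
  by rewrite (negbTE ji) !mulr0.
have [N hN] : exists N : 'I_n -> nat, forall i, mu i = (N i)%:R.
  suff /choice[N hN] : forall i, exists M : nat, mu i = M%:R by exists N.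
  move=> i; have [d ed] : exists d : nat, c i = d%:R.
    by case: (rd_mark rd i) => [->|[-> _]]; [exists 1%N|exists 2%N].
  have : mu i / c i \is a Num.nat.
    by rewrite natrEint muc divr_ge0 // ltW // c_gt0.
  move=> /natrP[M eM]; exists (M * d)%N.
  by rewrite natrM -eM -ed divfK // gt_eqF // c_gt0.
have Nc i : (N i)%:R / c i \is a Num.int by rewrite -hN.
have hgood k1 : good (blocks (below N k1)).
  by apply: good_blocks => i; rewrite /below; case: ifP => // _; rewrite mul0r rpred0.
have nodeE k1 : node k1 = u + \sum_i (below N k1 i)%:R *: (z0 i - u).
  rewrite /node big_mkcond; congr (_ + _); apply: eq_bigr => i _; rewrite /below hN.
  by case: ifP; rewrite ?scale0r.
have Gnode k1 : G (node k1) = pos (blocks (below N k1)) by rewrite nodeE GE pos_blocks.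
have nodeV k1 : node k1 \in V.
  rewrite nodeE memvD ?(vertexV uv) // memv_suml // => i _.
  by rewrite memvZ // memvB ?(vertexV uv).
have tv (j : 'I_n) w : w \in t j -> cell_vertex Phi w.
  have [hp _] := ht j; move: hp; elim: (t j) {3}(node j) => [//|b s IH] a /=.
  move=> /andP[/asboolP[[eab _] _] hs]; rewrite inE => /orP[/eqP ->|ws].
    by have [] := edge_vertex eab.
  exact: IH hs ws.
have Gt (j : 'I_n) : map G (t j) = walk_from (pos (blocks (below N j))) (nseq (N j) j).
  have [hp hl] := ht j.
  apply: ray_path; first by rewrite -blocks_belowS.
    rewrite -Gnode.
    have : node j.+1 - node j = mu j *: (z0 j - u).
      rewrite !nodeE opprD addrACA subrr add0r -sumrB (bigD1 j) //= big1 => [|i ij].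
        by rewrite /below ltnSn ltnn scale0r subr0 addr0 hN.
      rewrite /below ltnS leq_eqVlt (_ : (i == j :> nat) = false) ?subrr //.
      by apply: contraNF ij => /eqP/val_inj ->.
    move=> eN; elim: (t j) {1 4 5}(node j) (nodeV j) hp {hl} => [//|b s IH] a aV /=.
    move=> /andP[/asboolP[[eab _] [r r0 er]] hs].
    have [av bv] := edge_vertex eab.
    apply/andP; split; last exact: IH (vertexV bv) hs.
    apply/asboolP; split; first by rewrite -!hG //; apply: sim_edge.
    rewrite eN scalerA in er.
    have e := eisometry_parallel GI aV (vertexV bv) (vertexV uv) (z0V j) er.
    rewrite Gu Gz subr0 in e; exists (r * mu j) => //.
    rewrite mulr_gt0 // lt_def mu0 andbT; apply/eqP => m0.
    by have := edge_neq eab; rewrite er m0 mulr0 scale0r eqxx.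
  by rewrite -Gnode last_map hl Gnode blocks_belowS.
have e1 : map phi (u :: flatten [seq t j | j <- enum 'I_n]) =
    map (phi' \o g) (walk (blocks N)).
  have -> : walk (blocks N) = map G (u :: flatten [seq t j | j <- enum 'I_n]).
    rewrite /walk -(flatten_walks (fun j => esym (esym (Gt j)))) /= Gu.
    by rewrite map_flatten -map_comp.
  rewrite -map_comp; apply/eq_in_map => w hw.
  have wv : cell_vertex Phi w.
    move: hw; rewrite inE => /orP[/eqP -> //|/flattenP[_ /mapP[j _ ->]]]; exact: tv.
  by rewrite /= (hk w wv).2 hG.
exists A, (phi' \o g), (take k0 (blocks N)); split=> //.
  exact/good_take/good_blocks.
by rewrite -[phi u :: _]/(map phi (u :: _)) e1 -map_take take_walk.
Qed.

Lemma nseq_path (L : seq 'I_n) j N : good (L ++ nseq N j) ->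
  segment_path Phi (pos L) (pos (L ++ nseq N j)) (walk_from (pos L) (nseq N j)).
Proof.
move=> hg; split; last by rewrite last_walk_from pos_cat.
set x := pos L; set y := pos (L ++ nseq N j).
have exy : y - x = N%:R *: z j by rewrite /y pos_cat pos_nseq addrC addKr.
suff h M r : (r + M = N)%N -> path (fun a b => `[< edge_on Phi x y a b /\ codirected x y a b >])
    (x + r%:R *: z j) (walk_from (x + r%:R *: z j) (nseq M j)).
  by have := h N 0%N (add0n N); rewrite scale0r addr0.
elim: M r => [//|M IH] r er /=.
have eS : x + r%:R *: z j + z j = x + r.+1%:R *: z j.
  by rewrite -addrA -[r.+1%:R]natr1 scalerDl scale1r.
rewrite eS IH ?addSnnS // andbT.
have rN : (r < N)%N by rewrite -er -addSnnS leq_addr.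
have N0 : (0 : R) < N%:R by rewrite ltr0n; apply: leq_ltn_trans rN.
apply/asboolP; split; last first.
  exists N%:R^-1; first by rewrite invr_gt0.
  have -> : N%:R^-1 *: (y - x) = z j.
    by rewrite exy [LHS]scalerA mulVf ?gt_eqF // [LHS]scale1r.
  by rewrite -eS addrAC subrr add0r.
split.
  have := @good_edge (L ++ nseq r j) j.
  rewrite rcons_cat nseq_rcons !pos_cat !pos_nseq; apply.
  apply: (good_catl (L2 := nseq M j)).
  by rewrite -catA -nseqD addSnnS er.
move=> _ [t /andP[t0 t1] <-]; exists ((r%:R + t) / N%:R).
  apply/andP; split; first by rewrite divr_ge0 ?addr_ge0 ?ler0n // ltW.
  rewrite ler_pdivrMr // mul1r; apply: (@le_trans _ _ r.+1%:R); last by rewrite ler_nat.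
  by rewrite -natr1 lerD2l.
have -> : y = x + N%:R *: z j by rewrite -exy addrC subrK.
rewrite -[r.+1%:R]natr1; apply: segment_reparam.
by rewrite mulrC divfK // gt_eqF.
Qed.

(** The sector of an interior point of the alcove: every positive root is positive there, so the
    sector is the dominant cone. *)
Lemma dominant_sector (N : 'I_n -> R) : (forall i, 0 <= N i) ->
  exists S, [/\ sector Phi 0 S, S 0, forall i, S (z i) & S (\sum_i N i *: z i)].
Proof.
move=> N0; pose p := barycenter xpredT.
have p0 i : 0 < dot p (Pi i).
  have [|h1 h2] := @aff_barycenter xpredT (Some i); first by exists None.
  by have : 0 < aff (Some i) p; [rewrite lt_def h1 h2|rewrite /aff /= addr0].
have pos_root al : al \in Phi -> (forall i, 0 <= dot (omega i) al) -> 0 < dot p al.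
  move=> aP h; rewrite lt_def dot_root // sumr_ge0 ?andbT; last first.
    by move=> i _; rewrite mulr_ge0 // ltW.
  apply/negP => /eqP/eqP; rewrite psumr_eq0 => [/allP e|i _]; last by rewrite mulr_ge0 // ltW.
  have /negP := rd_neq0 rd aP; apply; apply/eqP; rewrite (rd_span rd aP) big1 // => i _.
  have := e i (mem_index_enum i); rewrite /= mulf_eq0 (gt_eqF (p0 i)) orbF => /eqP ->.
  by rewrite scale0r.
pose S := [set v | v \in V /\ forall al, al \in Phi -> 0 < dot (p - 0) al -> 0 <= dot (v - 0) al].
have Sdom v : v \in V -> (forall i, 0 <= dot v (Pi i)) -> S v.
  move=> vV h; split=> // al aP; rewrite !subr0 => pal.
  case: (rd_sign rd aP) => ha.
    by rewrite dot_root // sumr_ge0 // => i _; rewrite mulr_ge0.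
  have hN i : 0 <= dot (omega i) (- al) by rewrite dotNr oppr_ge0.
  have := pos_root _ (rd_opp rd aP) hN; rewrite dotNr oppr_gt0 => /(lt_trans pal).
  by rewrite ltxx.
exists S; split.
- exists p; split=> //; first exact: barycenterV.
  move=> al aP; rewrite subr0; case: (rd_sign rd aP) => ha.
    by rewrite gt_eqF // pos_root.
  have hN i : 0 <= dot (omega i) (- al) by rewrite dotNr oppr_ge0.
  by have := pos_root _ (rd_opp rd aP) hN; rewrite dotNr oppr_gt0 => h; rewrite lt_eqF.
- by apply: Sdom => [|i]; rewrite ?mem0v ?dot0l.
- move=> i; apply: Sdom => [|j]; first exact: cornerV.
  by rewrite dotZl omegaPi mulr_ge0 ?ler0n // invr_ge0 ltW // c_gt0.
- apply: Sdom => [|i].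
    by rewrite memv_suml // => i _; rewrite memvZ // cornerV.
  rewrite dot_suml sumr_ge0 // => j _; rewrite !dotZl omegaPi.
  by rewrite !mulr_ge0 ?ler0n // invr_ge0 ltW // c_gt0.
Qed.

(** A walk may stop at a nonspecial vertex inside its last block; extending that block yields a full
    combing path of which it is a prefix. *)
Lemma good_complete L : good L -> exists N : 'I_n -> nat,
  (forall i, (N i)%:R / c i \is a Num.int) /\ L = take (size L) (blocks N).
Proof.
case/lastP: L => [|L j] hL.
  by exists (fun=> 0%N); split=> [i|]; rewrite ?mul0r ?rpred0 ?take0.
(* Doubling the multiplicity of the last type makes it divisible by the mark, be it 1 or 2. *)
pose M := rcons L j ++ nseq (count_mem j (rcons L j)) j.
have sM : sorted ole M.
  rewrite (sorted_pairwise ole_trans) pairwise_cat -(sorted_pairwise ole_trans) hL.1 /=.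
  apply/andP; split.
    by apply/allrelP => i k hi /nseqP[-> _]; apply: (sorted_rcons_le hL.1).
  elim: (count_mem _ _) => [//|K IHK] /=; rewrite IHK andbT.
  by apply/allP => x /nseqP[-> _]; apply: ole_refl.
exists (fun i => count_mem i M); split=> [i|]; last first.
  by rewrite -(blocks_unique sM (fun=> erefl)) take_size_cat.
rewrite /M count_cat count_nseq /=.
have [ji|ji] := eqVneq j i.
  rewrite -ji mul1n natrD; case: (rd_mark rd j) => [->|[-> _]].
    by rewrite divr1 rpredD // natr_int.
  by rewrite -mulr2n -[X in X / _]mulr_natr mulfK ?natr_int // pnatr_eq0.
rewrite mul0n addn0; have [lt|ge] := ltnP i j.
  by apply: hL.2 lt; rewrite mem_rcons mem_head.
rewrite (_ : count_mem i _ = 0%N) ?mul0r ?rpred0 //; apply/count_memPn/negP => iL.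
have le := sorted_rcons_le hL.1 iL.
by move/eqP: ji; apply; apply: val_inj; apply/eqP; rewrite eqn_leq ge le.
Qed.

Lemma walks_sub_combing : walk_paths `<=` combing Phi Apt tau.
Proof.
move=> _ [A [phi [L [st hL ->]]]]; have [hphi stz] := st.
have [N [Nc eL]] := good_complete hL.
have N0 i : (0 : R) <= (N i)%:R by apply: ler0n.
have [S [hS S0 Sz Sv]] := dominant_sector N0.
have gb k : good (blocks (below N k)).
  by apply: good_blocks => i; rewrite /below; case: ifP => // _; rewrite mul0r rpred0.
pose t (k : 'I_n) := walk_from (pos (blocks (below N k))) (nseq (N k) k).
have node k : 0 + \sum_(i < n | (i < k)%N) (N i)%:R *: (z i - 0) = pos (blocks (below N k)).
  rewrite add0r pos_blocks big_mkcond; apply: eq_bigr => i _; rewrite /below subr0.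
  by case: ifP; rewrite ?scale0r.
have ez : \sum_i (N i)%:R *: z i = pos (blocks N) by rewrite pos_blocks.
have fE : 0 |` range (fun i => z i) = face id xpredT.
  apply/seteqP; split=> [x [->|[i _ <-]]|x [[i|] _ ->]].
  - by exists None.
  - by exists (Some i).
  - by right; exists i.
  - by left.
exists (phi 0), (phi (pos (blocks N))), (map phi (walk (blocks N))), (size L); split; last first.
  by rewrite -map_take take_walk -eL.
exists phi, 0, (pos (blocks N)), S, (fun i => z i), (fun i => (N i)%:R), t; split.
- split=> //; first exact: chart_on_chart hphi.
    exact: special0.
  by apply/pos_special => i; rewrite count_blocks.
- split=> //; first by rewrite -ez.
    by rewrite fE; apply/top_simplexP; exists id => //; apply: ew_id.
  by move=> x [->//|[i _ <-]].
- split=> //; rewrite add0r -ez; apply: eq_bigr => i _; by rewrite subr0.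
- move=> k; rewrite !node blocks_belowS; apply: nseq_path.
  by rewrite -blocks_belowS.
- by rewrite (flatten_walks (N := N) (t := t)).
Qed.

End RootDatum.

(** * The root systems A_n, B_n, C_n *)

Section Coordinates.
Variables (R : realType) (m : nat).
Implicit Types u v : 'rV[R]_m.

Lemma dot_epsE v (k : 'I_m) : dot v (eps k) = v 0 k.
Proof.
rewrite /dot (bigD1 k) //= mxE eqxx mulr1 big1 ?addr0 // => j jk.
by rewrite mxE (_ : (j == k :> nat) = false) ?mulr0 // ; apply/negbTE.
Qed.

Lemma dot_eps j k : (j < m)%N -> dot (eps j : 'rV[R]_m) (eps k) = (j == k)%:R.
Proof.
move=> jm; rewrite dotC -[j]/(nat_of_ord (Ordinal jm)) dot_epsE mxE //=.
Qed.

Lemma coord_ext u v : (forall k, (k < m)%N -> dot u (eps k) = dot v (eps k)) -> u = v.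
Proof. by move=> h; apply/rowP => k; rewrite -!dot_epsE h. Qed.

Lemma dot_coord u v : dot u v = \sum_(k < m) dot u (eps k) * dot v (eps k).
Proof. by apply: eq_bigr => k _; rewrite !dot_epsE. Qed.

End Coordinates.

Section Classical.
Variables (R : realType) (X : cartan_type) (n : nat).
Hypothesis hn : admissible_rank X n.

Notation m := (ambient_dim X n).
Notation Phi := (root_system R X n).
Notation Pi := (simple_roots R X n).
Notation e k := (eps k : 'rV[R]_m).
Implicit Types (v : 'rV[R]_m) (s t : bool).

(** The length of the roots on the coordinate axes; type A has none, and 0 is a placeholder
    there. *)
Definition axis_length : R := match X with TypeA => 0 | TypeB => 1 | TypeC => 2 end.

Definition pair_root v := exists a b s t, [/\ (a < m)%N && (b < m)%N, a != b,
  X = TypeA -> s != t & v = (-1) ^+ s *: e a + (-1) ^+ t *: e b].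

Definition axis_root v := exists a s, [/\ (a < m)%N, X <> TypeA
  & v = ((-1) ^+ s * axis_length) *: e a].

Let pairsP (f : nat -> nat -> 'rV[R]_m) M v :
  reflect (exists a b, [/\ (a < M)%N && (b < M)%N, a != b & v = f a b])
   (v \in [seq f i j | i <- iota 0 M, j <- [seq j <- iota 0 M | j != i]]).
Proof.
apply: (iffP allpairsPdep) => -[a [b [h1 h2 ->]]]; exists a, b.
  by move: h1 h2; rewrite mem_filter !mem_iota /= !add0n eq_sym => -> /andP[-> ->].
by move/andP: h1 => [aM bM]; rewrite mem_filter !mem_iota /= !add0n aM bM eq_sym h2.
Qed.

Let axisP (r : R) M v :
  reflect (exists2 a, (a < M)%N & v = r *: e a) (v \in [seq r *: e i | i <- iota 0 M]).
Proof.
by apply: (iffP mapP) => -[a]; rewrite ?mem_iota => h ->; exists a; rewrite ?mem_iota.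
Qed.

(** A description uniform in the three types: from here on one distinguishes roots with two nonzero
    coordinates from roots with one. *)
Lemma classical_rootP v : v \in Phi <-> pair_root v \/ axis_root v.
Proof.
rewrite /pair_root /axis_root /axis_length /root_system.
move: pairsP axisP v; case: X => pP aP v; cbv beta iota zeta.
- split=> [/pP[a [b [h1 h2 ->]]]|[[a [b [s [t [h1 h2 /(_ erefl) st ->]]]]]|[a [s []]]]] //.
    by left; exists a, b, false, true; split=> //; rewrite expr0 expr1 scale1r scaleN1r.
  apply/pP; case: s t st => -[] //= _; rewrite expr0 expr1 scale1r scaleN1r.
    by exists b, a; rewrite eq_sym andbC addrC.
  by exists a, b.
- rewrite !mem_cat; split.
    move=> /or4P[/pP[a [b [h1 h2 ->]]]|/pP[a [b [h1 h2 ->]]]|/mapP[_ /pP[a [b [h1 h2 ->]]] ->]|].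
    + by left; exists a, b, false, true; split=> //; rewrite expr0 expr1 scale1r scaleN1r.
    + by left; exists a, b, false, false; split=> //; rewrite expr0 !scale1r.
    + by left; exists a, b, true, true; split=> //; rewrite expr1 !scaleN1r opprD.
    + move=> /orP[/aP[a h ->]|/aP[a h ->]]; right.
        by exists a, false; rewrite expr0 mulr1.
      by exists a, true; rewrite expr1 mulr1.
  move=> [[a [b [s [t [h1 h2 _ ->]]]]]|[a [s [h1 _ ->]]]].
    case: s t => -[]; rewrite ?expr0 ?expr1 ?scale1r ?scaleN1r.
    + by apply/or4P/Or43/mapP; exists (eps a + eps b); rewrite ?opprD //; apply/pP; exists a, b.
    + by apply/or4P/Or41/pP; exists b, a; rewrite eq_sym andbC addrC.
    + by apply/or4P/Or41/pP; exists a, b.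
    + by apply/or4P/Or42/pP; exists a, b.
  apply/or4P/Or44; case: s; rewrite ?expr0 ?expr1 mulr1; apply/orP; [right|left].
    by apply/aP; exists a.
  by apply/aP; exists a.
- rewrite !mem_cat; split.
    move=> /or4P[/pP[a [b [h1 h2 ->]]]|/pP[a [b [h1 h2 ->]]]|/mapP[_ /pP[a [b [h1 h2 ->]]] ->]|].
    + by left; exists a, b, false, true; split=> //; rewrite expr0 expr1 scale1r scaleN1r.
    + by left; exists a, b, false, false; split=> //; rewrite expr0 !scale1r.
    + by left; exists a, b, true, true; split=> //; rewrite expr1 !scaleN1r opprD.
    + move=> /orP[/aP[a h ->]|/aP[a h ->]]; right.
        by exists a, false; rewrite expr0 mul1r.
      by exists a, true; rewrite expr1 mulN1r.
  move=> [[a [b [s [t [h1 h2 _ ->]]]]]|[a [s [h1 _ ->]]]].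
    case: s t => -[]; rewrite ?expr0 ?expr1 ?scale1r ?scaleN1r.
    + by apply/or4P/Or43/mapP; exists (eps a + eps b); rewrite ?opprD //; apply/pP; exists a, b.
    + by apply/or4P/Or41/pP; exists b, a; rewrite eq_sym andbC addrC.
    + by apply/or4P/Or41/pP; exists a, b.
    + by apply/or4P/Or42/pP; exists a, b.
  apply/or4P/Or44; case: s; rewrite ?expr0 ?expr1 ?mul1r ?mulN1r; apply/orP; [right|left].
    by apply/aP; exists a.
  by apply/aP; exists a.
Qed.

Lemma simple_rootE (i : 'I_n) : ((i.+1 < m)%N -> Pi i = e i - e i.+1) /\
  (~~ (i.+1 < m)%N -> X <> TypeA /\ Pi i = axis_length *: e i).
Proof.
have := ltn_ord i; rewrite /simple_roots /axis_length.
case: X => /= h; split=> hi //.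
- by move: hi; rewrite ?ltnS h.
- by rewrite (ltn_eqF hi).
- rewrite (_ : i.+1 == n); first by rewrite scale1r.
  by rewrite eqn_leq h leqNgt hi.
- by rewrite (ltn_eqF hi).
- by have -> : i.+1 == n by rewrite eqn_leq h leqNgt hi.
Qed.

Lemma rank_le : (n <= m)%N. Proof. by case: X. Qed.
Lemma axis_gt0 : X <> TypeA -> 0 < axis_length.
Proof. by rewrite /axis_length; case: X. Qed.

Lemma pair_dot a b s t u v : (a < m)%N -> (b < m)%N ->
  u = (-1) ^+ s *: e a + (-1) ^+ t *: e b -> a != b -> dot u u = 2.
Proof.
move=> am bm -> ab; rewrite !dotE !dot_eps // eqxx eqxx (negbTE ab) eq_sym (negbTE ab).
by rewrite !mulr0 !mulr1 addr0 add0r -!signr_addb !addbb.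
Qed.

Lemma root_norm v : v \in Phi -> dot v v = 2 \/ dot v v = axis_length ^+ 2 /\ X <> TypeA.
Proof.
move=> /classical_rootP[[a [b [s [t [/andP[am bm] ab _ ev]]]]]|[a [s [am nA ->]]]].
  by left; apply: (pair_dot v am bm ev).
right; split=> //; rewrite !dotE dot_eps // eqxx mulr1 mulrACA -signr_addb addbb mul1r.
by rewrite expr2.
Qed.

Lemma root_neq0 : {in Phi, forall al, al != 0}.
Proof.
move=> v /root_norm h; apply/eqP => v0; move: h; rewrite v0 dot0l => -[/eqP|[/eqP h /axis_gt0 a0]].
  by rewrite eq_sym pnatr_eq0.
by move: h; rewrite eq_sym sqrf_eq0 gt_eqF.
Qed.

Lemma root_opp : {in Phi, forall al, - al \in Phi}.
Proof.
move=> v /classical_rootP h; apply/classical_rootP; case: h => [[a [b [s [t [h1 h2 h3 ->]]]]]|[a [s [h1 h2 ->]]]].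
  left; exists a, b, (~~ s), (~~ t); split=> //; first by move=> /h3; clear; case: s t => -[].
  by rewrite opprD -!scaleNr !signrN.
by right; exists a, (~~ s); split=> //; rewrite -scaleNr signrN mulNr.
Qed.

(** Reflections act on the basis by signed permutations, without signs in type A; in this form they
    visibly preserve the shape of a root. *)
Lemma reflection_signed al : al \in Phi -> exists (p : nat -> nat) (f : nat -> bool),
  [/\ forall k, (k < m)%N -> (p k < m)%N, injective p, X = TypeA -> forall k, f k = false
    & forall k, (k < m)%N -> reflection al (e k) = (-1) ^+ f k *: e (p k)].
Proof.
move=> /classical_rootP[[a [b [s [t [/andP[am bm] ab hA ea]]]]]|[a [s [am nA ->]]]].
  exists (fun k => if k == a then b else if k == b then a else k),
    (* The signs change exactly when [s] and [t] agree, which is excluded in type A. *)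
    (fun k => ((k == a) || (k == b)) && ~~ (s (+) t)); split.
  - by move=> k km; case: eqP => // _; case: eqP.
  - apply: inv_inj => k; case: (eqVneq k a) => [->|ka]; first by rewrite eq_sym (negbTE ab) eqxx.
    case: (eqVneq k b) => [->|kb]; first by rewrite eqxx.
    by rewrite (negbTE ka) (negbTE kb).
  - by move=> /hA st k; rewrite (_ : ~~ _ = false) ?andbF //; case: s t st {ea hA} => -[].
  - move=> k km; rewrite reflectionE (pair_dot al am bm ea ab).
    rewrite mulrAC divff ?pnatr_eq0 // mul1r {2}ea scalerDr !scalerA.
    rewrite ea !dotE !dot_eps //.
    case: (eqVneq k a) => [->|ka] /=.
      rewrite (negbTE ab) mulr1 mulr0 addr0 -!signr_addb addbb scale1r opprD addNKr.
      by rewrite -scaleNr signrN.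
    case: (eqVneq k b) => [->|kb] /=.
      rewrite mulr1 mulr0 add0r -!signr_addb addbb scale1r [X in _ - X]addrC opprD addNKr.
      by rewrite -scaleNr signrN addbC.
    by rewrite !mulr0 addr0 !mul0r !scale0r addr0 subr0 scale1r.
exists id, (fun k => k == a); split=> // k km.
have l0 : axis_length != 0 by rewrite gt_eqF // axis_gt0.
rewrite reflectionE !dotE !dot_eps // scalerA.
case: (eqVneq k a) => [->|ka] /=; last first.
  by rewrite !mulr0 !mul0r scale0r subr0 scale1r.
rewrite eqxx -{1}[e a]scale1r -scalerBl; congr (_ *: _); rewrite expr1.
have s0 : (-1) ^+ s != 0 :> R by rewrite signr_eq0.
rewrite /= ?mulr1; move: ((-1) ^+ s) axis_length s0 l0 => x y x0 y0.
by field; rewrite x0 y0.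
Qed.

Lemma root_refl : {in Phi &, forall al be, reflection al be \in Phi}.
Proof.
move=> al be /reflection_signed[p [f [pm pinj fA h]]] /classical_rootP hb; apply/classical_rootP.
have r0 : reflection al 0 = 0 by rewrite reflectionE dot0l mulr0 mul0r scale0r subr0.
have lin x y u v : reflection al (x *: u + y *: v) = x *: reflection al u + y *: reflection al v.
  rewrite (@reflection_is_linear _ _ al); congr (_ + _).
  by have := @reflection_is_linear _ _ al y v 0; rewrite r0 !addr0.
case: hb => [[a [b [s [t [/andP[am bm] ab hA ->]]]]]|[a [s [am nA ->]]]].
  left; exists (p a), (p b), (s (+) f a), (t (+) f b); split.
  - by rewrite !pm.
  - by rewrite (inj_eq pinj).
  - by move=> XA; rewrite !fA // !addbF hA.
  - by rewrite lin !h // !scalerA -!signr_addb.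
right; exists (p a), (s (+) f a); split=> //; first exact: pm.
have := lin ((-1) ^+ s * axis_length) 0 (e a) 0; rewrite !scale0r !addr0 => ->.
by rewrite h // scalerA signr_addb mulrAC.
Qed.

Lemma root_int v k : v \in Phi -> dot v (eps k) \is a Num.int.
Proof.
move=> /classical_rootP[[a [b [s [t [/andP[am bm] _ _ ->]]]]]|[a [s [am nA ->]]]]; rewrite !dotE !dot_eps //.
  by rewrite rpredD // rpredM ?rpred_sign // natr_int.
rewrite !rpredM ?rpred_sign ?natr_int // /axis_length.
by case: X => //; [exact: rpred0|exact: rpred1|exact: natr_int].
Qed.

(** Proportional roots have the same number of nonzero coordinates, hence the same length, so the
    factor has square 1. *)
Lemma root_prim : {in Phi &, forall al be r, be = r *: al -> r = 1 \/ r = -1}.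
Proof.
move=> al be ha hb r e1.
have r0 : r != 0.
  by apply/eqP => r0; have := root_neq0 hb; rewrite e1 r0 scale0r eqxx.
suff h : dot al al = dot be be.
  have := dot_gt0 (root_neq0 ha); rewrite {1}h e1 !dotE mulrA => a0.
  have : r * r = 1.
    apply: (mulIf (lt0r_neq0 (dot_gt0 (root_neq0 ha)))); rewrite mul1r.
    by rewrite [RHS]h e1 !dotE mulrA.
  by rewrite -expr2 => /eqP; rewrite sqrf_eq1 => /orP[/eqP ->|/eqP ->]; [left|right].
have sgn0 s : (-1) ^+ s != 0 :> R by rewrite signr_eq0.
have kinds a b s t a' s' x y : a != b -> (a < m)%N -> (b < m)%N -> (a' < m)%N ->
    y != 0 -> (-1) ^+ s *: e a + (-1) ^+ t *: e b = y *: (((-1) ^+ s' * x) *: e a') -> False.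
  move=> ab am bm am' y0 ee.
  have := congr1 (fun v => dot v (eps a)) ee; have := congr1 (fun v => dot v (eps b)) ee.
  have ba : (b == a) = false by rewrite eq_sym (negbTE ab).
  rewrite !dotE !dot_eps // !eqxx (negbTE ab) ba !mulr0 !mulr1 add0r addr0.
  case: (eqVneq a' a) => [->|aroot].
    by rewrite (negbTE ab) !mulr0 => /eqP; rewrite (negbTE (sgn0 t)).
  by rewrite !mulr0 => _ /eqP; rewrite (negbTE (sgn0 s)).
case: (classical_rootP al) => [/(_ ha) ra _]; case: (classical_rootP be) => [/(_ hb) rb _].
case: ra rb => [[a [b [s [t [/andP[am bm] ab _ ea]]]]]|[a [s [am nA ea]]]]
  [[a' [b' [s' [t' [/andP[am' bm'] ab' _ eb]]]]]|[a' [s' [am' nA' eb]]]].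
- by rewrite (pair_dot al am bm ea ab) (pair_dot be am' bm' eb ab').
- exfalso; apply: (kinds a b s t a' s' axis_length r^-1 ab am bm am').
    by rewrite invr_eq0.
  by rewrite -ea -eb e1 scalerA mulVf // scale1r.
- exfalso; apply: (kinds a' b' s' t' a s axis_length r ab' am' bm' am r0).
  by rewrite -ea -eb.
- rewrite ea eb !dotE !dot_eps // !eqxx !mulr1 mulrACA -signr_addb addbb.
  by rewrite [RHS]mulrACA -signr_addb addbb.
Qed.

Lemma root_simple i : Pi i \in Phi.
Proof.
apply/classical_rootP; have [h1 h2] := simple_rootE i; have im := leq_trans (ltn_ord i) rank_le.
have [lt|/h2[nA ->]] := boolP (i.+1 < m)%N.
  left; exists i, i.+1, false, true; rewrite im lt; split=> //; first by rewrite ltn_eqF.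
  by rewrite h1 // expr0 expr1 scale1r scaleN1r.
by right; exists i, false; split=> //; rewrite expr0 mul1r.
Qed.

Lemma root_orth (i j k : 'I_n) : (i < j < k)%N -> dot (Pi i) (Pi k) = 0.
Proof.
move=> /andP[ij jk]; have km := leq_trans (ltn_ord k) rank_le.
have ik : (i.+1 < k)%N by apply: leq_ltn_trans jk.
have [h1 _] := simple_rootE i; have [h3 h4] := simple_rootE k.
have i1 : (i.+1 < m)%N by apply: ltn_trans km.
have i0 : (i < m)%N by apply: ltn_trans i1.
have n0 : (i == k :> nat) = false by apply/negbTE/eqP; lia.
have n1 : (i == k.+1 :> nat) = false by apply/negbTE/eqP; lia.
have n2 : (i.+1 == k :> nat) = false by apply/negbTE/eqP; lia.
have n3 : (i.+1 == k.+1 :> nat) = false by apply/negbTE/eqP; lia.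
have [lt|/h4[_ ->]] := boolP (k.+1 < m)%N; rewrite h1 // ?h3 // !dotE !dot_eps //.
  rewrite n0 n1 n2 n3 /=; ring.
rewrite n0 n2 /=; ring.
Qed.

(** The product of the sign changes of all coordinates. It supplies the inversion required at marks
    equal to 2, which occur only in types B and C. *)
Lemma opposition : X <> TypeA -> exists2 l, {subset l <= Phi} &
  forall v, foldr (@reflection R m) v l = - v.
Proof.
move=> nA; have l0 : axis_length != 0 by rewrite gt_eqF // axis_gt0.
exists [seq axis_length *: e k | k <- iota 0 m].
  move=> x /mapP[k]; rewrite mem_iota => /= km ->; apply/classical_rootP; right.
  by exists k, false; rewrite expr0 mul1r.
move=> v; apply: coord_ext => k km.
have h (l : seq nat) : uniq l -> {subset l <= iota 0 m} ->
    dot (foldr (@reflection R m) v [seq axis_length *: e k | k <- l]) (eps k) =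
    (-1) ^+ (k \in l) * dot v (eps k).
  elim: l => [_ _|j l IH /= /andP[jl ul] sl]; first by rewrite mul1r.
  have jm : (j < m)%N by have := sl j (mem_head _ _); rewrite mem_iota.
  have {}IH := IH ul (fun x xl => sl x (mem_behead (s := j :: l) xl)).
  rewrite reflectionE !dotE !dot_eps // eqxx inE.
  case: (eqVneq j k) => [jk|jk].
    rewrite -jk in IH *; rewrite ?eqxx IH (negbTE jl) /= expr0 expr1.
    by field.
  by rewrite ?(negbTE jk) /= !mulr0 subr0 IH.
rewrite h ?iota_uniq // mem_iota /= km expr1 mulN1r dotNl //.
Qed.

End Classical.

(** * Coweights, highest root and marks in coordinates *)

Definition by_type (T : Type) (X : cartan_type) (a b c : T) : T :=
  match X with TypeA => a | TypeB => b | TypeC => c end.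

Lemma by_typeA (T : Type) X (x y z : T) : X = TypeA -> by_type X x y z = x.
Proof. by move=> ->. Qed.
Lemma by_typeB (T : Type) X (x y z : T) : X = TypeB -> by_type X x y z = y.
Proof. by move=> ->. Qed.
Lemma by_typeC (T : Type) X (x y z : T) : X = TypeC -> by_type X x y z = z.
Proof. by move=> ->. Qed.

Section ClassicalDatum.
Variables (R : realType) (X : cartan_type) (n : nat).
Hypothesis hn : admissible_rank X n.

Notation m := (ambient_dim X n).
Notation Phi := (root_system R X n).
Notation Pi := (simple_roots R X n).
Notation e k := (eps k : 'rV[R]_m).
Notation ax := (axis_length R X).
Variables (omega : 'I_n -> 'rV[R]_m) (c : 'I_n -> R).
Hypothesis homega : fundamental_coweights Phi Pi omega.
Hypothesis hc : highest_root_coefficients Phi Pi c.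
Implicit Types (v : 'rV[R]_m) (s t : bool).

Notation x i k := (dot (omega i) (eps k)).

Lemma dim_gt0 : (0 < m)%N.
Proof. by move: hn; case: X => //= ?; apply: ltnW. Qed.

Lemma rank_gt0 : (0 < n)%N.
Proof. by move: hn; case: X => //= ?; apply: ltnW. Qed.

Lemma dim_rank : X <> TypeA -> m = n.
Proof. by case: X. Qed.

Lemma omega_step i k : (k.+1 < m)%N -> x i k.+1 = x i k - (i == k :> nat)%:R.
Proof.
move=> km; have kn : (k < n)%N by move: km; case: X => //=; apply: ltnW.
have [h _] := simple_rootE R X (Ordinal kn).
have := homega.2 i (Ordinal kn); rewrite h //= dotBr -val_eqE /= => <-.
by rewrite opprB addrC subrK.
Qed.

(** Pairing with the simple roots determines the differences of consecutive coordinates. In type A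
    the first coordinate is left undetermined: it cancels in every product with a root. *)
Lemma omegaE i k : (k < m)%N -> x i k = x i 0 - (i < k)%:R.
Proof.
elim: k => [|k IH] km; first by rewrite subr0.
rewrite omega_step // IH; last exact: ltnW.
by rewrite ltnS (leq_eqVlt i k); case: (ltngtP i k) => _ /=; ring.
Qed.

Lemma omega0 i : X <> TypeA -> x i 0 = if i.+1 == n then ax^-1 else 1.
Proof.
move=> nA; have n0 := rank_gt0; have mn := dim_rank nA.
have ln : (n.-1 < n)%N by rewrite prednK.
have [_ h] := simple_rootE R X (Ordinal ln).
have [|_ el] := h; first by rewrite /= prednK // mn ltnn.
have := homega.2 i (Ordinal ln); rewrite el dotZr /= omegaE ?mn // -val_eqE /=.
have a0 := lt0r_neq0 (axis_gt0 R nA).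
have -> : (i == n.-1 :> nat) = (i.+1 == n) by apply/idP/idP => /eqP h0; apply/eqP; move: h0 n0; lia.
have [e1|ne] := eqVneq i.+1 n.
  have -> : (i < n.-1)%N = false by apply/negbTE; rewrite -leqNgt; move: e1; lia.
  by rewrite subr0 => h1; apply: (mulfI a0); rewrite h1 mulfV.
have lt : (i < n.-1)%N by have := ltn_ord i; move/eqP: ne; lia.
by rewrite lt => /eqP; rewrite mulf_eq0 (negbTE a0) /= subr_eq0 => /eqP.
Qed.

Lemma omega_antitone i j k : (j <= k)%N -> (k < m)%N -> x i k <= x i j.
Proof.
move=> jk km; rewrite omegaE // (omegaE i (k := j)); last exact: leq_ltn_trans km.
rewrite lerB // ler_nat; case: (ltnP i j) => // ij.
by rewrite (leq_trans ij jk).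
Qed.

Lemma omega_ge0 i k : X <> TypeA -> (k < m)%N -> 0 <= x i k.
Proof.
move=> nA km; rewrite omegaE // omega0 //; have mn := dim_rank nA.
case: eqP => [e1|_]; last by rewrite subr_ge0 (ler_nat R _ 1) leq_b1.
have -> : (i < k)%N = false by apply/negbTE; rewrite -leqNgt -ltnS e1 -mn.
by rewrite subr0 invr_ge0 ltW // axis_gt0.
Qed.

Lemma dot_pair i a b s t :
  dot (omega i) ((-1) ^+ s *: e a + (-1) ^+ t *: e b) = (-1) ^+ s * x i a + (-1) ^+ t * x i b.
Proof. by rewrite !dotE. Qed.

Lemma omega_sign : {in Phi, forall be, (forall i, 0 <= dot (omega i) be) \/
                                       (forall i, dot (omega i) be <= 0)}.
Proof.
move=> be /classical_rootP[[a [b [s [t [/andP[am bm] ab hA ->]]]]]|[a [s [am nA ->]]]].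
  have nA : s = t -> X <> TypeA by move=> st /hA; rewrite st eqxx.
  case: s t {hA} nA => -[] nA.
  - right=> i; rewrite dot_pair /= !mulN1r -opprD oppr_le0.
    by rewrite addr_ge0 //; apply: omega_ge0 => //; apply: nA.
  - have [lt|ge] := leqP a b; [right|left] => i; rewrite dot_pair /= mulN1r mul1r addrC.
      by rewrite subr_le0 omega_antitone.
    by rewrite subr_ge0 omega_antitone // ltnW.
  - have [lt|ge] := leqP a b; [left|right] => i; rewrite dot_pair /= mulN1r mul1r.
      by rewrite subr_ge0 omega_antitone.
    by rewrite subr_le0 omega_antitone // ltnW.
  - left=> i; rewrite dot_pair /= !mul1r.
    by rewrite addr_ge0 //; apply: omega_ge0 => //; apply: nA.
have p i : 0 <= ax * x i a by rewrite mulr_ge0 ?omega_ge0 // ltW // axis_gt0.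
case: s; [right|left] => i; rewrite dotZr -mulrA.
  by rewrite mulN1r oppr_le0.
by rewrite mul1r.
Qed.

Lemma axis_omega_int i k : X <> TypeA -> (k < m)%N -> ax * x i k \is a Num.int.
Proof.
move=> nA km; rewrite omegaE // omega0 // mulrBr; have a0 := lt0r_neq0 (axis_gt0 R nA).
have ai : ax \is a Num.int.
  by rewrite /axis_length; case: X; rewrite ?rpred0 ?rpred1 // natr_int.
have h (b : bool) : ax * b%:R \is a Num.int by rewrite rpredM ?natr_int.
by case: ifP => _; [rewrite mulfV //|rewrite mulr1]; rewrite rpredB ?rpred1.
Qed.

Lemma omega_int : {in Phi, forall be i, dot (omega i) be \is a Num.int}.
Proof.
move=> be /classical_rootP[[a [b [s [t [/andP[am bm] ab hA ->]]]]]|[a [s [am nA ->]]]] i; last first.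
  by rewrite dotZr -mulrA rpredM ?rpred_sign // axis_omega_int.
rewrite dot_pair omegaE // (omegaE i (k := b)) //.
have -> : (-1) ^+ s * (x i 0 - (i < a)%:R) + (-1) ^+ t * (x i 0 - (i < b)%:R) =
    ((-1) ^+ s + (-1) ^+ t) * x i 0 - ((-1) ^+ s * (i < a)%:R + (-1) ^+ t * (i < b)%:R) by ring.
apply: rpredB; last by rewrite rpredD // rpredM ?rpred_sign // natr_int.
have h2 : X <> TypeA -> 2 * x i 0 \is a Num.int.
  move=> nA; have := axis_omega_int i nA dim_gt0; move: (dot _ _) => y; rewrite /axis_length.
  by case: (X) nA => // _; rewrite mul1r => h; rewrite rpredM ?natr_int.
case: s t hA => -[] hA /=.
- by rewrite (_ : _ * _ = - (2 * x i 0)); [rewrite rpredN h2 // => /hA|ring].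
- by rewrite expr1 expr0 addNr mul0r rpred0.
- by rewrite expr1 expr0 subrr mul0r rpred0.
- by rewrite (_ : _ * _ = 2 * x i 0); [rewrite h2 // => /hA|ring].
Qed.

(** Let [D] be the sum of all coordinates of [v] and [T i] that of the coordinates beyond [i]. By
    [omegaE] the hypothesis reads [x i 0 * D = T i]. In types B and C the last tail is empty and
    gives [D] = 0; then all tails vanish, and the coordinates are their differences. *)
Lemma coords_inj v : (X = TypeA -> \sum_(k < m) dot v (eps k) = 0) ->
  (forall i, dot (omega i) v = 0) -> v = 0.
Proof.
move=> sA h; pose D := \sum_(k < m) dot v (eps k).
pose T (i : nat) := \sum_(k < m | (i < k)%N) dot v (eps k).
have hT i : x i 0 * D = T i.
  have := h i; rewrite dot_coord => hi; apply/eqP; rewrite -subr_eq0 -hi /D /T mulr_sumr.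
  rewrite [X in _ - X]big_mkcond -sumrB /=; apply/eqP; apply: eq_bigr => k _.
  by rewrite [in RHS]omegaE //; case: (i < k)%N => /=; ring.
have Tlast i : (m <= i.+1)%N -> T i = 0.
  move=> mi; rewrite /T big_pred0 // => k; apply/negbTE; rewrite -leqNgt -ltnS.
  exact: leq_trans (ltn_ord k) mi.
have D0 : D = 0.
  have [XA|nA] : X = TypeA \/ X <> TypeA by case: (X); [left|right|right].
    exact: sA.
  have n0 := rank_gt0; have ln : (n.-1 < n)%N by rewrite prednK.
  have := hT (Ordinal ln); rewrite Tlast /= ?prednK ?dim_rank // omega0 //= prednK // eqxx.
  by move=> /eqP; rewrite mulf_eq0 invr_eq0 (gt_eqF (axis_gt0 R nA)) => /eqP.
have T0 i : T i = 0.
  have [ni|ltn] := leqP n i; last by rewrite -(hT (Ordinal ltn)) D0 mulr0.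
  apply: Tlast; apply: leq_trans (_ : n.+1 <= _)%N; last by rewrite ltnS.
  by case: (X) => /=.
apply: coord_ext => k km; rewrite dot0l; pose o := Ordinal km.
case: k km @o => [|k] km o.
  have : D = dot v (eps 0) + T 0%N.
    rewrite /D (bigD1 o) //=; congr (_ + _); apply: eq_bigl => j.
    by rewrite lt0n -val_eqE.
  by rewrite D0 T0 addr0.
have : T k = dot v (eps k.+1) + T k.+1.
  rewrite /T (bigD1 o) //=; congr (_ + _); apply: eq_bigl => j.
  by rewrite -val_eqE /= [RHS]ltn_neqAle eq_sym andbC.
by rewrite !T0 addr0.
Qed.

Lemma root_sum0 v : X = TypeA -> v \in Phi -> \sum_(k < m) dot v (eps k) = 0.
Proof.
move=> XA /classical_rootP[[a [b [s [t [/andP[am bm] ab /(_ XA) hA ->]]]]]|[a [s [_ /(_ XA)]]]] //.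
have one j : (j < m)%N -> \sum_(k < m) (j == k)%:R = 1 :> R.
  move=> jm; rewrite (bigD1 (Ordinal jm)) //= eqxx big1 ?addr0 // => k.
  by rewrite -val_eqE /= eq_sym => /negbTE ->.
under eq_bigr => k _ do rewrite !dotE !dot_eps //.
rewrite big_split -!mulr_sumr /= !one // !mulr1.
by case: s t hA => -[] //= _; rewrite expr1 expr0 ?addNr ?subrr.
Qed.

Lemma omega_span : {in Phi, forall be, be = \sum_i dot (omega i) be *: Pi i}.
Proof.
move=> be bP; apply/eqP; rewrite -subr_eq0; apply/eqP; apply: coords_inj => [XA|i].
  under eq_bigr do rewrite dotBl.
  rewrite sumrB root_sum0 // sub0r; apply/eqP; rewrite oppr_eq0; apply/eqP.
  under eq_bigr do rewrite dot_suml.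
  rewrite exchange_big big1 // => i _.
  under eq_bigr do rewrite dotZl.
  by rewrite -mulr_sumr root_sum0 ?mulr0 //; apply: root_simple.
rewrite dotBr dot_sumr (bigD1 i) //= big1 => [|j ji]; rewrite dotZr homega.2.
  by rewrite eqxx mulr1 addr0 subrr.
by rewrite eq_sym (negbTE ji) mulr0.
Qed.

Notation theta := (\sum_i c i *: Pi i).

Lemma dot_omega_highest i : dot (omega i) theta = c i.
Proof.
rewrite dot_sumr (bigD1 i) //= big1 => [|j ji]; rewrite dotZr homega.2.
  by rewrite eqxx mulr1 addr0.
by rewrite eq_sym (negbTE ji) mulr0.
Qed.

Lemma omega_highest : {in Phi, forall be i, dot (omega i) be <= c i}.
Proof.
move=> be /hc.2[a a0 he] i; rewrite -subr_ge0 -dot_omega_highest -dotBr he.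
rewrite dot_sumr sumr_ge0 // => j _; rewrite dotZr homega.2.
by rewrite mulr_ge0 // ler0n.
Qed.

Lemma axis_lengthB : X = TypeB -> ax = 1. Proof. by move=> ->. Qed.
Lemma axis_lengthC : X = TypeC -> ax = 2. Proof. by move=> ->. Qed.

(** The explicit highest roots. The coefficients [c] are given only through maximality, and
    [highestE] links the two. *)
Definition highest : 'rV[R]_m := by_type X (e 0 - e n) (e 0 + e 1) (2 *: e 0).

Lemma highestA : X = TypeA -> highest = e 0 - e n.
Proof. exact: by_typeA. Qed.
Lemma highestB : X = TypeB -> highest = e 0 + e 1.
Proof. exact: by_typeB. Qed.
Lemma highestC : X = TypeC -> highest = 2 *: e 0.
Proof. exact: by_typeC. Qed.

Lemma highest_root_in : highest \in Phi.
Proof.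
have m0 := dim_gt0; have n0 := rank_gt0; apply/classical_rootP; rewrite /highest /pair_root /axis_root /axis_length.
move: hn m0 n0; case: X => /= h m0 n0.
- by left; exists 0%N, n, false, true; rewrite expr0 expr1 scale1r scaleN1r ltnSn; split; rewrite // ltn_eqF.
- by left; exists 0%N, 1%N, false, false; rewrite expr0 !scale1r m0 h.
- by right; exists 0%N, false; rewrite expr0 mul1r.
Qed.

Lemma le_highest be i : be \in Phi -> dot (omega i) be <= dot (omega i) highest.
Proof.
have m0 := dim_gt0.
have h0 k : (k < m)%N -> x i k <= x i 0 by move=> km; apply: omega_antitone.
have sg s (y : R) : 0 <= y -> (-1) ^+ s * y <= y by case: s => /= y0; rewrite ?expr1 ?expr0; lra.
move=> /classical_rootP[[a [b [s [t [/andP[am bm] ab hA ->]]]]]|[a [s [am nA ->]]]].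
- rewrite dot_pair; have [XA|nA] : X = TypeA \/ X <> TypeA by case: (X); [left|right|right].
    have nm : (n < m)%N by rewrite XA.
    have -> : dot (omega i) highest = x i 0 - x i n by rewrite highestA // dotBr.
    have := h0 a am; have := h0 b bm.
    have la : x i n <= x i a by apply: omega_antitone => //; rewrite -ltnS; move: am; rewrite XA.
    have lb : x i n <= x i b by apply: omega_antitone => //; rewrite -ltnS; move: bm; rewrite XA.
    by have := hA XA; clear hA; case: s t => -[] //= _; rewrite expr1 expr0; lra.
  have pa := omega_ge0 i nA am; have pb := omega_ge0 i nA bm.
  apply: (@le_trans _ _ (x i a + x i b)); first by apply: lerD; apply: sg.
  have ha := h0 a am; have hb := h0 b bm.
  have : X = TypeB \/ X = TypeC by move: nA; case: (X) => // _; [left|right].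
  move=> [XB|XC].
    have -> : dot (omega i) highest = x i 0 + x i 1.
      by rewrite highestB // dotDr.
    have [a0|a0] := posnP a.
      by rewrite a0; apply: lerD => //; apply: omega_antitone => //; move: ab; rewrite a0; lia.
    by rewrite addrC; apply: lerD => //; apply: omega_antitone.
  have -> : dot (omega i) highest = 2 * x i 0 by rewrite highestC // dotZr.
  lra.
- have pa := omega_ge0 i nA am; have ha := h0 a am; rewrite dotZr -mulrA.
  apply: (@le_trans _ _ (ax * x i a)); first by apply: sg; rewrite mulr_ge0 // ltW // axis_gt0.
  have : X = TypeB \/ X = TypeC by move: nA; case: (X) => // _; [left|right].
  move=> [XB|XC].
    have -> : dot (omega i) highest = x i 0 + x i 1.
      by rewrite highestB // dotDr.
    have m1 : (1 < m)%N by move: hn; rewrite XB.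
    by have := omega_ge0 i nA m1; rewrite axis_lengthB //; lra.
  have -> : dot (omega i) highest = 2 * x i 0 by rewrite highestC // dotZr.
  by rewrite axis_lengthC //; lra.
Qed.

(** Both are roots and each dominates all roots, so their coefficients on the simple roots agree. *)
Lemma highestE : theta = highest.
Proof.
rewrite (omega_span hc.1) (omega_span highest_root_in); apply: eq_bigr => i _.
congr (_ *: _); apply/eqP; rewrite eq_le le_highest ?hc.1 // dot_omega_highest.
by rewrite omega_highest // highest_root_in.
Qed.

Lemma three_types (P : Prop) : (X = TypeA -> P) -> (X = TypeB -> P) -> (X = TypeC -> P) -> P.
Proof. by case: (X) => hA hB hC; [apply: hA|apply: hB|apply: hC]. Qed.

Lemma markA i : X = TypeA -> c i = 1.
Proof.
move=> XA; rewrite -dot_omega_highest highestE highestA // dotBr (omegaE i (k := n)); last by rewrite XA.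
by rewrite ltn_ord /=; ring.
Qed.

Lemma markB i : X = TypeB -> c i = if (i : nat) == 0%N then 1 else 2.
Proof.
move=> XB; rewrite -dot_omega_highest highestE highestB // dotDr.
have m1 : (1 < m)%N by move: hn; rewrite XB.
have nA : X <> TypeA by rewrite XB.
rewrite (omegaE i m1) (omega0 i nA) axis_lengthB // invr1 if_same ltnS leqn0.
by case: eqP => _ /=; ring.
Qed.

Lemma markC i : X = TypeC -> c i = if i.+1 == n then 1 else 2.
Proof.
move=> XC; have nA : X <> TypeA by rewrite XC.
rewrite -dot_omega_highest highestE highestC // dotZr (omega0 i nA) axis_lengthC //.
by case: eqP => _; [rewrite mulfV // pnatr_eq0|rewrite mulr1].
Qed.

Lemma simple_norm i : dot (Pi i) (Pi i) = if (i.+1 < m)%N then 2 else ax ^+ 2.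
Proof.
have im := leq_trans (ltn_ord i) (rank_le X n).
have [h1 h2] := simple_rootE R X i; have [lt|nlt] := boolP (i.+1 < m)%N.
  rewrite h1 // !dotE !dot_eps // !eqxx [i.+1 == i]gtn_eqF // [i == i.+1 :> nat]ltn_eqF //=.
  ring.
have [nA ->] := h2 nlt; rewrite !dotE dot_eps // eqxx mulr1 expr2 //.
Qed.

Lemma highest_norm : dot highest highest = by_type X 2 2 4.
Proof.
have n0 := rank_gt0; have m0 := dim_gt0; apply: three_types => XE.
- have nm : (n < m)%N by rewrite XE.
  rewrite highestA // !dotE !dot_eps // !eqxx (gtn_eqF n0) (ltn_eqF n0) by_typeA //=; ring.
- have m1 : (1 < m)%N by move: hn; rewrite XE.
  rewrite highestB // !dotE !dot_eps // by_typeB //=; ring.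
- rewrite highestC // !dotE !dot_eps // by_typeC //=; ring.
Qed.

Lemma classical_root_datum : root_datum Phi Pi omega c.
Proof.
split.
- exact: rank_gt0.
- exact: root_opp.
- exact: root_refl.
- exact: root_neq0.
- exact: root_prim.
- exact: root_simple.
- exact: root_orth.
- exact: homega.
- exact: omega_sign.
- exact: omega_int.
- exact: omega_span.
- exact: hc.1.
- exact: omega_highest.
(* The coroot of the highest root is that root itself in types A and B and half of it in type C, so
   it has integral coordinates. *)
- move=> be bP /=; rewrite highestE highest_norm; have ri k := root_int k bP.
  have n2 : (2 : R) != 0 by rewrite pnatr_eq0.
  have n4 : (4 : R) != 0 by rewrite pnatr_eq0.
  apply: three_types => XE; rewrite ?(by_typeA _ _ _ XE) ?(by_typeB _ _ _ XE) ?(by_typeC _ _ _ XE).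
  + by rewrite mulrAC divff // mul1r highestA // dotC dotBr rpredB.
  + by rewrite mulrAC divff // mul1r highestB // dotC dotDr rpredD.
  + rewrite highestC // dotC dotZr mulrA (_ : 2 * 2 = 4 :> R); last by ring.
    by rewrite mulrAC divff // mul1r.
(* In type A all marks are 1; in types B and C the inversion at marks 2 is [opposition]. *)
- move=> i; apply: three_types => XE; first by left; apply: markA.
    have [l lP hl] : exists2 l, {subset l <= Phi} &
        forall v, foldr (@reflection R m) v l = - v by apply: opposition; rewrite XE.
    rewrite markB //; case: ifP => _; [by left|right; split=> //].
    by exists l.
  have [l lP hl] : exists2 l, {subset l <= Phi} &
      forall v, foldr (@reflection R m) v l = - v by apply: opposition; rewrite XE.
  rewrite markC //; case: ifP => _; [by left|right; split=> //].
  by exists l.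
(* The value to be tested is 2 throughout in type A. In type B it is 2 at mark 1 and 8 or 4 at mark
   2, against 2 for the highest root; in type C it is 4 at mark 1 and 8 at mark 2, against 4. *)
- move=> i /=; rewrite highestE highest_norm simple_norm; apply: three_types => XE.
  + have im : (i.+1 < m)%N by rewrite XE ltnS ltn_ord.
    by rewrite markA // by_typeA // im; split=> // _; ring.
  + rewrite markB // axis_lengthB // by_typeB //.
    have [i0|i0] := eqVneq (i : nat) 0%N.
      have -> : (i.+1 < m)%N by move: hn; rewrite i0 XE.
      by split=> // _; ring.
    split=> [/eqP|]; first by rewrite (eqr_nat R 2 1).
    by case: ifP => _ E; exfalso; move: E; lra.
  + have nA : X <> TypeA by rewrite XE.
    rewrite markC // axis_lengthC // by_typeC // (dim_rank nA).
    have := ltn_ord i; rewrite leq_eqVlt; case: eqP => [-> _|_ /= ->].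
      by rewrite ltnn; split=> // _; ring.
    split=> [/eqP|E]; first by rewrite (eqr_nat R 2 1).
    by exfalso; move: E; lra.
Qed.

End ClassicalDatum.

Theorem mainTheorem3 (R : realType) (X : cartan_type) (n : nat)
    (hn : admissible_rank X n)
    (omega : 'I_n -> 'rV[R]_(ambient_dim X n)) (c : 'I_n -> R)
    (homega : fundamental_coweights (root_system R X n) (simple_roots R X n) omega)
    (hc : highest_root_coefficients (root_system R X n) (simple_roots R X n) c)
    (Delta : pecomplex R) (Apt : set (set (set Delta)))
    (hDelta : euclidean_building (coxeter_complex (root_system R X n)) Apt)
    (tau : Delta -> Delta -> 'I_n)
    (htau : standard_ordering (root_system R X n) omega c Apt tau) :
  combing (root_system R X n) Apt tau =
  local_combing (root_system R X n) omega c Apt tau.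
Proof.
have rd := classical_root_datum hn homega hc.
have [tauO [phi0 [A0 hA0 hphi0] std0]] := htau.
have st0 : standard_chart (root_system R X n) omega c Apt tau A0 phi0 by split.
apply/seteqP; split=> p hp.
  apply: (walks_sub_local rd hDelta tauO).
  exact: (combing_sub_walks rd hDelta tauO st0) hp.
apply: (walks_sub_combing rd).
exact: (local_sub_walks rd hDelta tauO st0) hp.
Qed.
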